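(* Let $n\ge2$, $X=\mathrm{SL}_n(\mathbb{Z})\backslash\mathrm{SL}_n(\mathbb{R})$, let $1\le m<n$, $d=m(n-m)$, and let $u$ be the associated $d$-dimensional abelian horospherical flow on $X$. Let $\delta>0$, let $x_0\in X$ be strongly polynomially $\delta$-Diophantine, put $\kappa=\min(m,n-m)$, fix $$0<\alpha<\frac{\delta bn}{9d(d^2+bn\kappa)},$$ and for $T>0$ let $P=P(T)$ be the product of all primes less than $T^\alpha$. Then for any positive $f\in C_c^\infty(X)$ there exists a sequence $T_i\to\infty$ as $i\to\infty$ such that for all $i$ $$\sum_{\substack{\mathbf k\in B_{T_i}\cap\mathbb{Z}^d\\ \gcd(k_1\cdots k_d,P(T_i))=1}}f(x_0u(\mathbf k))\ \asymp\ \left(\frac{T_i}{\log T_i}\right)^d\int_Xf\,dm_X .$$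
   Context: $U=\left\{\begin{pmatrix}I_m&*\\0&I_{n-m}\end{pmatrix}\right\}$ and $u:\mathbb{R}^d\to U$ is the group isomorphism given by an identification of the coordinates of $\mathbf t$ with the entries of the upper-right block (one per entry), acting on $X$ by right multiplication. $B_T=[0,T]^d$. $\Gamma=\mathrm{SL}_n(\mathbb{Z})$. $m_X$ is the invariant probability measure on $X$. ''Positive'' means $f\ge0$. $G=\mathrm{SL}_n(\mathbb{R})$ acts on $\Lambda^j(\mathbb{R}^n)$ on the right by $(e_{i_1}\wedge\cdots\wedge e_{i_j})g=(e_{i_1}g)\wedge\cdots\wedge(e_{i_j}g)$; for $w=\sum_Iw_Ie_I$ in the standard basis, $\|w\|=\max_I|w_I|$; $\Lambda^j(\mathbb{Z}^n)$ is the set of integer combinations of the $e_I$. A point $x=\Gamma g$ is strongly polynomially $\delta$-Diophantine if there exists a sequence $T_i\to\infty$ such that for all $i\in\mathbb{N}$ $$\inf_{\substack{w\in\Lambda^j(\mathbb{Z}^n)\setminus\{0\}\\ j=1,\dots,n-1}}\ \sup_{\mathbf t\in[0,T_i]^d}\|w\,g\,u(\mathbf t)\|>T_i^\delta .$$ The constant $b$: put $\ell=n(n-1)/2$; fix a basis $\mathcal{B}$ of the Lie algebra of $G$ acting by $Yf(x)=\frac{d}{dt}f(x\exp(tY))|_{t=0}$, and let $\mathcal{S}_{\infty,\ell}(f)=\sum_{\deg\mathcal{D}\le\ell}\|\mathcal{D}f\|_{L^\infty(X)}$ over monomials in $\mathcal{B}$ of degree at most $\ell$ (including degree $0$). Say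 $x_0=\Gamma g_0$ satisfies $\mathrm{Dio}(T,R)$ if for all $j\in\{1,\dots,n-1\}$ and all $w\in\Lambda^j(\mathbb{Z}^n)\setminus\{0\}$ there exists $\mathbf t\in[0,T]^d$ with $\|w\,g_0\,u(\mathbf t)\|\ge R^{d/n}$. Then $0<b<1$ is a fixed constant depending only on $n,d$ such that, for some constant $C>0$ depending only on $n,d$, $$\left|\frac1{T^d}\int_{[0,T]^d}\psi(\mathbf t)\Big(f(x_0u(\mathbf t))-\int_Xf\,dm_X\Big)d\mathbf t\right|\ll R^{-b}\mathcal{S}_{\infty,\ell}(f)$$ for all $x_0$ satisfying $\mathrm{Dio}(T,R)$ with $T>R>C$, all $f\in C_c^\infty(X)$ and all additive characters $\psi(\mathbf t)=e^{i\mathbf a\cdot\mathbf t}$, $\mathbf a\in\mathbb{R}^d$. (Such a $b$ exists.) $a\asymp a'$ means $c_1a'\le a\le c_2a'$ with constants $c_1,c_2>0$ depending only on $n$, $d$ (with $\delta$ and $\alpha$ regarded as fixed), and not on $f$, $x_0$ or $i$; $\ll$ has the analogous meaning. *)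

(* Defs.v *)
From HB Require Import structures.
From mathcomp Require Import all_boot all_order all_algebra.
From mathcomp Require Import all_classical all_reals all_analysis.
From mathcomp Require Import complex.

Set Implicit Arguments.
Unset Strict Implicit.
Unset Printing Implicit Defensive.

Import Order.TTheory GRing.Theory Num.Theory.
Import numFieldNormedType.Exports.

Local Open Scope classical_set_scope.
Local Open Scope ring_scope.

Section LebesgueTuple.
Variable R : realType.

Definition tcons d (p : measurableTypeR R * d.-tuple (measurableTypeR R)) :
  d.+1.-tuple (measurableTypeR R) := [the d.+1.-tuple _ of p.1 :: p.2].

Lemma measurable_tcons d : measurable_fun [set: _] (@tcons d).
Proof. by apply: measurable_cons. Qed.

Section Step.
Variables (d : nat)
  (mu : {sigma_finite_measure set (d.-tuple (measurableTypeR R)) -> \bar R}).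

Definition leb_step : set (d.+1.-tuple (measurableTypeR R)) -> \bar R :=
  pushforward (@lebesgue_measure R \x mu)%E (@tcons d).

Let leb_step0 : leb_step set0 = 0%E.
Proof. by rewrite /leb_step /pushforward preimage_set0 measure0. Qed.

Let leb_step_ge0 A : (0 <= leb_step A)%E.
Proof. by rewrite /leb_step /pushforward; exact: measure_ge0. Qed.

Let leb_step_additive : semi_sigma_additive leb_step.
Proof.
move=> F mF tF mUF; rewrite /leb_step /pushforward preimage_bigcup.
have mt := @measurable_tcons d.
apply: measure_semi_sigma_additive.
- by move=> n; rewrite -[X in measurable X]setTI; exact: mt.
- apply/trivIsetP => /= i j _ _ ij; rewrite -preimage_setI.
  by move/trivIsetP : tF => /(_ _ _ _ _ ij) ->//; rewrite preimage_set0.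
- by rewrite -preimage_bigcup -[X in measurable X]setTI; exact: mt.
Qed.

HB.instance Definition _ := isMeasure.Build _ _ _ leb_step
  leb_step0 leb_step_ge0 leb_step_additive.

Let leb_step_sigma_finite : sigma_finite setT leb_step.
Proof.
have [F TF Foo] : sigma_finite setT (@lebesgue_measure R \x mu)%E.
  have /sigma_finiteP[F [TF ndF Foo]] := sigma_finiteT (@lebesgue_measure R :
    {sigma_finite_measure set (measurableTypeR R) -> \bar R}).
  have /sigma_finiteP[G [TG ndG Goo]] := sigma_finiteT mu.
  exists (fun n => F n `*` G n).
    rewrite -setXTT TF TG predeqE => -[x y]; split.
      move=> [/= [n _ Fnx] [k _ Gky]]; exists (maxn n k) => //; split.
      - by move: x Fnx; exact/subsetPset/ndF/leq_maxl.
      - by move: y Gky; exact/subsetPset/ndG/leq_maxr.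
    by move=> [n _ []/= ? ?]; split; exists n.
  move=> k; have [? ?] := Foo k; have [? ?] := Goo k.
  split; first exact: measurableX.
  by rewrite product_measure1E// lte_mul_pinfty// ge0_fin_numE.
pose uncons (t : d.+1.-tuple (measurableTypeR R)) :
  measurableTypeR R * d.-tuple (measurableTypeR R) :=
  (thead t, [tuple of behead t]).
have unconsK : cancel uncons (@tcons d).
  by move=> t; rewrite [RHS](tuple_eta t); apply/val_inj.
have tconsK : cancel (@tcons d) uncons.
  by move=> [x t]; rewrite /uncons /= ; congr pair; apply/val_inj.
have mu' : measurable_fun [set: _] uncons.
  apply/measurable_fun_pairP; split => /=.
    exact: measurable_tnth.
  exact: measurable_behead.
exists (fun k => uncons @^-1` F k).
  by rewrite -preimage_bigcup -TF preimage_setT.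
move=> k; have [mFk Fk] := Foo k; split.
  by rewrite -[X in measurable X]setTI; exact: mu'.
rewrite /leb_step /pushforward -comp_preimage.
rewrite (_ : _ \o _ = id); first by [].
by apply/funext => p /=; rewrite tconsK.
Qed.

HB.instance Definition _ := Measure_isSigmaFinite.Build _ _ _ leb_step
  leb_step_sigma_finite.

End Step.

Fixpoint leb d :
    {sigma_finite_measure set (d.-tuple (measurableTypeR R)) -> \bar R} :=
  match d with
  | 0 => \d_([tuple] : 0.-tuple (measurableTypeR R))
  | d'.+1 => leb_step (leb d')
  end.

End LebesgueTuple.

Section Space.
Variables (R : realType) (n : nat).

Definition SL : Type := {g : 'M[R]_n | \det g == 1}.

HB.instance Definition _ := Choice.on SL.
HB.instance Definition _ := [isSub of SL for @sval _ _].

Definition SL1 : SL := exist _ 1%:M (introT eqP (det1 R n)).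

HB.instance Definition _ := isPointed.Build SL SL1.

Definition SLtop : Type := initial_topology (val : SL -> 'M[R]_n).

HB.instance Definition _ := PointedTopological.on SLtop.

Definition sameSLZ (g h : SLtop) : bool :=
  `[< exists2 c : 'M[int]_n, \det c = 1 &
      map_mx (fun z : int => z%:~R) c *m val g = val h >].

Lemma sameSLZ_refl : reflexive sameSLZ.
Proof.
move=> g; apply/asboolP; exists 1%:M; first exact: det1.
by rewrite map_mx1 mul1mx.
Qed.

Lemma sameSLZ_half g h : sameSLZ g h -> sameSLZ h g.
Proof.
move=> /asboolP[c c1 cgh]; apply/asboolP.
have cu : c \in unitmx by rewrite unitmxE c1 unitr1.
exists (invmx c); first by rewrite det_inv c1 invr1.
by rewrite -cgh mulmxA -map_mxM mulVmx// map_mx1 mul1mx.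
Qed.

Lemma sameSLZ_sym : symmetric sameSLZ.
Proof. by move=> g h; apply/idP/idP; exact: sameSLZ_half. Qed.

Lemma sameSLZ_trans : transitive sameSLZ.
Proof.
move=> h g k /asboolP[c c1 cgh] /asboolP[e e1 ehk]; apply/asboolP.
exists (e *m c); first by rewrite det_mulmx c1 e1 mulr1.
by rewrite map_mxM -mulmxA cgh.
Qed.

Definition sameSLZ_equiv : equiv_rel SLtop :=
  EquivRel sameSLZ sameSLZ_refl sameSLZ_sym sameSLZ_trans.

Definition lattices : Type :=
  quotient_topology {eq_quot sameSLZ_equiv}%qT.

HB.instance Definition _ := PointedTopological.on lattices.

Definition borelX : Type := g_sigma_algebraType (@open lattices).

HB.instance Definition _ := Measurable.on borelX.

Definition toX (g : SL) : lattices := (\pi_lattices (g : SLtop))%qT.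

(* Only meant for [h] of determinant 1, the case in which [insubd] does not
   fall back to its default value. *)
Definition act (x : lattices) (h : 'M[R]_n) : lattices :=
  toX (insubd SL1 (val (repr x) *m h)).

(* Among probability measures on the Borel sets of X, this property singles
   out the one induced by Haar measure. *)
Definition SL_invariant (mX : probability borelX R) :=
  forall (h : SL) (A : set borelX), measurable A ->
    mX ((fun x : borelX => act x (val h) : borelX) @^-1` A) = mX A.

End Space.

Section Smooth.
Variables (R : realType) (n : nat).
Implicit Types (Y : 'M[R]_n) (f : lattices R n -> R).

Definition expmx Y : 'M[R]_n :=
  limn (series (fun k : nat => (k`!%:R)^-1 *: Y ^+ k)).

Definition slv : {vspace 'M[R]_n} :=
  lker (linfun (@mxtrace R n : 'M[R]_n -> R^o)).

Definition lie Y f : lattices R n -> R :=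
  fun x => derive1 (fun t : R => f (act x (expmx (t *: Y)))) 0.

Definition lies (s : seq 'M[R]_n) f := foldr lie f s.

(* C^oo-smoothness through the left-invariant vector fields, which form a
   global frame of the tangent bundle: all iterated derivatives along them
   exist and are continuous. *)
Definition smooth f :=
  forall s : seq 'M[R]_n, {in s, forall Y, Y \in slv} ->
    continuous (lies s f) /\
    forall Y x, Y \in slv ->
      derivable (fun t : R => lies s f (act x (expmx (t *: Y)))) 0 1.

Definition Cc_smooth f :=
  smooth f /\ compact (closure [set x | f x != 0]).

(* Monomials of degree k are all the words of length k in the basis. *)
Definition sobolev (mX : probability (borelX R n) R) (B : seq 'M[R]_n)
    (l : nat) f : \bar R :=
  (\sum_(k < l.+1) \sum_(w : k.-tuple 'I_(size B))
    Lnorm mX +oo (fun x : borelX R n =>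
      (lies [seq B`_i | i : 'I_(size B) <- w] f x)%:E))%E.

End Smooth.

Section Flow.
Variables (R : realType) (n d : nat) (phi : 'I_d -> 'I_n * 'I_n).

(* [phi] identifies the coordinates of R^d with the entries of the upper-right
   m x (n - m) block. *)
Definition block_coords (m : nat) :=
  injective phi /\
  forall i j : 'I_n, (exists k, phi k = (i, j)) <-> (i < m <= j)%N.

Definition horo (t : d.-tuple R) : 'M[R]_n :=
  1%:M + \sum_k tnth t k *: delta_mx (phi k).1 (phi k).2.

Definition box (T : R) : set (d.-tuple R) :=
  [set t | forall k, 0 <= tnth t k <= T].

End Flow.

Section Exterior.
Variables (R : realType) (n : nat).

(* [w I] is the coordinate of [w] on [e_I = e_{i_1} /\ ... /\ e_{i_j}], where
   [I = {i_1 < ... < i_j}]. *)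
Definition ext : Type := {ffun {set 'I_n} -> R}.

Definition wedge (v w : ext) : ext :=
  [ffun K : {set 'I_n} => \sum_(I : {set 'I_n} | I \subset K)
    (-1) ^+ #|[pred p : 'I_n * 'I_n | [&& p.1 \in I, p.2 \in K :\: I
                                 & (p.2 < p.1)%N]]|
    * v I * w (K :\: I)].

Definition ext1 : ext := [ffun I => (I == finset.set0)%:R].

Definition ext_vec (v : 'rV[R]_n) : ext :=
  [ffun I => \sum_(i | I == finset.set1 i) v 0 i].

(* e_I acted on by g; [enum I] lists I in increasing order. *)
Definition ext_basis_act (I : {set 'I_n}) (g : 'M[R]_n) : ext :=
  \big[wedge/ext1]_(i <- enum I) ext_vec (row i g).

Definition ext_act (w : ext) (g : 'M[R]_n) : ext :=
  [ffun J => \sum_I w I * ext_basis_act I g J].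

Definition ext_norm (w : ext) : R := \big[Num.max/0]_I `|w I|.

Definition ext_deg (j : nat) (w : {ffun {set 'I_n} -> int}) :=
  forall I : {set 'I_n}, #|I| != j -> w I = 0.

Definition ext_of_int (w : {ffun {set 'I_n} -> int}) : ext :=
  [ffun I => (w I)%:~R].

(* The union over j = 1, ..., n - 1 of the nonzero vectors of the lattices
   [Lambda^j(Z^n)]. *)
Definition int_multivectors : set {ffun {set 'I_n} -> int} :=
  [set w | w != 0 /\ exists j : nat, (0 < j < n)%N /\ ext_deg j w].

End Exterior.

Section Dio.
Variables (R : realType) (n d : nat) (phi : 'I_d -> 'I_n * 'I_n).
Implicit Types (x : lattices R n).

Definition wgu (w : {ffun {set 'I_n} -> int}) (g : SL R n) (t : d.-tuple R) :=
  ext_norm (ext_act (ext_of_int R w) (val g *m horo phi t)).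

Definition strongly_poly_dio (delta : R) x :=
  exists2 g : SL R n, x = toX g &
  exists2 T : nat -> R, T i @[i --> \oo] --> +oo &
  forall i,
    ((T i `^ delta)%:E <
     ereal_inf [set ereal_sup [set (wgu w g t)%:E | t in box (T i)]
               | w in @int_multivectors n])%E.

Definition Dio (T S : R) x :=
  exists2 g : SL R n, x = toX g &
  forall w, @int_multivectors n w ->
    exists2 t, box T t & S `^ (d%:R / n%:R) <= wgu w g t.

Definition int_box (T : R) (F : d.-tuple R -> R[i]) : R[i] :=
  Complex (\int[@leb R d]_(t in box T) complex.Re (F t))
          (\int[@leb R d]_(t in box T) complex.Im (F t)).

Definition additive_char (a t : d.-tuple R) : R[i] :=
  let s := \sum_k tnth a k * tnth t k in Complex (cos s) (sin s).

(* For the real-valued f used here the estimate is equivalent to the one for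
   complex-valued f, up to doubling K. *)
Definition equidistribution_exponent (B : seq 'M[R]_n)
    (mX : probability (borelX R n) R) (b : R) :=
  0 < b < 1 /\
  exists C K : R, [/\ 0 < C, 0 < K &
  forall (T S : R) x (f : lattices R n -> R) (a : d.-tuple R),
    C < S -> S < T -> Dio T S x -> Cc_smooth f ->
    ((Normc.normc ((T ^+ d)^-1%:C%C *
        int_box T (fun t => additive_char a t *
          (f (act x (horo phi t)) - \int[mX]_y f y)%:C%C)))%:E
     <= (K * S `^ (- b))%:E * sobolev mX B (n * n.-1)./2 f)%E].

Definition primorial (y : R) : nat :=
  \prod_(0 <= p < (Num.truncn y).+1 | prime p && (p%:R < y)) p.

Definition sieved_box (T y : R) : set (d.-tuple int) :=
  [set k | @box R d T (map_tuple (fun z : int => z%:~R) k) /\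
           coprimez (\prod_i tnth k i) (primorial y)].

End Dio.

(* Main.v *)
From HB Require Import structures.
Require Import Defs.
From mathcomp Require Import all_boot all_order all_algebra.
From mathcomp Require Import all_classical all_reals all_analysis.
From mathcomp Require Import measurable_realfun ess_sup_inf ring lra zify complex.

Set Implicit Arguments.
Unset Strict Implicit.
Unset Printing Implicit Defensive.

Import Order.TTheory GRing.Theory Num.Theory.
Import numFieldNormedType.Exports.

Local Open Scope classical_set_scope.
Local Open Scope ring_scope.

(** Let F(t) = f(x0 u(t)) and let mu be the integral of f. The sum of F over the
    integer points of [0, T]^d whose coordinates have no prime factor below
    y = T^alpha is a sieve problem in d coordinates: if the sums of F over the
    points with q_i | k_i for all i are mu T^d / (q_1 ... q_d) up to an error
    uniform in q, then a sieve of dimension 1 in each coordinate gives the right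
    order of magnitude mu (T / ln T)^d, by Mertens' product.

    The hypothesis on b controls the integral of F - mu against every character
    over the cube, with one bound E0 for all characters, provided x0 satisfies
    the condition Dio(T, T^theta). The value F(k) is therefore replaced by the
    integral of F against a product of tents of width 1 / N around k. Summed over
    the multiples of q, the tents form a periodic function, which by Fejer's
    kernel is a uniform limit of combinations of cosines with nonnegative
    coefficients of sum at most 1 (tent_approx). Hence the smoothed sums along
    q_i | k_i have the expected size with the error E0 whatever q is
    (sample_level), and smoothing costs O(1 / N) because f is Lipschitz along the
    flow (horo_lipschitz, sample_value).

    As the error is uniform in q, what matters in the sieve is the number of its
    terms. The Brun-Hooley sieve (sieve_bounds) cuts the primes into ranges
    whose end points are successive squares, truncates inclusion-exclusion
    separately in each range by Bonferroni's inequalities, and recovers a lower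
    bound by replacing one factor at a time (prod_defect); it uses
    y^(4 d^2 + 4 d + 1) terms up to constants and logarithms.

    So one needs alpha (4 d^2 + 4 d + 1) < b theta, with a little to spare for
    N = T^rho. The Diophantine hypothesis provides every theta < delta n / d at
    arbitrarily large times (strongly_dio), and 4 d^2 + 4 d + 1 <= 9 d^2, so the
    upper bound on alpha leaves room for such a theta. The condition
    T^theta < T is automatic, since the pigeonhole principle forces delta <= m / n
    (dio_exponent_le). All errors are then smaller than the main term by a power
    of T, although they depend on f: its Sobolev norm is finite because its
    derivatives are continuous with compact support (sobolev_bounded). If
    mu = 0 there is no main term, but then f = 0, because nonempty open sets have
    positive measure (integral_eq0_eq0). *)

(** * Mertens' product over primes *)

Definition prime_prod (n : nat) : nat := (\prod_(0 <= p < n.+1 | prime p) p)%N.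

Lemma prod_primes_dvd (s : seq nat) (N : nat) :
  uniq s -> all prime s -> all (fun p => p %| N)%N s -> (\prod_(p <- s) p %| N)%N.
Proof.
elim: s => [|p s IHs] /=; first by rewrite big_nil dvd1n.
move=> /andP[ps us] /andP[pp sp] /andP[pN sN]; rewrite big_cons Gauss_dvd.
  by rewrite pN IHs.
rewrite big_seq; apply: (big_ind (fun m => coprime p m)).
- exact: coprimen1.
- by move=> a b; rewrite coprimeMr => -> ->.
move=> q qs; have pq : prime q by exact: (allP sp).
rewrite prime_coprime// dvdn_prime2//.
by apply: contra ps => /eqP ->.
Qed.

(** The primes in (h, 2h] divide the binomial coefficient C(2h, h), which is at
    most 4^h. *)
Lemma prime_prod_double (h : nat) : (prime_prod h.*2 <= prime_prod h * 4 ^ h)%N.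
Proof.
have -> : prime_prod h.*2 = (prime_prod h * \prod_(h.+1 <= p < h.*2.+1 | prime p) p)%N.
  by rewrite /prime_prod -big_cat_nat //= ltnS -addnn leq_addr.
rewrite leq_mul2l; apply/orP; right.
have hC : ('C(h.*2, h) <= 4 ^ h)%N.
  have -> : (4 ^ h = 2 ^ h.*2)%N by rewrite -mul2n expnM.
  have lt : (h < h.*2.+1)%N by rewrite ltnS -addnn leq_addr.
  rewrite -[2%N]/(1 + 1)%N expnDn (bigD1 (Ordinal lt)) //= !exp1n !muln1.
  exact: leq_addr.
apply: leq_trans hC; apply: dvdn_leq; first by rewrite bin_gt0 -addnn leq_addr.
rewrite -big_filter; apply: prod_primes_dvd.
- by rewrite filter_uniq // iota_uniq.
- exact: filter_all.
apply/allP => p; rewrite mem_filter mem_index_iota => /andP[pp /andP[hp p2]].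
have := bin_fact (leq_addr h h); rewrite addnK addnn => E.
have : (p %| h.*2`!)%N by rewrite dvdn_fact // prime_gt0.
rewrite -E !Euclid_dvdM //.
have nd : (p %| h`!)%N = false.
  apply/negP => H.
  have : (0 < logn p h`!)%N by rewrite logn_gt0 mem_primes pp fact_gt0.
  rewrite logn_fact // big_nat_cond big1 // => k /andP[/andP[k1 _] _].
  by rewrite divn_small // (leq_trans hp) // -{1}(expn1 p) leq_exp2l // prime_gt1.
by rewrite nd !orbF.
Qed.

(** Chebyshev's bound, by halving n; 16 instead of 4 absorbs the rounding up of
    n / 2 and keeps the induction short. *)
Lemma prime_prod_le (n : nat) : (prime_prod n <= 16 ^ n)%N.
Proof.
elim/ltn_ind: n => n IH.
have [n1|n1] := leqP n 1.
  by case: n {IH} n1 => [|[|//]] _; rewrite /prime_prod unlock.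
have hn : (uphalf n < n)%N by lia.
have le2 : (n <= (uphalf n).*2)%N by lia.
apply: (@leq_trans (prime_prod (uphalf n).*2)).
  rewrite /prime_prod [leqRHS](big_cat_nat _ (n := n.+1)) //= leq_pmulr//.
  rewrite prodn_cond_gt0// => p; exact: prime_gt0.
apply: leq_trans (prime_prod_double _) _.
apply: leq_trans (leq_mul (IH _ hn) (leqnn _)) _.
rewrite -expnMn -[(16 * 4)%N]/(4 ^ 3)%N -[16%N]/(4 ^ 2)%N -!expnM leq_exp2l//.
lia.
Qed.

Section Mertens.
Variable R : realType.
Implicit Types (n p : nat).

Definition ln_nat n : R := ln n%:R.
Definition mertens_sum n : R := \sum_(0 <= p < n.+1 | prime p) ln_nat p / p%:R.

Lemma ln_nat_ge0 n : 0 <= ln_nat n.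
Proof.
by case: n => [|n]; [rewrite /ln_nat ln0 | rewrite /ln_nat ln_ge0// ler1n].
Qed.

Lemma ln_prodn (I : Type) (r : seq I) (P : pred I) (F : I -> nat) :
  (forall i, P i -> 0 < F i)%N ->
  ln_nat (\prod_(i <- r | P i) F i)%N = \sum_(i <- r | P i) ln_nat (F i).
Proof.
move=> F0.
suff: (0 < \prod_(i <- r | P i) F i)%N /\
  ln_nat (\prod_(i <- r | P i) F i)%N = \sum_(i <- r | P i) ln_nat (F i) by case.
elim/big_rec2 : _ => [|i y1 y2 Pi [y0 E]]; first by rewrite /ln_nat ln1.
split; first by rewrite muln_gt0 F0.
by rewrite /ln_nat natrM lnM ?posrE ?ltr0n ?F0// -E.
Qed.

Lemma ln_fact n :
  ln_nat n`! = \sum_(0 <= p < n.+1 | prime p) (logn p n`!)%:R * ln_nat p.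
Proof.
have E : n`! = (\prod_(0 <= p < n.+1 | prime p) p ^ logn p n`!)%N.
  rewrite -[LHS]partnT ?fact_gt0// (widen_partn (m := maxn n n`!)) ?leq_maxr//.
  rewrite (big_cat_nat _ (n := n.+1)) ?ltnS ?leq_maxl//= [X in (_ * X)%N]big_nat_cond.
  rewrite [X in (_ * X)%N]big1 ?muln1.
    rewrite [LHS](bigID prime) /= [X in (_ * X)%N]big1 ?muln1//.
    by move=> p /= np; rewrite lognE (negbTE np).
  move=> p /andP[/andP[np _] _]; rewrite lognE; case: ifP => // /and3P[pp _ pd].
  have : (p %| n`!)%N = false; last by rewrite pd.
  apply/negP => _; have : (0 < logn p n`!)%N by rewrite logn_gt0 mem_primes pp fact_gt0.
  rewrite logn_fact // big_nat_cond big1 // => k /andP[/andP[k1 _] _].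
  by rewrite divn_small // (leq_trans np) // -{1}(expn1 p) leq_exp2l // prime_gt1.
rewrite {1}E ln_prodn; last by move=> p pp; rewrite expn_gt0 prime_gt0.
apply: eq_bigr => p pp; rewrite /ln_nat natrX lnXn ?ltr0n ?prime_gt0//.
by rewrite mulr_natl.
Qed.

Lemma ln_fact_le n : ln_nat n`! <= n%:R * ln_nat n.
Proof.
case: n => [|n]; first by rewrite mul0r /ln_nat fact0 ln1.
rewrite mulr_natl -lnXn ?ltr0n// -natrX ler_ln ?posrE ?ltr0n ?fact_gt0 ?expn_gt0//.
rewrite ler_nat fact_prod.
have -> : (n.+1 ^ n.+1)%N = (\prod_(1 <= i < n.+2) n.+1)%N.
  by rewrite prod_nat_const_nat subn1.
rewrite big_nat_cond [leqRHS]big_nat_cond; apply: leq_prod => i /andP[/andP[_ ?] _]; lia.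
Qed.

Lemma ln_fact_ge n : n%:R * ln_nat n - n%:R <= ln_nat n`!.
Proof.
elim: n => [|n IH]; first by rewrite mul0r subr0 ln_nat_ge0.
have -> : ln_nat n.+1`! = ln_nat n.+1 + ln_nat n`!.
  by rewrite /ln_nat factS natrM lnM ?posrE ?ltr0n ?fact_gt0.
case: n IH => [|n] IH; first by rewrite fact0 /ln_nat ln1 mul1r; lra.
have H : n.+1%:R * (ln_nat n.+2 - ln_nat n.+1) <= 1.
  rewrite -ln_div ?posrE ?ltr0n//.
  have -> : n.+2%:R / n.+1%:R = 1 + n.+1%:R^-1 :> R.
    by rewrite -(natr1 n.+1) mulrDl divff ?pnatr_eq0// mul1r.
  rewrite -ler_pdivlMl ?ltr0n// mulr1 le_ln1Dx//.
  by rewrite (lt_trans _ (_ : 0 < _)) ?invr_gt0 ?ltr0n// ltrN10.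
rewrite -(natr1 n.+1) in IH H *; set x := ln_nat n.+2 in H *; set y := ln_nat n.+1 in IH H *.
set m := n.+1%:R in IH H *; nra.
Qed.

(** The upper half of Mertens' first theorem: compare ln n! with n ln n, the
    fractional parts costing at most Chebyshev's bound. *)
Lemma mertens_sum_le n : (0 < n)%N -> mertens_sum n <= ln_nat n + ln 16.
Proof.
move=> n0; have n0' : 0 < n%:R :> R by rewrite ltr0n.
have H1 : \sum_(0 <= p < n.+1 | prime p) (n%:R / p%:R - 1) * ln_nat p <= ln_nat n`!.
  rewrite ln_fact big_nat_cond [leRHS]big_nat_cond; apply: ler_sum => p /andP[/andP[_ pn] pp].
  apply: ler_wpM2r; first exact: ln_nat_ge0.
  have p0 : 0 < p%:R :> R by rewrite ltr0n prime_gt0.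
  rewrite lerBlDr ler_pdivrMr// natr1 -natrM ler_nat.
  have : (n %/ p <= logn p n`!)%N.
    rewrite logn_fact// big_ltn//= expn1 ?leq_addr//; lia.
  move=> H; rewrite (leq_trans (ltnW (ltn_ceil n (prime_gt0 pp))))//.
  by rewrite leq_mul2r orbC ltnS H.
have H2 : \sum_(0 <= p < n.+1 | prime p) ln_nat p <= n%:R * ln 16.
  rewrite -ln_prodn; last by move=> p; exact: prime_gt0.
  rewrite -/(prime_prod n) mulr_natl -lnXn ?ltr0n// -natrX ler_ln ?posrE ?ltr0n ?expn_gt0//.
    by rewrite ler_nat prime_prod_le.
  by rewrite prodn_cond_gt0// => p; exact: prime_gt0.
have E : \sum_(0 <= p < n.+1 | prime p) (n%:R / p%:R - 1) * ln_nat p =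
    n%:R * mertens_sum n - \sum_(0 <= p < n.+1 | prime p) ln_nat p.
  rewrite /mertens_sum mulr_sumr -sumrB; apply: eq_bigr => p _; ring.
rewrite -(ler_pM2l n0') mulrDr.
by have := ln_fact_le n; lra.
Qed.

(** The contribution of proper prime powers to ln n!. It converges because
    (ln m + 2) / m decreases by at least ln m / (m (m - 1)) at each step. *)
Lemma sum_prime_powers_le n :
  \sum_(0 <= p < n.+1 | prime p) ln_nat p / (p%:R * (p%:R - 1)) <= 3.
Proof.
pose g (m : nat) : R := (ln_nat m + 2) / m%:R.
have g0 m : 0 <= g m by rewrite divr_ge0 ?addr_ge0 ?ln_nat_ge0.
have key m : (2 <= m)%N -> ln_nat m / (m%:R * (m%:R - 1)) <= g m.-1 - g m.
  case: m => [//|[//|m]] _; rewrite /g /=.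
  have H : m.+2%:R * (ln_nat m.+2 - ln_nat m.+1) <= 2.
    rewrite -ln_div ?posrE ?ltr0n//.
    have -> : m.+2%:R / m.+1%:R = 1 + m.+1%:R^-1 :> R.
      by rewrite -(natr1 m.+1) mulrDl divff ?pnatr_eq0// mul1r.
    have le : ln (1 + m.+1%:R^-1) <= m.+1%:R^-1 :> R.
      by rewrite le_ln1Dx// (lt_trans _ (_ : 0 < _)) ?invr_gt0 ?ltr0n// ltrN10.
    apply: le_trans (ler_wpM2l _ le) _ => //.
    by rewrite ler_pdivrMr ?ltr0n// -natrM ler_nat; lia.
  have m1 : 0 < m.+1%:R :> R by rewrite ltr0n.
  have m2 : m.+2%:R = m.+1%:R + 1 :> R by rewrite natr1.
  rewrite m2 in H *; move: m1 H; set x := m.+1%:R; set a := ln_nat m.+2; set b := ln_nat m.+1.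
  move=> x0 H; rewrite -subr_ge0.
  have -> : (b + 2) / x - (a + 2) / (x + 1) - a / ((x + 1) * (x + 1 - 1)) =
     (2 - (x + 1) * (a - b)) / (x * (x + 1)).
    by field; rewrite !gt_eqF//; lra.
  by rewrite divr_ge0 ?mulr_ge0//; lra.
have [n1|n1] := leqP n 1.
  by case: n n1 => [|[|//]] _; rewrite unlock.
rewrite big_ltn_cond// [prime 0]/= big_ltn_cond ?ltnS 1?ltnW// [prime 1]/= big_mkcond /=.
apply: (@le_trans _ _ (\sum_(2 <= p < n.+1) (g p.-1 - g p))).
  rewrite big_nat_cond [leRHS]big_nat_cond; apply: ler_sum => p /andP[/andP[p2 _] _].
  case: ifP => _; first exact: key.
  apply: le_trans (key _ p2); rewrite divr_ge0 ?ln_nat_ge0// mulr_ge0//.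
  by rewrite subr_ge0 ler1n; lia.
have -> : \sum_(2 <= p < n.+1) (g p.-1 - g p) = g 1%N - g n.
  rewrite -opprB -(@telescope_sumr _ 1 n g) 1?ltnW// -sumrN big_add1 /=.
  by apply: eq_bigr => i _; rewrite opprB.
have -> : g 1%N = 2 by rewrite /g /ln_nat ln1 add0r divr1.
by have := g0 n; lra.
Qed.

(** The lower half of Mertens' first theorem: the exponent of p in n! is at most
    n / (p - 1), and 1 / (p - 1) differs from 1 / p by a summable amount. *)
Lemma mertens_sum_ge n : (0 < n)%N -> ln_nat n - 4 <= mertens_sum n.
Proof.
move=> n0; have n0' : 0 < n%:R :> R by rewrite ltr0n.
have H1 : ln_nat n`! <= \sum_(0 <= p < n.+1 | prime p)
    n%:R * (ln_nat p / p%:R + ln_nat p / (p%:R * (p%:R - 1))).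
  rewrite ln_fact; apply: ler_sum => p pp.
  have p0 : 0 < p%:R :> R by rewrite ltr0n prime_gt0.
  have p1 : 1 < p%:R :> R by rewrite ltr1n prime_gt1.
  have -> : n%:R * (ln_nat p / p%:R + ln_nat p / (p%:R * (p%:R - 1))) =
      n%:R / (p%:R - 1) * ln_nat p.
    by field; rewrite !gt_eqF//; lra.
  apply: ler_wpM2r; first exact: ln_nat_ge0.
  rewrite logn_fact// natr_sum.
  suff H N : \sum_(1 <= k < N.+1) (n %/ p ^ k)%:R <= (n%:R / (p%:R - 1)) * (1 - p%:R ^- N) :> R.
    apply: le_trans (H n) _; rewrite ler_piMr//.
      by rewrite divr_ge0 ?subr_ge0// ltW.
  elim: N => [|N IH]; first by rewrite big_geq// expr0 invr1 subrr mulr0.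
  rewrite big_nat_recr //=.
  have H : (n %/ p ^ N.+1)%:R <= n%:R * p%:R ^- N.+1 :> R.
    rewrite ler_pdivlMr ?exprn_gt0// -natrX -natrM ler_nat; exact: leq_trunc_div.
  apply: le_trans (lerD IH H) _; rewrite exprS.
  have q0 : 0 < p%:R ^+ N :> R by rewrite exprn_gt0.
  rewrite le_eqVlt; apply/orP; left; apply/eqP; field.
  by rewrite !gt_eqF//; lra.
have := le_trans (ln_fact_ge n) H1.
rewrite -mulr_sumr big_split /= -/(mertens_sum n) => H.
have := sum_prime_powers_le n; rewrite -(ler_pM2l n0') => H3.
rewrite -(ler_pM2l n0'); nra.
Qed.

Definition mertens_prod n : R := \prod_(0 <= p < n | prime p) (1 - p%:R^-1).

Lemma mertens_factor p : prime p -> 0 < 1 - p%:R^-1 :> R /\ 1 - p%:R^-1 <= 1 :> R.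
Proof.
move=> pp; have p1 : 1 < p%:R :> R by rewrite ltr1n prime_gt1.
split; last by rewrite gerBl.
by rewrite subr_gt0 invf_lt1// (lt_trans _ p1).
Qed.

Lemma mertens_prod_gt0 n : 0 < mertens_prod n.
Proof. by apply: prodr_gt0 => p pp; case: (mertens_factor pp). Qed.

Definition prime_inv_sum n : R := \sum_(0 <= p < n.+1 | prime p) p%:R^-1.

(** Partial summation from Mertens' first theorem. The induction carries the
    exact boundary term of the summation, so that each step only compares
    1 - ln n / ln (n + 1) with the increment of ln ln. *)
Lemma prime_inv_sum_le : exists C : R, forall n, (2 <= n)%N -> prime_inv_sum n <= ln (ln_nat n) + C.
Proof.
pose C : R := ln 16.
have lnp2 : 0 < ln_nat 2 by rewrite ln_gt0// ltr1n.
pose c0 : R := - ln (ln_nat 2).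
exists (1 + C / ln_nat 2 + c0) => n n2.
have lngt m : (2 <= m)%N -> 0 < ln_nat m by move=> m2; rewrite ln_gt0// ltr1n.
suff H : prime_inv_sum n <= mertens_sum n / ln_nat n + ln (ln_nat n) + C * ((ln_nat 2)^-1 - (ln_nat n)^-1) + c0.
  have An : mertens_sum n / ln_nat n <= 1 + C / ln_nat n.
    rewrite ler_pdivrMr ?lngt// mulrDl mul1r divfK ?gt_eqF ?lngt//.
    by apply: mertens_sum_le; lia.
  apply: le_trans H _; move: An; rewrite mulrBr -![C / _]/(C * _); lra.
elim: n n2 => [//|n IH]; rewrite leq_eqVlt => /orP[/eqP <-|n2].
  rewrite subrr mulr0 addr0 /c0 addrK /mertens_sum /prime_inv_sum.
  by rewrite mulr_suml le_eqVlt; apply/orP; left; apply/eqP; rewrite unlock /= !addr0 mulrAC divff ?mul1r// gt_eqF.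
have {}IH := IH n2.
have b0 := lngt _ n2; have a0 := lngt _ (ltnW n2 : 2 <= n.+1)%N.
have ab : ln_nat n <= ln_nat n.+1 by rewrite ler_ln ?posrE ?ltr0n// ?ler_nat//; lia.
have E : prime_inv_sum n.+1 - prime_inv_sum n = (mertens_sum n.+1 - mertens_sum n) / ln_nat n.+1.
  rewrite /prime_inv_sum /mertens_sum [in LHS]big_mkcond [in RHS]big_mkcond /=.
  rewrite [X in _ - X]big_mkcond [X in (_ - X) / _]big_mkcond /=.
  rewrite [in LHS]big_nat_recr//= [in RHS]big_nat_recr//= addrAC subrr add0r.
  rewrite [X in X / _]addrAC subrr add0r; case: ifP => _; last by rewrite mul0r.
  by rewrite mulrAC divff ?mul1r// gt_eqF.
have A := mertens_sum_le (ltnW n2).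
have L : 1 - ln_nat n / ln_nat n.+1 <= ln (ln_nat n.+1) - ln (ln_nat n).
  have -> : ln (ln_nat n.+1) - ln (ln_nat n) = - ln (1 + (ln_nat n / ln_nat n.+1 - 1)).
    by rewrite addrCA subrr addr0 ln_div ?posrE// opprB.
  rewrite lerNr opprB le_ln1Dx//.
  by rewrite ltrBrDr addrC subrr divr_gt0.
have AB : mertens_sum n * ((ln_nat n)^-1 - (ln_nat n.+1)^-1) <= (ln_nat n + C) * ((ln_nat n)^-1 - (ln_nat n.+1)^-1).
  by rewrite ler_wpM2r// subr_ge0 lef_pV2 ?posrE.
have bb : ln_nat n / ln_nat n = 1 by rewrite divff ?gt_eqF.
move: AB L E IH bb; rewrite !mulrBr !mulrDl.
set ib := (ln_nat n)^-1; set ia := (ln_nat n.+1)^-1; set i2 := (ln_nat 2)^-1.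
rewrite !mulNr.
by lra.
Qed.

(** Each factor 1 - 1 / p is at least exp (- 1 / (p - 1)), and the sum of
    1 / (p - 1) over primes is at most ln ln n up to a bounded amount. *)
Lemma mertens_prod_ge : exists2 c : R, 0 < c & forall n, (2 <= n)%N -> c / ln_nat n <= mertens_prod n.+1.
Proof.
have [C HC] := prime_inv_sum_le; exists (expR (- (C + 1))); first exact: expR_gt0.
move=> n n2; have ln0 : 0 < ln_nat n by rewrite ln_gt0// ltr1n.
have H1 : \sum_(0 <= p < n.+1 | prime p) (p%:R * (p%:R - 1))^-1 <= 1 :> R.
  rewrite big_ltn_cond// [prime 0]/= big_ltn_cond ?ltnS 1?ltnW// [prime 1]/= big_mkcond /=.
  apply: (@le_trans _ _ (\sum_(2 <= p < n.+1) (p.-1%:R^-1 - p%:R^-1))).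
    rewrite big_nat_cond [leRHS]big_nat_cond; apply: ler_sum => p /andP[/andP[p2 _] _].
    have E : (p%:R * (p%:R - 1))^-1 = p.-1%:R^-1 - p%:R^-1 :> R.
      case: p p2 => [//|[//|p]] _ /=.
      have m2 : p.+2%:R = p.+1%:R + 1 :> R by rewrite natr1.
      have x0 : 0 < p.+1%:R :> R by rewrite ltr0n.
      rewrite m2; field; rewrite !gt_eqF//; lra.
    case: ifP => _; first by rewrite E.
    by rewrite -E invr_ge0 mulr_ge0// subr_ge0 ler1n; lia.
  have -> : \sum_(2 <= p < n.+1) (p.-1%:R^-1 - p%:R^-1) = 1 - n%:R^-1 :> R.
    have := @telescope_sumr _ 1 n (fun m => m%:R^-1 : R) (ltnW n2).
    rewrite invr1 -[1 - _]opprB => <-; rewrite -sumrN big_add1 /=.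
    by apply: eq_bigr => i _; rewrite opprB.
  by rewrite gerBl invr_ge0.
apply: (@le_trans _ _ (expR (- (prime_inv_sum n + \sum_(0 <= p < n.+1 | prime p) (p%:R * (p%:R - 1))^-1)))).
  have -> : expR (- (C + 1)) / ln_nat n = expR (- (C + 1) - ln (ln_nat n)).
    by rewrite expRB lnK.
  rewrite ler_expR; have := HC _ n2; lra.
rewrite /prime_inv_sum -big_split /= -sumrN expR_sum; apply: ler_prod => p pp.
rewrite expR_ge0 /=.
have p1 : 1 < p%:R :> R by rewrite ltr1n prime_gt1.
have -> : p%:R^-1 + (p%:R * (p%:R - 1))^-1 = (p%:R - 1)^-1 :> R.
  by field; rewrite !gt_eqF//; lra.
have -> : 1 - p%:R^-1 = (1 + (p%:R - 1)^-1)^-1 :> R.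
  by field; rewrite !gt_eqF//; lra.
rewrite expRN lef_pV2 ?posrE ?expR_gt0 ?expR_ge1Dx//.
by rewrite addr_gt0// invr_gt0; lra.
Qed.

Let smooth_sum N k : R := \sum_(1 <= m < N.+1 | all (fun p => p < k)%N (primes m)) m%:R^-1.

(** Removing the multiples of k from the smooth integers costs at most the
    fraction 1 / k of the sum, since m = k l with l again smooth. *)
Let smooth_sum_step N k : prime k ->
  smooth_sum N k.+1 * (1 - k%:R^-1) <= smooth_sum N k.
Proof.
move=> pk; have k0 : 0 < k%:R :> R by rewrite ltr0n prime_gt0.
pose sm j m := all (fun p => p < j)%N (primes m).
suff H : smooth_sum N k.+1 - smooth_sum N k <= smooth_sum N k.+1 / k%:R by lra.
have E : smooth_sum N k.+1 - smooth_sum N k =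
    \sum_(1 <= m < N.+1 | sm k.+1 m && (k %| m)%N) m%:R^-1.
  rewrite {1}/smooth_sum (bigID (fun m => k %| m)%N) /= addrAC -[RHS]addr0 -addrA.
  congr (_ + _); apply/eqP; rewrite addrC subr_eq0; apply/eqP.
  rewrite /smooth_sum big_nat_cond [RHS]big_nat_cond; apply: eq_bigl => m.
  case: (boolP (1 <= m < N.+1)%N) => //= /andP[m1 _].
  apply/andP/allP => [[/allP h kd] p pm|h].
    have := h p pm; rewrite ltnS leq_eqVlt => /orP[/eqP pE|//].
    by move: kd; rewrite -pE; move: pm; rewrite mem_primes => /and3P[_ _ ->].
  split; first by apply/allP => p /h; lia.
  apply/negP => kd; have := h k; rewrite mem_primes pk m1 kd ltnn => /(_ isT).
  by [].
rewrite E mulr_suml.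
apply: (@le_trans _ _ (\sum_(1 <= m < N.+1) \sum_(1 <= l < N.+1 | sm k.+1 l)
   (if m == (k * l)%N then m%:R^-1 else 0))).
  rewrite big_mkcond /= big_nat_cond [leRHS]big_nat_cond.
  apply: ler_sum => m /andP[/andP[m1 mN] _].
  have ge0 l : 0 <= (if m == (k * l)%N then m%:R^-1 else 0) :> R.
    by case: ifP.
  case: ifP => [/andP[sk /dvdnP[l El]]|_]; last by rewrite sumr_ge0.
  have l0 : (0 < l)%N by case: l El m1 => [->|//]; rewrite mul0n.
  have lN : (l < N.+1)%N.
    by apply: leq_trans mN; rewrite ltnS El leq_pmulr ?prime_gt0.
  rewrite big_mkcond (bigD1_seq l) /=.
  - have -> : sm k.+1 l.
      apply/allP => p pl; apply: (allP sk); move: pl; rewrite !mem_primes m1 => /and3P[-> _ pl] /=.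
      by rewrite El dvdn_mulr.
    rewrite mulnC -El eqxx lerDl sumr_ge0// => j _; by case: ifP.
  - by rewrite mem_index_iota l0.
  - exact: iota_uniq.
rewrite exchange_big_nat /=; apply: ler_sum => l _.
rewrite -big_mkcond /= -invfM -natrM mulnC.
have [kN|kN] := boolP ((0 < k * l) && (k * l < N.+1))%N.
  rewrite -big_filter; have -> : [seq i <- index_iota 1 N.+1 | i == (l * k)%N] = [:: (l * k)%N].
    by rewrite mulnC filter_pred1_uniq ?iota_uniq// mem_index_iota.
  by rewrite big_seq1.
rewrite big_nat_cond big1 ?invr_ge0// => m /andP[/andP[m0 mN] /eqP mE].
by move: kN; rewrite mulnC -mE m0 mN.
Qed.

(** The product of 1 - 1 / p over p < k, times the reciprocal sum over k-smooth
    integers, never exceeds 1; when k > n all integers up to n are smooth and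
    the sum is at least ln (n + 1). *)
Lemma mertens_prod_le n : (0 < n)%N -> mertens_prod n.+1 * ln n.+1%:R <= 1.
Proof.
move=> n0.
have H k : smooth_sum n k * mertens_prod k <= 1.
  elim: k => [|k IH].
    rewrite /mertens_prod big_geq// mulr1 /smooth_sum big_ltn_cond//= invr1.
    rewrite big_nat_cond big1 ?addr0// => m /andP[/andP[m2 _]].
    have : (pdiv m \in primes m) by rewrite mem_primes pdiv_prime// pdiv_dvd/= andbT; lia.
    by case: (primes m).
  rewrite /mertens_prod big_mkcond big_nat_recr//= -big_mkcond -/(mertens_prod k).
  case: ifP => pk.
    apply: le_trans IH; rewrite mulrCA [leRHS]mulrC; apply: ler_wpM2l; first exact/ltW/mertens_prod_gt0.
    exact: smooth_sum_step.
  rewrite mulr1; apply: le_trans IH; apply: ler_wpM2r; first exact/ltW/mertens_prod_gt0.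
  rewrite /smooth_sum le_eqVlt; apply/orP; left; apply/eqP.
  apply: eq_bigl => m; apply: eq_in_all => p pm.
  rewrite ltnS leq_eqVlt; case: eqP => //= pE.
  by move: pm; rewrite pE mem_primes pk.
apply: le_trans (H n.+1); rewrite mulrC; apply: ler_wpM2r; first exact/ltW/mertens_prod_gt0.
have -> : smooth_sum n n.+1 = \sum_(1 <= m < n.+1) m%:R^-1.
  rewrite /smooth_sum big_nat_cond [RHS]big_nat_cond; apply: eq_bigl => m.
  case: (boolP (1 <= m < n.+1)%N) => //= /andP[m0 mn].
  apply/allP => p; rewrite mem_primes => /and3P[_ _ /dvdn_leq] => /(_ m0); lia.
elim: (n) => [|m IH]; first by rewrite ln1 big_geq.
rewrite big_nat_recr//=; apply: le_trans (lerD IH (lexx _)).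
rewrite -lerBlDl -ln_div ?posrE ?ltr0n//.
have -> : m.+2%:R / m.+1%:R = 1 + m.+1%:R^-1 :> R.
  by rewrite -(natr1 m.+1) mulrDl divff ?pnatr_eq0// mul1r.
by rewrite le_ln1Dx// (lt_trans _ (_ : 0 < _)) ?invr_gt0 ?ltr0n// ltrN10.
Qed.

End Mertens.

(** * The Brun-Hooley sieve in several coordinates *)

Section Subsets.
Variables (R : realType) (T : finType) (x : T -> R).
Implicit Types (Q : {set T}) (c : nat -> R).

(** Elementary symmetric polynomials of the weights, combined with coefficients
    [c] depending on the degree. *)
Definition subset_sum c Q : R :=
  \sum_(A : {set T} | A \subset Q) c #|A| * \prod_(p in A) x p.

Lemma subset_sum0 c : subset_sum c finset.set0 = c 0%N.
Proof.
rewrite /subset_sum (big_pred1 finset.set0) ?cards0 ?big_set0 ?mulr1// => A.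
by rewrite /= finset.subset0.
Qed.

Lemma eq_subset_sum c c' Q : c =1 c' -> subset_sum c Q = subset_sum c' Q.
Proof. by move=> cc; apply: eq_bigr => A _; rewrite cc. Qed.

(** The subsets of p |: Q are those of Q and those of Q with p added. *)
Lemma subset_sumU1 c p Q : p \notin Q ->
  subset_sum c (p |: Q)%SET = subset_sum c Q + x p * subset_sum (c \o S) Q.
Proof.
move=> pQ; rewrite /subset_sum (bigID (fun A : {set T} => p \in A)) /= addrC; congr (_ + _).
  apply: eq_bigl => A; apply/andP/idP => [[/fintype.subsetP AQ pA]|AQ].
    apply/fintype.subsetP => z zA; have := AQ z zA; rewrite !inE => /orP[/eqP zp|//].
    by move: zA; rewrite zp (negbTE pA).
  split; first by apply: fintype.subset_trans AQ (finset.subsetUr _ _).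
  by apply: contra pQ; apply/fintype.subsetP.
rewrite mulr_sumr (reindex_onto (fun A => p |: A)%SET (fun A => A :\ p)%SET) /=; last first.
  by move=> A /andP[_ pA]; rewrite finset.setD1K.
rewrite [LHS](eq_bigl (fun A : {set T} => A \subset Q)); last first.
  move=> A; rewrite setU11 andbT; apply/andP/idP => [[AQ /eqP E]|AQ].
    rewrite -E; apply/fintype.subsetP => z; rewrite !inE => /andP[zp zA].
    have := fintype.subsetP AQ z; rewrite !inE (negbTE zp) /= => H; apply: H.
    by move: zA; rewrite (negbTE zp).
  split; first exact: finset.setUS.
  by rewrite finset.setU1K//; apply: contra pQ; apply/fintype.subsetP.
apply: eq_bigr => A AQ; have pA : p \notin A by apply: contra pQ; apply/fintype.subsetP.
by rewrite cardsU1 pA add1n big_setU1//= mulrCA.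
Qed.

Lemma finset_ind (P : {set T} -> Prop) : P finset.set0 ->
  (forall p Q, p \notin Q -> P Q -> P (p |: Q)%SET) -> forall Q, P Q.
Proof.
move=> P0 PS Q; move: {2}#|Q| (erefl #|Q|) => n; elim: n Q => [|n IH] Q.
  by move/eqP; rewrite cards_eq0 => /eqP ->.
move=> Qn; have /card_gt0P[p pQ] : (0 < #|Q|)%N by rewrite Qn.
rewrite -(finset.setD1K pQ); apply: PS; first by rewrite !inE eqxx.
by apply: IH; move: Qn; rewrite (cardsD1 p) pQ => -[].
Qed.

Definition trunc_sign (b s : nat) : R := (s <= b)%N%:R * (-1) ^+ s.
Definition exact_size (t s : nat) : R := (s == t)%:R.

(** Bonferroni's inequalities for arbitrary weights in [0, 1]. For weights in
    {0, 1} they are the pointwise sieve inequalities, for weights 1/p they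
    control the corresponding densities. *)
Lemma bonferroni Q b : {in Q, forall p, 0 <= x p <= 1} ->
  0 <= (-1) ^+ b * (subset_sum (trunc_sign b) Q - \prod_(p in Q) (1 - x p))
    <= subset_sum (exact_size b.+1) Q.
Proof.
elim/finset_ind: Q b => [|p Q pQ IH] b x01.
  rewrite !subset_sum0 big_set0 /trunc_sign /exact_size leq0n mul1r expr0 subrr mulr0 lexx.
  by [].
have {}IH k : 0 <= (-1) ^+ k * (subset_sum (trunc_sign k) Q - \prod_(p in Q) (1 - x p))
    <= subset_sum (exact_size k.+1) Q.
  by apply: IH => q qQ; apply: x01; rewrite !inE qQ orbT.
have /andP[xp0 xp1] : 0 <= x p <= 1 by apply: x01; rewrite setU11.
rewrite !subset_sumU1// big_setU1//=.
have -> : subset_sum (exact_size b.+1 \o S) Q = subset_sum (exact_size b) Q by apply: eq_subset_sum.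
have /andP[IH1 IH2] := IH b.
set V := \prod_(p in Q) _ in IH IH1 IH2 *; set Eb := subset_sum (trunc_sign b) Q in IH1 IH2 *.
suff H : 0 <= (-1) ^+ b * (subset_sum (trunc_sign b \o S) Q + V) <= subset_sum (exact_size b) Q.
  have -> : (-1) ^+ b * (Eb + x p * subset_sum (trunc_sign b \o S) Q - (1 - x p) * V) =
    (-1) ^+ b * (Eb - V) + x p * ((-1) ^+ b * (subset_sum (trunc_sign b \o S) Q + V)) by ring.
  move: H => /andP[H1 H2]; apply/andP; split.
    by rewrite addr_ge0// mulr_ge0.
  by rewrite lerD// ler_wpM2l.
case: b {IH1 IH2 Eb} => [|b].
  have -> : subset_sum (trunc_sign 0 \o S) Q = 0.
    by rewrite /subset_sum big1// => A _; rewrite /trunc_sign /= !mul0r.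
  rewrite add0r expr0 mul1r /V; apply/andP; split.
    apply: prodr_ge0 => q qQ; have /andP[_] : 0 <= x q <= 1 by apply: x01; rewrite !inE qQ orbT.
    by rewrite subr_ge0.
  have -> : subset_sum (exact_size 0) Q = 1.
    rewrite /subset_sum (bigD1 finset.set0) ?finset.sub0set//= big_set0 cards0 /exact_size eqxx mulr1.
    rewrite big1 ?addr0// => A /andP[_ A0]; rewrite cards_eq0 (negbTE A0) mul0r//.
  rewrite -[leRHS](@big1 _ 1 *%R _ (index_enum T) (mem Q) (fun=> 1))//.
  apply: ler_prod => q qQ; have /andP[q0 q1] : 0 <= x q <= 1 by apply: x01; rewrite !inE qQ orbT.
  by rewrite subr_ge0 q1 gerBl.
have -> : subset_sum (trunc_sign b.+1 \o S) Q = - subset_sum (trunc_sign b) Q.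
  rewrite /subset_sum -sumrN; apply: eq_bigr => A _; rewrite /trunc_sign /= ltnS exprS; ring.
have := IH b; rewrite exprS.
by have -> : -1 * (-1) ^+ b * (- subset_sum (trunc_sign b) Q + V) = (-1) ^+ b * (subset_sum (trunc_sign b) Q - V) by ring.
Qed.

(** Elementary symmetric functions are dominated by power sums: an s-subset is
    counted s! times in the s-th power of the total weight. *)
Lemma esym_le Q s : {in Q, forall p, 0 <= x p} ->
  subset_sum (exact_size s) Q <= (\sum_(p in Q) x p) ^+ s / s`!%:R.
Proof.
elim/finset_ind: Q s => [|p Q pQ IH] s x0.
  rewrite subset_sum0 big_set0 /exact_size; case: s => [|s]; first by rewrite fact0 divr1 expr0.
  by rewrite expr0n /= mul0r.
have xQ : {in Q, forall p, 0 <= x p} by move=> q qQ; apply: x0; rewrite !inE qQ orbT.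
have xp0 : 0 <= x p by apply: x0; rewrite setU11.
have S0 : 0 <= \sum_(p in Q) x p by apply: sumr_ge0.
rewrite subset_sumU1// big_setU1//=; case: s => [|s].
  have -> : subset_sum (exact_size 0 \o S) Q = 0.
    by rewrite /subset_sum big1// => A _; rewrite /exact_size mul0r.
  by rewrite mulr0 addr0 expr0; apply: le_trans (IH 0%N xQ) _; rewrite expr0.
have -> : subset_sum (exact_size s.+1 \o S) Q = subset_sum (exact_size s) Q by apply: eq_subset_sum.
apply: le_trans (lerD (IH s.+1 xQ) (ler_wpM2l xp0 (IH s xQ))) _.
set L := \sum_(q in Q) x q in S0 *.
have f0 : 0 < s`!%:R :> R by rewrite ltr0n fact_gt0.
have s0 : 0 < s.+1%:R :> R by rewrite ltr0n.
have E u : u / s.+1`!%:R = u / s.+1%:R / s`!%:R :> R.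
  by rewrite factS natrM invfM mulrA.
rewrite !E mulrA -mulrDl ler_pM2r ?invr_gt0// -(ler_pM2r s0) mulrDl !divfK ?gt_eqF//.
elim: s {E f0 IH} s0 => [|s IHs] s0; first by rewrite !expr1 expr0; lra.
rewrite [leRHS]exprS.
have Lx : 0 <= x p + L by rewrite addr_ge0.
apply: le_trans (ler_wpM2l Lx (IHs (ltr0Sn _ _))).
rewrite [L ^+ s.+2]exprS [L ^+ s.+1]exprS -(natr1 s.+1).
have : 0 <= L ^+ s by rewrite exprn_ge0.
have : 0 <= s.+1%:R :> R by [].
move: (L ^+ s) (s.+1%:R : R) => u k k0 u0.
have -> : (x p + L) * (L * u + x p * u * k) =
  L * (L * u) + x p * (L * u) * (k + 1) + x p * x p * u * k by ring.
by rewrite lerDl !mulr_ge0.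
Qed.

End Subsets.

(** A product of majorants exceeds the product by at most one defect at a time,
    the other factors being majorants. This is what turns upper bound sieves on
    separate ranges of primes into a lower bound sieve. *)
Lemma prod_defect (R : realType) (J : finType) (X Y D : J -> R) (A : {set J}) :
  (forall j, 0 <= X j <= Y j) -> (forall j, Y j <= X j + D j) ->
  \prod_(j in A) Y j - \prod_(j in A) X j <=
  \sum_(j in A) D j * \prod_(k in A :\ j) Y k.
Proof.
move=> XY YD; elim/finset_ind: A => [|p A pA IH]; first by rewrite !big_set0 subrr.
rewrite !big_setU1//= setU1K//.
have /andP[X0 XYp] := XY p; have Y0 j : 0 <= Y j by have /andP[X0j /(le_trans X0j)] := XY j.
have -> : \sum_(j in A) D j * \prod_(k in (p |: A) :\ j) Y k =
    Y p * \sum_(j in A) D j * \prod_(k in A :\ j) Y k.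
  rewrite mulr_sumr; apply: eq_bigr => j jA.
  have jp : j != p by apply: contra pA => /eqP <-.
  have -> : ((p |: A) :\ j)%SET = (p |: (A :\ j))%SET.
    by apply/setP => z; rewrite !inE; case: (eqVneq z p) => // ->; rewrite eq_sym jp.
  rewrite big_setU1/=; last by rewrite !inE (negbTE pA) andbF.
  by rewrite mulrCA.
set PY := \prod_(j in A) Y j; set PX := \prod_(j in A) X j.
have PY0 : 0 <= PY by apply: prodr_ge0.
have -> : Y p * PY - X p * PX = (Y p - X p) * PY + X p * (PY - PX) by ring.
apply: lerD; first by rewrite ler_wpM2r// lerBlDl.
have S0 : 0 <= \sum_(j in A) D j * \prod_(k in A :\ j) Y k.
  apply: sumr_ge0 => j _; rewrite mulr_ge0// ?prodr_ge0//.
  by have := YD j; have /andP[_] := XY j; lra.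
apply: le_trans (ler_wpM2l X0 IH) _.
by rewrite ler_wpM2r.
Qed.

Lemma prod_dvd_coprime (K : nat) (J : eqType) (r : seq J) (P : pred J) (m : J -> nat) :
  uniq r -> (forall i j, P i -> P j -> i != j -> coprime (m i) (m j)) ->
  (forall i, P i -> m i %| K)%N -> (\prod_(i <- r | P i) m i %| K)%N.
Proof.
move=> + cop dv; elim: r => [|i r IH] /=; first by rewrite big_nil dvd1n.
move=> /andP[ir ur]; rewrite big_cons; case: ifP => Pi; last exact: IH.
rewrite Gauss_dvd ?dv ?IH// coprime_sym.
rewrite big_seq_cond; apply: (big_ind (fun n => coprime n (m i))).
- exact: coprime1n.
- by move=> u v; rewrite coprimeMl => -> ->.
by move=> j /andP[jr Pj]; apply: cop => //; apply: contra ir => /eqP <-.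
Qed.

(** The primes to be sifted are split into classes [cls j]; the weights [a] are
    equidistributed along the conditions q_i | k_i with a uniform error [E]. *)
Section Expansion.
Variables (R : realType) (Z d : nat) (J : finType) (cls : J -> {set 'I_Z}).
Hypothesis cls_prime : forall j p, p \in cls j -> prime p.
Hypothesis cls_disj : forall j k p, p \in cls j -> p \in cls k -> j = k.
Variables (I : finType) (kap : I -> 'I_d -> nat) (a : I -> R) (Y E : R).
Hypothesis levelH : forall q : 'I_d -> nat, (forall i, 0 < q i)%N ->
  `|\sum_(x | [forall i, q i %| kap x i]%N) a x - Y / (\prod_i q i)%:R| <= E.

Definition divs (x : I) (i : 'I_d) (p : 'I_Z) : R := (p %| kap x i)%N%:R.

(** A product of polynomials in the divisibility indicators expands into
    indicators of q_i | k_i with independent moduli. Since the error E is the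
    same for all moduli, it gets multiplied by the total absolute weight of the
    terms only. *)
Lemma expansion (u : 'I_d * J -> {set 'I_Z} -> R) :
  (forall al (A : {set 'I_Z}), ~~ (A \subset cls al.2) -> u al A = 0) ->
  `|\sum_x a x * \prod_al \sum_A u al A * \prod_(p in A) divs x al.1 p
    - Y * \prod_al \sum_A u al A * \prod_(p in A) (p%:R)^-1|
  <= E * \prod_al \sum_A `|u al A|.
Proof.
move=> u0.
rewrite [X in `|_ - Y * X|](bigA_distr_bigA (fun al A => u al A * \prod_(p in A) (p%:R)^-1)).
rewrite [X in _ <= E * X](bigA_distr_bigA (fun al A => `|u al A|)) /=.
under eq_bigr do rewrite (bigA_distr_bigA (fun al A => u al A * \prod_(p in A) divs _ al.1 p)) mulr_sumr.
rewrite exchange_big /= !mulr_sumr -sumrB.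
apply: le_trans (ler_norm_sum _ _ _) _; apply: ler_sum => f _.
have [fQ|] := boolP [forall al, f al \subset cls al.2]; last first.
  rewrite negb_forall => /fintype.existsP[al fal].
  have z : u al (f al) = 0 by exact: u0.
  rewrite [X in _ - Y * X](bigD1 al)//= z !mul0r mulr0 subr0 big1 ?normr0.
    by rewrite (bigD1 al)//= z normr0 mul0r mulr0.
  by move=> x _; rewrite (bigD1 al)//= z !mul0r mulr0.
move/forallP : fQ => fQ.
have fp al p : p \in f al -> prime p by move=> /(fintype.subsetP (fQ al)); exact: cls_prime.
pose q (i : 'I_d) : nat := (\prod_j \prod_(p in f (i, j)) p)%N.
have q0 i : (0 < q i)%N.
  apply: prodn_gt0 => j; apply: prodn_cond_gt0 => p /fp; exact: prime_gt0.
have qdvd x i : (q i %| kap x i)%N = [forall j, [forall p in f (i, j), (p %| kap x i)%N]].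
  apply/idP/forallP => [H j|H].
    apply/forall_inP => p pf; apply: dvdn_trans H.
    rewrite /q (bigD1 j)//=; apply: dvdn_mulr.
    by rewrite (bigD1 p)//=; apply: dvdn_mulr.
  apply: prod_dvd_coprime; first exact: index_enum_uniq.
    move=> j k _ _ jk; apply: (big_ind (fun n => coprime n _)).
    - exact: coprime1n.
    - by move=> u1 v1; rewrite coprimeMl => -> ->.
    move=> p pf; apply: (big_ind (fun n => coprime p n)).
    - exact: coprimen1.
    - by move=> u1 v1; rewrite coprimeMr => -> ->.
    move=> p' pf'; rewrite prime_coprime ?(fp _ _ pf)// dvdn_prime2 ?(fp _ _ pf) ?(fp _ _ pf')//.
    apply: contra jk => /eqP pp'; apply/eqP; apply: (@cls_disj _ _ p).
      exact: (fintype.subsetP (fQ (i, j))).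
    have -> : p = p' by apply/val_inj.
    exact: (fintype.subsetP (fQ (i, k))).
  move=> j _; have {}H := H j; apply: prod_dvd_coprime; first exact: index_enum_uniq.
    move=> p p' pf pf' pp'; rewrite prime_coprime ?(fp _ _ pf)// dvdn_prime2 ?(fp _ _ pf) ?(fp _ _ pf')//.
  by move=> p pf; apply: (forall_inP H).
have E1 : \prod_al (u al (f al) * \prod_(p in f al) (p%:R)^-1) =
    (\prod_al u al (f al)) / (\prod_i q i)%:R.
  rewrite big_split /=; congr (_ * _).
  under eq_bigr do rewrite prodfV.
  rewrite prodfV natr_prod; congr (_ ^-1).
  rewrite [RHS](eq_bigr (fun i => \prod_j \prod_(p in f (i, j)) p%:R)); last first.
    by move=> i _; rewrite natr_prod; apply: eq_bigr => j _; rewrite natr_prod.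
  by rewrite pair_big /=; apply: eq_bigr => -[i j].
have E2 x : a x * \prod_al (u al (f al) * \prod_(p in f al) divs x al.1 p) =
    (\prod_al u al (f al)) * (if [forall i, q i %| kap x i]%N then a x else 0).
  rewrite big_split /= mulrCA; congr (_ * _).
  case: ifP => [/forallP H|/negbT].
    rewrite big1 ?mulr1// => -[i j] _ /=; rewrite big1// => p pf.
    have := H i; rewrite qdvd => /forallP/(_ j)/forall_inP/(_ p pf).
    by rewrite /divs => ->.
  move=> /forallPn [ i ]; rewrite qdvd => /forallPn [j] /forallPn [p].
  rewrite negb_imply => /andP[pf pn].
  by rewrite (bigD1 (i, j))//= (bigD1 p)//= /divs (negbTE pn) !mul0r mulr0.
rewrite E1 (eq_bigr _ (fun x _ => E2 x)) -mulr_sumr -big_mkcond /=.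
rewrite mulrCA -mulrBr normrM normr_prod mulrC.
by apply: ler_wpM2r; [exact: prodr_ge0|exact: levelH].
Qed.

End Expansion.

Section BrunHooley.
Variables (R : realType) (Z d : nat) (J : finType) (cls : J -> {set 'I_Z}).
Hypothesis cls_prime : forall j p, p \in cls j -> prime p.
Hypothesis cls_disj : forall j k p, p \in cls j -> p \in cls k -> j = k.
Variables (I : finType) (kap : I -> 'I_d -> nat) (a : I -> R) (Y E : R).
Hypothesis a0 : forall x, 0 <= a x.
Hypothesis Y0 : 0 <= Y.
Hypothesis E0 : 0 <= E.
Hypothesis levelH : forall q : 'I_d -> nat, (forall i, 0 < q i)%N ->
  `|\sum_(x | [forall i, q i %| kap x i]%N) a x - Y / (\prod_i q i)%:R| <= E.
Variable b : J -> nat.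
Hypothesis b_even : forall j, ~~ odd (b j).
(* [NB j] counts the terms used by class j, [tau] bounds the relative size of
   the first neglected terms. *)
Variables (tau Dl : R) (NB : J -> R).
Let inv (p : 'I_Z) : R := (p%:R)^-1.
Let V (j : J) : R := \prod_(p in cls j) (1 - inv p).
Hypothesis tail_le : \sum_j subset_sum inv (exact_size R (b j).+1) (cls j) / V j <= tau.
Hypothesis NB_ge : forall j, ((#|cls j|).+1)%:R ^+ b j <= NB j.
Hypothesis Dl_ge : forall j, (#|cls j|)%:R <= Dl.

Let sifted x := [forall al : 'I_d * J, forall p in cls al.2, ~~ (p %| kap x al.1)%N].

Let inv01 j : {in cls j, forall p, 0 <= inv p <= 1}.
Proof.
move=> p /cls_prime pp; rewrite /inv invr_ge0 ler0n /=.
by rewrite invf_le1 ?ltr0n ?ler1n prime_gt0.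
Qed.

Let V_gt0 j : 0 < V j.
Proof.
apply: prodr_gt0 => p /cls_prime pp; rewrite subr_gt0 invf_lt1 ?ltr0n ?prime_gt0//.
by rewrite ltr1n prime_gt1.
Qed.

(* [U] are the coefficients of the sieve truncated at level [b j], [W] those of
   the first term left out, which bounds the defect of the truncation. *)
Let U j (A : {set 'I_Z}) : R := (A \subset cls j)%:R * trunc_sign R (b j) #|A|.
Let W j (A : {set 'I_Z}) : R := (A \subset cls j)%:R * exact_size R (b j).+1 #|A|.

Let sumE (c : nat -> R) (j : J) (w : 'I_Z -> R) :
  \sum_(A : {set 'I_Z}) ((A \subset cls j)%:R * c #|A|) * \prod_(p in A) w p = subset_sum w c (cls j).
Proof.
rewrite /subset_sum [RHS]big_mkcond; apply: eq_bigr => A _.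
by case: ifP => _; rewrite ?mul1r ?mul0r.
Qed.

Let normU j : \sum_A `|U j A| <= NB j.
Proof.
apply: le_trans (NB_ge j).
have -> : \sum_A `|U j A| = subset_sum (fun=> 1 : R) (fun s => (s <= b j)%N%:R) (cls j).
  rewrite -sumE; apply: eq_bigr => A _; rewrite big1// mulr1 /U /trunc_sign.
  by rewrite !normrM !normr_nat normrX normrN1 expr1n mulr1.
elim/finset_ind: (cls j) (b j) => [|p Q pQ IH] k.
  by rewrite subset_sum0 leq0n cards0 expr1n.
rewrite subset_sumU1// mul1r cardsU1 pQ add1n; case: k => [|k].
  rewrite expr0 [X in _ + X](_ : _ = 0).
    by rewrite addr0; apply: le_trans (IH 0%N) _; rewrite expr0.
  by rewrite /subset_sum big1// => A _; rewrite mul0r.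
have -> : subset_sum (fun=> 1 : R) ((fun s => (s <= k.+1)%N%:R) \o S) Q =
          subset_sum (fun=> 1 : R) (fun s => (s <= k)%N%:R) Q by apply: eq_subset_sum.
apply: le_trans (lerD (IH k.+1) (IH k)) _.
rewrite exprS -[X in _ + X]mul1r -mulrDl [leRHS]exprS natr1.
by apply: ler_wpM2l => //; apply: lerXn2r; rewrite ?nnegrE// ler_nat.
Qed.

Let normW j : \sum_A `|W j A| <= Dl * NB j.
Proof.
have -> : \sum_A `|W j A| = subset_sum (fun=> 1 : R) (exact_size R (b j).+1) (cls j).
  rewrite -sumE; apply: eq_bigr => A _; rewrite big1// mulr1 /W /exact_size.
  by rewrite !normrM !normr_nat.
apply: le_trans (esym_le _ _) _ => //.
rewrite sumr_const; apply: (@le_trans _ _ (#|cls j|%:R ^+ (b j).+1)).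
  by rewrite ler_pdivrMr ?ltr0n ?fact_gt0// ler_peMr ?exprn_ge0// ler1n fact_gt0.
rewrite exprS; apply: ler_pM => //.
apply: le_trans (NB_ge j); apply: lerXn2r; rewrite ?nnegrE//.
by rewrite ler_nat.
Qed.

Let X (x : I) (al : 'I_d * J) : R := \prod_(p in cls al.2) (1 - divs R kap x al.1 p).
Let PU (x : I) (al : 'I_d * J) : R := subset_sum (divs R kap x al.1) (trunc_sign R (b al.2)) (cls al.2).
Let PW (x : I) (al : 'I_d * J) : R := subset_sum (divs R kap x al.1) (exact_size R (b al.2).+1) (cls al.2).
Let DU j : R := subset_sum inv (trunc_sign R (b j)) (cls j).
Let DW j : R := subset_sum inv (exact_size R (b j).+1) (cls j).

Let bonf (w : 'I_Z -> R) j : {in cls j, forall p, 0 <= w p <= 1} ->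
  [/\ \prod_(p in cls j) (1 - w p) <= subset_sum w (trunc_sign R (b j)) (cls j),
   subset_sum w (trunc_sign R (b j)) (cls j) <=
     \prod_(p in cls j) (1 - w p) + subset_sum w (exact_size R (b j).+1) (cls j)
   & 0 <= \prod_(p in cls j) (1 - w p)].
Proof.
move=> w01; have := bonferroni (b j) w01.
rewrite -signr_odd (negbTE (b_even j)) expr0 mul1r => /andP[]; rewrite subr_ge0 lerBlDl => h1 h2.
split => //; apply: prodr_ge0 => p pj; rewrite subr_ge0.
by have /andP[] := w01 p pj.
Qed.

Let divs01 x i j : {in cls j, forall p, 0 <= divs R kap x i p <= 1}.
Proof. by move=> p _; rewrite /divs; case: (_ %| _)%N; rewrite ?lexx ?ler01. Qed.

Let sifted_prod x : (sifted x)%:R = \prod_al X x al.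
Proof.
case: (boolP (sifted x)) => [/forallP H|].
  rewrite big1// => al _; rewrite /X big1// => p pj.
  by have /forall_inP/(_ p pj)/negbTE := H al; rewrite /divs => ->; rewrite subr0.
rewrite negb_forall => /fintype.existsP[al]; rewrite negb_forall => /fintype.existsP[p].
rewrite negb_imply negbK => /andP[pj pd].
by rewrite (bigD1 al)//= /X (bigD1 p)//= /divs pd subrr !mul0r.
Qed.

Let DU_bd j : V j <= DU j /\ DU j <= V j + DW j.
Proof. by have [] := bonf (@inv01 j). Qed.

Let DU_ge0 j : 0 <= DU j.
Proof. by apply: le_trans (DU_bd j).1; exact: ltW. Qed.

Let DW_ge0 j : 0 <= DW j.
Proof. by have [h1 h2] := DU_bd j; lra. Qed.

Let NB_ge0 j : 0 <= NB j.
Proof. by apply: le_trans (NB_ge j); rewrite exprn_ge0. Qed.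

Let VV : R := \prod_j V j.
Let NN : R := \prod_j NB j.

Let prod_al (f : J -> R) : \prod_(al : 'I_d * J) f al.2 = (\prod_j f j) ^+ d.
Proof.
rewrite -(pair_bigA _ (fun (i : 'I_d) j => f j)) /=.
by rewrite prodr_const card_ord.
Qed.

Let sum_al (f : J -> R) : \sum_(al : 'I_d * J) f al.2 = (\sum_j f j) *+ d.
Proof.
rewrite -(pair_bigA _ (fun (i : 'I_d) j => f j)) /=.
by rewrite sumr_const card_ord.
Qed.

Let DU_prod_le : \prod_(al : 'I_d * J) DU al.2 <= VV ^+ d * expR (d%:R * tau).
Proof.
rewrite prod_al expRM_natl -exprMn; apply: lerXn2r.
- by rewrite nnegrE prodr_ge0.
- by rewrite nnegrE mulr_ge0 ?expR_ge0// prodr_ge0// => j _; exact: ltW.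
apply: (@le_trans _ _ (VV * expR (\sum_j DW j / V j))).
  rewrite expR_sum -big_split /=; apply: ler_prod => j _; rewrite DU_ge0 /=.
  apply: le_trans (DU_bd j).2 _.
  have -> : V j + DW j = V j * (1 + DW j / V j).
    by rewrite mulrDr mulr1 mulrCA divff ?mulr1// gt_eqF.
  by rewrite ler_pM2l// expR_ge1Dx.
apply: ler_wpM2l; first by rewrite prodr_ge0// => j _; exact: ltW.
by rewrite ler_expR.
Qed.

Let expU : `|\sum_x a x * \prod_al PU x al - Y * \prod_(al : 'I_d * J) DU al.2| <= E * NN ^+ d.
Proof.
have u0 (al : 'I_d * J) (A : {set 'I_Z}) : ~~ (A \subset cls al.2) -> U al.2 A = 0.
  by rewrite /U => /negbTE ->; rewrite mul0r.
have := expansion cls_prime cls_disj levelH u0.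
have e1 x : \prod_(al : 'I_d * J) \sum_(A : {set 'I_Z}) U al.2 A * \prod_(p in A) divs R kap x al.1 p =
    \prod_al PU x al by apply: eq_bigr => al _; rewrite sumE.
have e2 : \prod_(al : 'I_d * J) \sum_(A : {set 'I_Z}) U al.2 A * \prod_(p in A) (p%:R)^-1 =
    \prod_(al : 'I_d * J) DU al.2 by apply: eq_bigr => al _; rewrite sumE.
rewrite e2 (eq_bigr _ (fun x _ => congr1 (fun z => a x * z) (e1 x))).
move=> H; apply: le_trans H _; apply: ler_wpM2l => //.
rewrite -(prod_al NB); apply: ler_prod => al _; rewrite normU andbT.
by apply: sumr_ge0.
Qed.

Let expW (al : 'I_d * J) : `|\sum_x a x * (PW x al * \prod_(k | k != al) PU x k)
   - Y * (DW al.2 * \prod_(k | k != al) DU k.2)| <= E * (Dl * NN ^+ d).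
Proof.
pose u (k : 'I_d * J) (A : {set 'I_Z}) := if k == al then W k.2 A else U k.2 A.
have u0 (k : 'I_d * J) (A : {set 'I_Z}) : ~~ (A \subset cls k.2) -> u k A = 0.
  by rewrite /u /U /W => /negbTE ->; rewrite !mul0r if_same.
have := expansion cls_prime cls_disj levelH u0.
have e1 x : \prod_k \sum_A u k A * \prod_(p in A) divs R kap x k.1 p =
    PW x al * \prod_(k | k != al) PU x k.
  rewrite (bigD1 al)//= /u eqxx sumE; congr (_ * _).
  by apply: eq_bigr => k /negbTE kal; rewrite kal sumE.
have e2 : \prod_k \sum_A u k A * \prod_(p in A) (p%:R)^-1 =
    DW al.2 * \prod_(k | k != al) DU k.2.
  rewrite (bigD1 al)//= /u eqxx sumE; congr (_ * _).
  by apply: eq_bigr => k /negbTE kal; rewrite kal sumE.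
rewrite e2 (eq_bigr _ (fun x _ => congr1 (fun z => a x * z) (e1 x))).
move=> H; apply: le_trans H _; apply: ler_wpM2l => //.
rewrite -(prod_al NB) (bigD1 al)//= [X in _ <= _ * X](bigD1 al)//= mulrA.
apply: ler_pM.
- by apply: sumr_ge0.
- by apply: prodr_ge0 => k _; apply: sumr_ge0.
- by rewrite /u eqxx; exact: normW.
apply: ler_prod => k /negbTE kal; rewrite /u kal normU andbT.
by apply: sumr_ge0.
Qed.

(** With even truncation levels each class has an upper bound sieve, hence so
    has their product; its density is that of the full sieve up to the factor
    exp (d tau). *)
Lemma brun_hooley_upper :
  \sum_(x | sifted x) a x <= Y * VV ^+ d * expR (d%:R * tau) + E * NN ^+ d.
Proof.
apply: (@le_trans _ _ (\sum_x a x * \prod_al PU x al)).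
  rewrite big_mkcond; apply: ler_sum => x _.
  rewrite -[leLHS]/(if sifted x then a x else 0).
  have -> : (if sifted x then a x else 0) = a x * \prod_al X x al.
    by rewrite -sifted_prod; case: ifP => _; rewrite ?mulr1 ?mulr0.
  apply: ler_wpM2l => //; apply: ler_prod => al _.
  by have [h1 _ ->] := bonf (@divs01 x al.1 al.2).
have := expU; rewrite ler_norml => /andP[_]; rewrite lerBlDl => /le_trans; apply.
by rewrite lerD2r -mulrA ler_wpM2l.
Qed.

(** The product of the upper bound sieves minus one defect at a time is a lower
    bound for the sifted indicator. Its density is the full density times
    1 - d tau, and each of the d #|J| defects costs as many terms as the upper
    bound, times at most [Dl]. *)
Lemma brun_hooley_lower : d%:R * tau <= 1 ->
  Y * VV ^+ d * (1 - d%:R * tau) - E * NN ^+ d * (1 + (d * #|J|)%:R * Dl)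
   <= \sum_(x | sifted x) a x.
Proof.
move=> dt; have Ddef x : \prod_al PU x al - (sifted x)%:R <=
    \sum_al PW x al * \prod_(k | k != al) PU x k.
  have := @prod_defect R _ (X x) (PU x) (PW x) finset.setT.
  have eT (F : 'I_d * J -> R) : \prod_(j in finset.setT) F j = \prod_j F j.
    by apply: eq_bigl => k; rewrite inE.
  rewrite sifted_prod !eT => H; apply: le_trans (H _ _) _.
  - by move=> al; have [h1 h2 h3] := bonf (@divs01 x al.1 al.2); apply/andP.
  - by move=> al; have [h1 h2 h3] := bonf (@divs01 x al.1 al.2).
  rewrite le_eqVlt; apply/orP; left; apply/eqP; apply: eq_big => [al|al _].
    by rewrite inE.
  by congr (_ * _); apply: eq_bigl => k; rewrite !inE andbT.
have S1 : \sum_x a x * \prod_al PU x al -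
   \sum_al \sum_x a x * (PW x al * \prod_(k | k != al) PU x k) <= \sum_(x | sifted x) a x.
  rewrite exchange_big /= -sumrB [leRHS]big_mkcond; apply: ler_sum => x _.
  have -> : (if sifted x then a x else 0) = a x * (sifted x)%:R.
    by case: ifP => _; rewrite ?mulr1 ?mulr0.
  by rewrite -mulr_sumr -mulrBr ler_wpM2l// lerBlDr -lerBlDl.
apply: le_trans S1.
have HU : Y * \prod_(al : 'I_d * J) DU al.2 - E * NN ^+ d <= \sum_x a x * \prod_al PU x al.
  by have := expU; rewrite ler_norml => /andP[+ _]; lra.
have HW : \sum_al \sum_x a x * (PW x al * \prod_(k | k != al) PU x k) <=
   Y * (\sum_(al : 'I_d * J) DW al.2 * \prod_(k | k != al) DU k.2) +
   (d * #|J|)%:R * (E * (Dl * NN ^+ d)).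
  have Ec c : (d * #|J|)%:R * c = \sum_(al : 'I_d * J) c :> R.
    by rewrite sumr_const card_prod card_ord mulr_natl.
  rewrite Ec mulr_sumr -big_split /=.
  by apply: ler_sum => al _; have := expW al; rewrite ler_norml => /andP[_]; lra.
have main : VV ^+ d * (1 - d%:R * tau) <= \prod_(al : 'I_d * J) DU al.2 -
    \sum_(al : 'I_d * J) DW al.2 * \prod_(k | k != al) DU k.2.
  set P := \prod_(al : 'I_d * J) DU al.2.
  have P1 : VV ^+ d <= P.
    rewrite -(prod_al V); apply: ler_prod => al _; rewrite (DU_bd _).1 andbT.
    exact: ltW.
  have -> : \sum_(al : 'I_d * J) DW al.2 * \prod_(k | k != al) DU k.2 =
      P * \sum_(al : 'I_d * J) DW al.2 / DU al.2.
    rewrite mulr_sumr; apply: eq_bigr => al _; rewrite /P [\prod_al0 _](bigD1 al)//=.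
    have Dp : DU al.2 != 0 by rewrite gt_eqF// (lt_le_trans _ (DU_bd _).1).
    by field.
  rewrite -[X in X - P * _]mulr1 -mulrBr.
  have T1 : \sum_(al : 'I_d * J) DW al.2 / DU al.2 <= d%:R * tau.
    apply: (@le_trans _ _ (\sum_(al : 'I_d * J) DW al.2 / V al.2)).
      apply: ler_sum => al _; apply: ler_wpM2l => //.
      rewrite lef_pV2 ?posrE//; first exact: (DU_bd _).1.
      by rewrite (lt_le_trans _ (DU_bd _).1).
    by rewrite (sum_al (fun j => DW j / V j)) -[leLHS]mulr_natl; apply: ler_wpM2l.
  have VV0 : 0 <= VV ^+ d by rewrite exprn_ge0// prodr_ge0// => j _; exact: ltW.
  have c1 : 0 <= 1 - d%:R * tau by rewrite subr_ge0.
  by apply: ler_pM => //; lra.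
have E1 : Y * (VV ^+ d * (1 - d%:R * tau)) <= Y * (\prod_(al : 'I_d * J) DU al.2 -
    \sum_(al : 'I_d * J) DW al.2 * \prod_(k | k != al) DU k.2) by exact: ler_wpM2l.
rewrite [leRHS]mulrBr mulrA in E1.
have -> : E * NN ^+ d * (1 + (d * #|J|)%:R * Dl) = E * NN ^+ d + (d * #|J|)%:R * (E * (Dl * NN ^+ d)).
  by ring.
move: HU HW E1; set A1 := Y * _; set A2 := Y * (\sum_(al : 'I_d * J) _); lra.
Qed.

End BrunHooley.

(** * The sieve with explicit ranges and level *)

Section Constants.
Variable R : realType.

(** Repeated square roots bring y into [w, w^2); the ranges of the sieve are then
    [v^(2^i), v^(2^(i+1))). *)
Lemma tower (w y : R) : 1 < w -> w <= y ->
  exists2 rv : nat * R, w <= rv.2 < w ^+ 2 & rv.2 ^+ (2 ^ rv.1) = y.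
Proof.
move=> w1 wy.
have [k yk] : exists k, y < w ^+ (2 ^ k).
  have d0 : 0 < w - 1 by rewrite subr_gt0.
  have y0 : 0 <= y / (w - 1) by rewrite divr_ge0 ?ltW// (lt_le_trans _ wy)// (lt_trans _ w1).
  pose n := (Num.truncn (y / (w - 1))).+1.
  exists n; have : y < n%:R * (w - 1).
    by rewrite -ltr_pdivrMr// /n truncnS_gt.
  have B m : 1 + m%:R * (w - 1) <= w ^+ m.
    elim: m => [|m IH]; first by rewrite mul0r addr0 expr0.
    rewrite exprS -natr1.
    have m0 : 0 <= m%:R :> R by [].
    apply: le_trans (ler_wpM2l (ltW (lt_trans ltr01 w1)) IH).
    have : 0 <= m%:R * (w - 1) ^+ 2 by rewrite mulr_ge0// sqr_ge0.
    rewrite expr2; nra.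
  have := B (2 ^ n)%N; have : n%:R <= (2 ^ n)%:R :> R by rewrite ler_nat ltnW// ltn_expl.
  move: (2 ^ n)%N => N; nra.
elim: k y wy yk => [|k IH] y wy yk.
  by move: yk; rewrite expn0 expr1 ltNge wy.
have [yw|yw] := ltP y (w ^+ 2).
  by exists (0%N, y); rewrite /= ?wy// expn0 expr1.
have y0 : 0 < y by apply: lt_le_trans wy; apply: lt_trans w1.
have sy : w <= Num.sqrt y by rewrite -(ler_pXn2r (n := 2))// ?nnegrE ?sqrtr_ge0// ?sqr_sqrtr// ltW// (lt_trans _ w1).
have sk : Num.sqrt y < w ^+ (2 ^ k).
  rewrite -(ltr_pXn2r (n := 2))// ?nnegrE ?sqrtr_ge0// ?exprn_ge0//.
    by rewrite sqr_sqrtr ?ltW// -exprM mulnC -expnS.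
  by rewrite ltW// (lt_trans _ w1).
have [[r v] /= vw E] := IH _ sy sk.
by exists (r.+1, v) => //=; rewrite expnS mulnC exprM E sqr_sqrtr// ltW.
Qed.

Lemma sum_subset_seq (s t : seq nat) (f : nat -> R) : uniq s -> uniq t ->
  {subset s <= t} -> (forall n, 0 <= f n) ->
  \sum_(n <- s) f n <= \sum_(n <- t) f n.
Proof.
move=> us ut st f0; rewrite [leRHS](bigID (mem s)) /= -[X in _ <= X + _]big_filter.
have -> : \sum_(i <- [seq x <- t | x \in s]) f i = \sum_(n <- s) f n.
  apply: perm_big; apply: uniq_perm => //; first exact: filter_uniq.
  by move=> n; rewrite mem_filter; case: (boolP (n \in s)) => // /st ->.
by rewrite lerDl sumr_ge0.
Qed.

(** Mertens' first theorem makes a range [[x, x^2)] have reciprocal sum close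
    to 1, below the value at which the Brun-Hooley tails stop converging fast
    enough. *)
Lemma range_sum : exists2 x0 : R, 100 <= x0 & forall x, x0 <= x ->
  forall Z (Q : {set 'I_Z}),
  (forall p, p \in Q -> prime p && (x <= p%:R < x ^+ 2)) ->
  \sum_(p in Q) (p%:R)^-1 <= 51 / 50 :> R.
Proof.
pose C : R := ln 16 + 4 + ln 2.
exists (Num.max 200 (expR (50 * C))); first by rewrite le_max; apply/orP; left; lra.
move=> x; rewrite ge_max => /andP[x200 xC] Z Q QP.
have x0 : 0 < x by lra.
have lnx : 50 * C <= ln x by rewrite -[leLHS]expRK ler_ln ?posrE ?expR_gt0.
have C0 : 0 < C by rewrite /C; have := @ln_ge0 R 16; have := @ln_ge0 R 2; lra.
have lx0 : 0 < ln x by lra.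
pose n0 := (Num.truncn x).-1; pose n2 := Num.truncn (x ^+ 2).
have /andP[tx1 tx2] := truncn_itv (ltW x0).
have tr1 : (100 <= Num.truncn x)%N.
  rewrite -(ler_nat R); move: tx2; rewrite -natr1; lra.
have n0E : n0.+1 = Num.truncn x by rewrite /n0; lia.
have n0x : x / 2 <= n0%:R by move: tx2; rewrite -n0E -(natr1 n0.+1) -(natr1 n0); lra.
have xx : 0 <= x ^+ 2 by rewrite exprn_ge0// ltW.
have /andP[t2 t2'] := truncn_itv xx.
have n02 : (n0 < n2)%N.
  rewrite -(ltr_nat R); move: t2'; rewrite -/n2 -natr1 expr2.
  move: tx1; rewrite -n0E -(natr1 n0); nra.
have H1 : \sum_(p in Q) ln_nat R p / p%:R <= mertens_sum R n2 - mertens_sum R n0.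
  have -> : mertens_sum R n2 - mertens_sum R n0 = \sum_(n0.+1 <= p < n2.+1 | prime p) ln_nat R p / p%:R.
    by rewrite /mertens_sum [X in X - _](big_cat_nat _ (n := n0.+1))//= 1?ltnW// addrAC subrr add0r.
  rewrite -[leRHS]big_filter.
  have -> : \sum_(p in Q) ln_nat R p / p%:R = \sum_(p <- [seq val p | p <- enum Q]) ln_nat R p / p%:R.
    by rewrite big_map big_enum.
  apply: sum_subset_seq.
  - by rewrite (map_inj_uniq val_inj) enum_uniq.
  - by rewrite filter_uniq// iota_uniq.
  - move=> n /mapP[p]; rewrite mem_enum => /QP /andP[pp /andP[xp px]] ->.
    rewrite mem_filter pp mem_index_iota n0E.
    rewrite -(ler_nat R) (le_trans tx1 xp)/= ltnS truncn_ge_nat//.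
    by rewrite ltW.
  by move=> n; rewrite divr_ge0// ln_nat_ge0.
have W2 : mertens_sum R n2 <= 2 * ln x + ln 16.
  apply: le_trans (mertens_sum_le _ (leq_ltn_trans (leq0n _) n02)) _.
  rewrite lerD2r mulr_natl -lnXn// ler_ln ?posrE ?exprn_gt0//.
  by rewrite ltr0n (leq_ltn_trans _ n02).
have n0pos : (0 < n0)%N by rewrite -ltnS n0E (leq_trans _ tr1).
have W0 : ln x - ln 2 - 4 <= mertens_sum R n0.
  apply: le_trans (mertens_sum_ge _ n0pos).
  by rewrite lerD2r -ln_div ?posrE// ler_ln ?posrE ?divr_gt0// ltr0n.
rewrite -(ler_pM2r lx0); apply: (@le_trans _ _ (\sum_(p in Q) ln_nat R p / p%:R)).
  rewrite mulr_suml; apply: ler_sum => p /QP /andP[pp /andP[xp px]].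
  rewrite mulrC ler_wpM2r// ler_ln ?posrE// ltr0n prime_gt0//.
rewrite /C in lnx; lra.
Qed.

(** The truncation level grows linearly as the ranges shrink, so the first
    neglected terms decay geometrically; the constants leave d times the sum of
    all relative tails below 1. *)
Lemma hooley_tail (d : nat) i : (0 < d)%N ->
  d%:R * ((51 / 50) ^+ (2 * (d + i)).+1 / ((2 * (d + i)).+1)`!%:R) <= 18 / 100 * (9^-1) ^+ i :> R.
Proof.
pose c (e : nat) : R := (51 / 50) ^+ (2 * e).+1 / ((2 * e).+1)`!%:R.
have c0 e : 0 <= c e by rewrite divr_ge0// exprn_ge0//; lra.
have step e : (0 < e)%N -> e.+1%:R * c e.+1 <= 9^-1 * (e%:R * c e).
  move=> e0; have -> : c e.+1 = c e * ((51 / 50) ^+ 2 / ((2 * e).+3 * (2 * e).+2)%:R).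
    rewrite /c mulnS -[(2 + 2 * e)%N]/(2 * e).+2 2!exprSr 2!factS mulnA natrM.
    by rewrite invfM; ring.
  rewrite mulrCA [e%:R * c e]mulrC [leRHS]mulrCA; apply: ler_wpM2l => //.
  rewrite mulrA ler_pdivrMr ?ltr0n//.
  have e1 : 1 <= e%:R :> R by rewrite ler1n.
  have -> : ((2 * e).+3 * (2 * e).+2)%:R = (2 * e%:R + 3) * (2 * e%:R + 2) :> R.
    by rewrite natrM -!natr1 natrM; ring.
  rewrite -natr1; nra.
have D e : (0 < e)%N -> e%:R * c e <= 18 / 100 * (9^-1) ^+ e.-1.
  elim: e => [//|[|e] IH] _.
    rewrite /c expr0 /= muln1 mul1r mulr1 -[(2).+1]/3%N -[3`!%N]/6%N; lra.
  apply: le_trans (step e.+1 isT) _; rewrite exprS [leRHS]mulrCA.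
  by apply: ler_wpM2l; [rewrite invr_ge0|exact: IH].
move=> d0; apply: (@le_trans _ _ ((d + i)%:R * c (d + i)%N)).
  by apply: ler_wpM2r; [exact: c0|rewrite ler_nat leq_addr].
apply: le_trans (D _ _) _; first by rewrite addn_gt0 d0.
apply: ler_wpM2l; first lra.
by apply: ler_wiXn2l; rewrite ?invr_ge0 ?invf_le1//; [lra|lia].
Qed.

Lemma geom9_le r : \sum_(i < r) (9^-1 : R) ^+ i <= 9 / 8.
Proof.
suff : \sum_(i < r) (9^-1 : R) ^+ i <= 9 / 8 - 9 / 8 * 9^-1 ^+ r.
  have : 0 <= (9^-1 : R) ^+ r by rewrite exprn_ge0// invr_ge0. lra.
elim: r => [|r IH]; first by rewrite big_ord0 expr0; lra.
rewrite big_ord_recr /= exprS; lra.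
Qed.

(** The number of terms of the sieve is a product of powers of the range ends,
    which are themselves powers of v with doubling exponents. *)
Lemma level_exponent d r :
  (\sum_(j < r) 2 ^ j.+1 * (2 * d + 2 * (r - j.+1)) <= (4 * d + 4) * 2 ^ r)%N.
Proof.
elim: r d => [|r IH] d; first by rewrite big_ord0.
rewrite big_ord_recr /= subnn muln0 addn0.
rewrite (eq_bigr (fun j : 'I_r => 2 ^ j.+1 * (2 * d.+1 + 2 * (r - j.+1)))%N); last first.
  by move=> j _; congr (_ * _)%N; have := ltn_ord j; lia.
apply: leq_trans (leq_add (IH d.+1) (leqnn _)) _.
rewrite expnS; move: (2 ^ r)%N => u; nia.
Qed.

(** The natural number Z is the ceiling of y, characterised by its order
    properties so that Mertens' product over p < Z runs over the primes p < y. *)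
Lemma mertens_prod_bounds : exists c : R, 0 < c /\ forall (y : R) (Z : nat), 3 <= y ->
  (forall p : nat, (p < Z)%N = (p%:R < y)) ->
  c / ln y <= mertens_prod R Z /\ mertens_prod R Z <= (ln y)^-1.
Proof.
have [c c0 Hc] := mertens_prod_ge R; exists c; split => // y Z y3 HZ.
have Zy : (2 < Z)%N by rewrite HZ (lt_le_trans _ y3)// ltr_nat.
case: Z Zy HZ => [//|n] n2 HZ.
have ny : n%:R < y by rewrite -HZ.
have yn : y <= n.+1%:R by rewrite leNgt -HZ ltnn.
have n0 : 0 < n%:R :> R by rewrite ltr0n; lia.
have ln0 : 0 < ln n%:R :> R by rewrite ln_gt0// ltr1n.
have lny0 : 0 < ln y by rewrite ln_gt0//; lra.
split.
  apply: le_trans (Hc n n2); rewrite ler_pM2l// lef_pV2 ?posrE//.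
  by rewrite ler_ln ?posrE//; lra.
have n1 : (0 < n)%N by lia.
have := mertens_prod_le R n1; rewrite -ler_pdivlMr; last first.
  by rewrite ln_gt0// ltr1n; lia.
rewrite div1r => /le_trans; apply; rewrite lef_pV2 ?posrE//.
  by rewrite ler_ln ?posrE//; lra.
by rewrite ln_gt0// ltr1n; lia.
Qed.

Lemma prime_range_prod_ge (w : R) Z (Q : {set 'I_Z}) : 102 <= w ->
  (forall p, p \in Q -> prime p && (w <= p%:R)) ->
  \sum_(p in Q) (p%:R)^-1 <= 51 / 50 :> R ->
  4^-1 <= \prod_(p in Q) (1 - (p%:R)^-1) :> R.
Proof.
move=> w102 QP QS.
apply: (@le_trans _ _ (expR (- (102 / 101 * \sum_(p in Q) (p%:R)^-1)))).
  apply: (@le_trans _ _ (expR (- (3 * (7 / 20))))).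
    rewrite expRN expRM_natl lef_pV2 ?posrE ?exprn_gt0 ?expR_gt0//.
    have e1 : expR (7 / 20) <= 20 / 13 :> R.
      have h := expRxMexpNx_1 (7 / 20 : R); have g := expR_ge1Dx (- (7 / 20) : R).
      have e0 : 0 < expR (7 / 20) :> R by exact: expR_gt0.
      nra.
    have e0 : 0 <= expR (7 / 20) :> R by exact: expR_ge0.
    apply: (@le_trans _ _ ((20 / 13) ^+ 3)); first by apply: lerXn2r; rewrite ?nnegrE//; lra.
    by rewrite !exprS expr0; lra.
  by rewrite ler_expR; lra.
rewrite mulr_sumr -sumrN expR_sum; apply: ler_prod => p /QP /andP[pp wp].
rewrite expR_ge0 /=; have p0 : 0 < p%:R :> R by lra.
have p1 : 0 < p%:R - 1 :> R by lra.
have -> : 1 - p%:R^-1 = (1 + (p%:R - 1)^-1)^-1 :> R.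
  by field; rewrite !gt_eqF//; lra.
rewrite expRN lef_pV2 ?posrE ?expR_gt0//; last by rewrite addr_gt0// invr_gt0.
apply: le_trans (expR_ge1Dx _) _; rewrite ler_expR.
rewrite -(ler_pM2l p1) divff ?gt_eqF// mulrA -(ler_pM2r p0) mul1r divfK ?gt_eqF//.
lra.
Qed.

Lemma ln_ge1 (x : R) : 4 <= x -> 1 <= ln x.
Proof.
move=> x4; rewrite -[leLHS]expRK ler_ln ?posrE ?expR_gt0//; last lra.
have e1 := expR_ge1Dx (- (1 / 2) : R); have h := expRxMexpNx_1 (1 / 2 : R).
have e0 : 0 < expR (1 / 2) :> R by exact: expR_gt0.
have -> : 1 = 1 / 2 + 1 / 2 :> R by lra.
rewrite expRD; nra.
Qed.

(** The arithmetic that collects the constants: [V] is the density of the sieve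
    in one coordinate and [NN] its number of terms. *)
Lemma sieve_arith d rr k (Y E V y cV D NN S : R) : 0 <= Y -> 0 <= E -> 0 < V -> 4 <= y ->
  1 <= ln y -> 0 < cV -> 0 <= D -> 0 <= NN -> NN <= D * y ^+ k -> rr.+1%:R <= ln y ->
  cV / ln y <= V -> V <= (ln y)^-1 ->
  S <= Y * V ^+ d * expR (82 / 100) + E * NN ->
  (82 / 100 <= 1 :> R -> Y * V ^+ d * (1 - 82 / 100) - E * NN * (1 + (d * rr.+1)%:R * y) <= S) ->
  cV ^+ d / 6 * (Y / ln y ^+ d) - (6 + D * (d%:R + 1)) * y ^+ (k + 1) * ln y * E <= S
  <= (6 + D * (d%:R + 1)) * (Y / ln y ^+ d) + (6 + D * (d%:R + 1)) * y ^+ (k + 1) * ln y * E.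
Proof.
move=> Y0 E0 V0 y4 lny cV0 D0 NNd0 NNd rle VB1 VB2 up lo.
have ymono : y ^+ k <= y ^+ (k + 1) * ln y.
  rewrite addn1 exprSr -mulrA ler_peMr ?exprn_ge0 ?mulr_ege1//; lra.
set y2 := y ^+ (k + 1) * ln y in ymono *.
set y3 := y ^+ k in NNd ymono *.
have y20 : 0 <= y2 by rewrite /y2 mulr_ge0// ?exprn_ge0//; lra.
have d10 : 0 <= d%:R + 1 :> R by rewrite addr_ge0.
have y3E : y2 = y3 * (y * ln y) by rewrite /y2 addn1 exprSr -mulrA.
have EN0 : 0 <= E * NN by rewrite mulr_ge0.
have EN : E * NN <= D * y2 * E.
  rewrite mulrC ler_wpM2r//; apply: le_trans NNd _; exact: ler_wpM2l.
have EN2 : E * NN * (1 + (d * rr.+1)%:R * y) <= (d%:R + 1) * (D * y2 * E).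
  have -> : (d%:R + 1) * (D * y2 * E) = E * (D * y3) * ((d%:R + 1) * (y * ln y)).
    by rewrite y3E; ring.
  apply: ler_pM => //; first by rewrite addr_ge0// mulr_ge0//; lra.
    exact: ler_wpM2l.
  rewrite natrM mulrDl mul1r addrC; apply: lerD; last by rewrite mulr_ege1//; lra.
  rewrite -mulrA ler_wpM2l// mulrC ler_wpM2l//; lra.
have lnd0 : 0 < ln y ^+ d by rewrite exprn_gt0//; lra.
rewrite -[_ * y ^+ (k + 1) * ln y]mulrA -/y2.
have CE : (6 + D * (d%:R + 1)) * y2 * E = 6 * (y2 * E) + (d%:R + 1) * (D * y2 * E) by ring.
rewrite CE.
have y2E : 0 <= y2 * E by rewrite mulr_ge0.
have DE : 0 <= D * y2 * E by rewrite mulr_ge0// mulr_ge0.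
have YV1 : cV ^+ d * (Y / ln y ^+ d) <= Y * V ^+ d.
  rewrite mulrCA -expr_div_n ler_wpM2l//; apply: lerXn2r; rewrite ?nnegrE//; last exact: ltW.
  by rewrite divr_ge0//; lra.
have YV2 : Y * V ^+ d <= Y / ln y ^+ d.
  rewrite ler_wpM2l// -exprVn; apply: lerXn2r; rewrite ?nnegrE ?invr_ge0//; [exact: ltW|lra].
have YV0 : 0 <= Y * V ^+ d by rewrite mulr_ge0// exprn_ge0// ltW.
have e6 : expR (82 / 100) <= 6 :> R.
  have h := expRxMexpNx_1 (82 / 100 : R); have g := expR_ge1Dx (- (82 / 100) : R).
  have e0 : 0 < expR (82 / 100) :> R by exact: expR_gt0.
  nra.
have d1E : D * y2 * E <= (d%:R + 1) * (D * y2 * E).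
  by rewrite ler_peMl// lerDr.
have h6 : Y * V ^+ d * expR (82 / 100) <= Y / ln y ^+ d * 6.
  by apply: ler_pM => //; exact: expR_ge0.
have YL : 0 <= Y / ln y ^+ d by rewrite divr_ge0// ltW.
have DyY : 0 <= D * (d%:R + 1) * (Y / ln y ^+ d) by rewrite mulr_ge0// mulr_ge0.
move: lo => /(_ _) lo; have {}lo := lo ltac:(lra).
clear y3E ymono NNd EN0 CE VB1 VB2 lnd0 d10 e6 y20.
apply/andP; split; lra.
Qed.

Lemma rev_trunc d r i : (i < r)%N -> (2 * d + 2 * (r - (r - i.+1).+1) = 2 * (d + i))%N.
Proof. lia. Qed.

(** The Brun-Hooley sieve of dimension one in each of d coordinates. The primes
    below a constant bound are sieved without truncation, the others in ranges
    whose truncation levels decrease from 2 d + 2 (r - 1) to 2 d. The power of y in the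
    error is d times the exponent 4 d + 4 counting the terms of one coordinate,
    plus one for the defects. *)
Theorem sieve_bounds (d : nat) : (0 < d)%N ->
  exists y0 c C : R, [/\ 3 <= y0, 0 < c, 0 < C & forall y, y0 <= y ->
  forall (I : finType) (kap : I -> 'I_d -> nat) (a : I -> R) (Y E : R) (P : pred I),
  (forall x, 0 <= a x) -> 0 <= Y -> 0 <= E ->
  (forall q : 'I_d -> nat, (forall i, 0 < q i)%N ->
    `|\sum_(x | [forall i, q i %| kap x i]%N) a x - Y / (\prod_i q i)%:R| <= E) ->
  (forall x, P x <-> forall p i, prime p -> p%:R < y -> ~~ (p %| kap x i)%N) ->
  c * (Y / ln y ^+ d) - C * y ^+ (4 * d * d + 4 * d + 1) * ln y * E
    <= \sum_(x | P x) a x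
    <= C * (Y / ln y ^+ d) + C * y ^+ (4 * d * d + 4 * d + 1) * ln y * E].
Proof.
move=> d0; have [x0 x0_100 RS] := range_sum.
have [cV [cV0 VB]] := mertens_prod_bounds.
pose w : R := 102 + x0.
have w202 : 202 <= w by rewrite /w; lra.
pose W : nat := (Num.truncn (w ^+ 2)).+1.
have wW : w ^+ 2 < W%:R by rewrite truncnS_gt.
pose C0 : R := (w ^+ 2) ^+ (2 * W).
have C01 : 1 <= C0 by rewrite exprn_ege1// exprn_ege1//; lra.
pose C : R := 6 + C0 ^+ d * (d%:R + 1).
exists w, (cV ^+ d / 6), C; split; [lra|by rewrite divr_gt0// exprn_gt0| |].
  have C0p : 0 <= C0 ^+ d by rewrite exprn_ge0//; lra.
  have d1 : 0 <= d%:R + 1 :> R by rewrite addr_ge0.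
  by have := mulr_ge0 C0p d1; rewrite /C; lra.
move=> y wy I kap a Y E P a0 Y0 E0 levelH PH.
have w1 : 1 < w by lra.
have [[r v] /= /andP[wv vw] vy] := tower w1 wy.
have y1 : 1 < y by lra.
have v1 : 1 < v by lra.
(* the ceiling of y *)
pose Z : nat := if (Num.truncn y)%:R == y then Num.truncn y else (Num.truncn y).+1.
have /andP[ty1 ty2] := truncn_itv (ltW (lt_trans ltr01 y1)).
have ZP p : (p < Z)%N = (p%:R < y).
  rewrite /Z; case: eqP => [{2}<-|/eqP ne]; first by rewrite ltr_nat.
  rewrite ltnS; apply/idP/idP => [pt|py].
    apply: (@le_lt_trans _ _ (Num.truncn y)%:R); first by rewrite ler_nat.
    by rewrite lt_neqAle ne.
  by rewrite -ltnS -(ltr_nat R) (lt_trans py).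
(* class 0 gathers the primes below v, class k + 1 those in
   [v^(2^k), v^(2^(k+1))) *)
pose thr (j : nat) : R := if j is k.+1 then v ^+ (2 ^ k) else 0.
have thr_ge1 k : 1 <= thr k.+1 by rewrite exprn_ege1// ltW.
have thr_mono j k : (j <= k)%N -> thr j <= thr k.
  case: j k => [|j] [|k] // jk; first by rewrite (le_trans ler01).
  by apply: ler_weXn2l; [exact: ltW|rewrite leq_exp2l].
have thr_sq k : thr k.+2 = thr k.+1 ^+ 2 by rewrite /thr -exprM expnSr.
have thr_w k : w <= thr k.+1.
  by apply: le_trans wv _; rewrite -[leLHS]expr1; apply: ler_weXn2l; [exact: ltW|rewrite expn_gt0].
have thr_r : thr r.+1 = y by [].
have thr1 : thr 1 = v by rewrite -[thr 1]/(v ^+ (2 ^ 0)) expn0 expr1.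
pose cls (j : 'I_r.+1) : {set 'I_Z} := finset (fun p : 'I_Z => prime p && (thr j <= p%:R < thr j.+1)).
have cls_prime j p : p \in cls j -> prime p by rewrite inE => /andP[].
have cls_disj j k p : p \in cls j -> p \in cls k -> j = k.
  rewrite !inE => /andP[_ /andP[a1 a2]] /andP[_ /andP[b1 b2]].
  apply/val_inj/eqP; rewrite eqn_leq; apply/andP; split; rewrite leqNgt; apply/negP => lt.
    by have := lt_le_trans b2 (le_trans (thr_mono _ _ lt) a1); rewrite ltxx.
  by have := lt_le_trans a2 (le_trans (thr_mono _ _ lt) b1); rewrite ltxx.
have cls_cover (p : 'I_Z) : prime p -> exists j, p \in cls j.
  move=> pp; have py : p%:R < y by rewrite -ZP.
  have ex : exists k, p%:R < thr k by exists r.+1; rewrite thr_r.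
  case: (ex_minnP ex) => [[|k] pk kmin]; first by move: pk; rewrite /thr ltNge ler0n.
  have kr : (k < r.+1)%N by apply: kmin; rewrite thr_r.
  exists (Ordinal kr); rewrite inE pp pk andbT /= leNgt; apply/negP => /kmin.
  by rewrite ltnn.
(* 2 W exceeds the number of primes below v, so that class 0 is sieved
   exactly *)
pose b (j : 'I_r.+1) : nat := if (j : nat) is k.+1 then (2 * d + 2 * (r - k.+1))%N else (2 * W)%N.
have b_even j : ~~ odd (b j).
  have ev n : ~~ odd (2 * n) by rewrite oddM.
  by case: j => [[|k] kr]; [exact: (ev W)|have := ev (d + (r - k.+1))%N; rewrite mulnDr].
have card_cls j : (#|cls j|).+1%:R <= thr j.+1.
  have t0 : 0 <= thr j.+1 by apply: le_trans (thr_ge1 _).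
  have /andP[u1 _] := truncn_itv t0; apply: le_trans u1; rewrite ler_nat.
  have tr1 : (0 < Num.truncn (thr j.+1))%N by rewrite truncn_gt0.
  have -> : #|cls j| = size [seq val p | p <- enum (cls j)] by rewrite size_map -cardE.
  rewrite -[X in (_ < X)%N](prednK tr1) ltnS -[leqRHS](size_iota 2).
  apply: uniq_leq_size; first by rewrite (map_inj_uniq val_inj) enum_uniq.
  move=> n /mapP[p]; rewrite mem_enum inE => /andP[pp /andP[_ pt]] ->.
  rewrite mem_iota prime_gt1//= add2n prednK// ltnS.
  by rewrite truncn_ge_nat// ltW.
have NB_ge j : ((#|cls j|).+1)%:R ^+ b j <= thr j.+1 ^+ b j.
  by apply: lerXn2r; rewrite ?nnegrE// (le_trans ler01).
have Dl_ge j : (#|cls j|)%:R <= y.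
  apply: (@le_trans _ _ (thr j.+1)); first by apply: le_trans (card_cls j); rewrite ler_nat.
  by rewrite -thr_r thr_mono// ltnS -ltnS.
have range_le (j : 'I_r.+1) : (0 < j)%N -> \sum_(p in cls j) (p%:R)^-1 <= 51 / 50 :> R.
  case: j => [[//|k] kr] /= _; apply: (RS (thr k.+1)).
    by apply: le_trans (thr_w k); rewrite /w; lra.
  by move=> p; rewrite inE /= => /andP[-> /=]; rewrite -thr_sq.
have V_ge (j : 'I_r.+1) : (0 < j)%N -> 4^-1 <= \prod_(p in cls j) (1 - (p%:R)^-1) :> R.
  move=> j0; apply: (@prime_range_prod_ge w); [lra| |exact: range_le].
  case: j j0 => [[//|k] kr] /= _ p; rewrite inE /= => /andP[-> /= /andP[+ _]].
  exact: (le_trans (thr_w k)).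
(* 82/100 bounds 4 * 18/100 * 9/8, the geometric sum of the tails divided
   by the least density 1/4 of a range *)
pose tau : R := 82 / 100 / d%:R.
have d0' : 0 < d%:R :> R by rewrite ltr0n.
have dtau : d%:R * tau = 82 / 100 by rewrite /tau mulrC divfK// gt_eqF.
have tail_le : \sum_j subset_sum (fun p : 'I_Z => (p%:R)^-1) (exact_size R (b j).+1) (cls j) /
   \prod_(p in cls j) (1 - (p%:R)^-1) <= tau.
  rewrite big_ord_recl [X in X / _](_ : _ = 0) ?mul0r ?add0r; last first.
    rewrite /subset_sum big1// => A AQ; rewrite /exact_size [_ == _](_ : _ = false) ?mul0r//.
    apply/negbTE; rewrite neq_ltn; apply/orP; left; rewrite ltnS.
    apply: leq_trans (subset_leq_card AQ) _.
    rewrite -(ler_nat R); apply: (@le_trans _ _ (thr 1)).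
      by apply: le_trans (card_cls ord0); rewrite ler_nat.
    rewrite thr1 -[b ord0]/(2 * W)%N; apply: (@le_trans _ _ W%:R).
      by rewrite ltW// (lt_trans vw).
    by rewrite ler_nat leq_pmull.
  rewrite -(ler_pM2l d0') dtau mulr_sumr (reindex_inj rev_ord_inj) /=.
  apply: (@le_trans _ _ (\sum_(i < r) (4 * (18 / 100)) * (9^-1) ^+ i)).
    apply: ler_sum => i _.
    set j := lift ord0 (rev_ord i).
    have j0 : (0 < j)%N by [].
    have bj : b j = (2 * (d + i))%N.
      by rewrite -[b j]/(2 * d + 2 * (r - (r - i.+1).+1))%N; exact: rev_trunc (ltn_ord i).
    have inv0 : {in cls j, forall p : 'I_Z, 0 <= (p%:R)^-1 :> R} by move=> p _.
    have V0 : 0 < \prod_(p in cls j) (1 - (p%:R)^-1) :> R by apply: lt_le_trans (V_ge _ j0).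
    rewrite [leLHS]mulrA ler_pdivrMr//.
    apply: (@le_trans _ _ (18 / 100 * 9^-1 ^+ i)).
      apply: le_trans (hooley_tail i d0); rewrite ler_pM2l//.
      apply: le_trans (esym_le _ inv0) _; rewrite bj.
      apply: ler_wpM2r; first by rewrite invr_ge0.
      apply: lerXn2r; rewrite ?nnegrE ?sumr_ge0//.
      exact: range_le.
    have u4 := V_ge _ j0; have g0 : 0 <= (9^-1 : R) ^+ i by rewrite exprn_ge0// invr_ge0.
    have := ler_wpM2l g0 u4; lra.
  rewrite -mulr_sumr; have := geom9_le r; lra.
have VE : \prod_j \prod_(p in cls j) (1 - (p%:R)^-1) = mertens_prod R Z.
  rewrite /mertens_prod big_mkord [RHS]big_mkcond /=.
  under eq_bigr do rewrite big_mkcond.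
  rewrite exchange_big /=; apply: eq_bigr => p _; case: ifP => pp.
    have [j pj] := cls_cover _ pp; rewrite (bigD1 j)//= pj big1 ?mulr1// => k kj.
    by case: ifP => // pk; rewrite (cls_disj _ _ _ pk pj) eqxx in kj.
  by rewrite big1// => j _; rewrite inE pp.
have NNle : \prod_(j < r.+1) thr j.+1 ^+ b j <= C0 * y ^+ (4 * d + 4).
  rewrite big_ord_recl; apply: ler_pM.
  - by rewrite exprn_ge0// (le_trans ler01).
  - by rewrite prodr_ge0// => j _; rewrite exprn_ge0// (le_trans ler01).
  - rewrite thr1 -[b ord0]/(2 * W)%N; apply: lerXn2r; rewrite ?nnegrE; lra.
  have -> : \prod_(i < r) thr (lift ord0 i).+1 ^+ b (lift ord0 i) =
     v ^+ (\sum_(i < r) 2 ^ i.+1 * (2 * d + 2 * (r - i.+1))).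
    rewrite (big_morph _ (exprD v) (expr0 v)); apply: eq_bigr => i _.
    by rewrite -[thr _]/(v ^+ (2 ^ i.+1)) -[b _]/(2 * d + 2 * (r - i.+1))%N -exprM.
  rewrite -[X in X ^+ (4 * d + 4)]vy -exprM; apply: ler_weXn2l; first exact: ltW.
  by rewrite [leqRHS]mulnC; exact: level_exponent.
have NN0 : 0 <= \prod_(j < r.+1) thr j.+1 ^+ b j.
  by rewrite prodr_ge0// => j _; rewrite exprn_ge0// (le_trans ler01).
have NNd : (\prod_(j < r.+1) thr j.+1 ^+ b j) ^+ d <= C0 ^+ d * y ^+ (4 * d * d + 4 * d).
  have -> : (4 * d * d + 4 * d = (4 * d + 4) * d)%N by rewrite mulnDl.
  rewrite [y ^+ _]exprM -exprMn; apply: lerXn2r => //; rewrite nnegrE.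
  by rewrite mulr_ge0 ?exprn_ge0//; lra.
have lny : 1 <= ln y by apply: ln_ge1; lra.
have lnv : 1 <= ln v by apply: ln_ge1; lra.
have rle : r.+1%:R <= ln y.
  rewrite -vy lnXn; last lra.
  rewrite -[leRHS]mulr_natr; apply: (@le_trans _ _ (2 ^ r)%:R).
    by rewrite ler_nat ltn_expl.
  by rewrite ler_peMl.
have [VB1 VB2] : cV / ln y <= mertens_prod R Z /\ mertens_prod R Z <= (ln y)^-1.
  by apply: VB => //; lra.
have V0 := mertens_prod_gt0 R Z.
have SE : \sum_(x | P x) a x =
    \sum_(x | [forall al : 'I_d * 'I_r.+1, forall p in cls al.2, ~~ (p %| kap x al.1)%N]) a x.
  apply: eq_bigl => x; apply/idP/idP => [/PH H|/forallP H].
    apply/forallP => -[i j] /=; apply/forall_inP => p pj.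
    by apply: H; [exact: cls_prime pj|rewrite -ZP].
  apply/PH => p i pp py; have pZ : (p < Z)%N by rewrite ZP.
  have [j pj] := cls_cover (Ordinal pZ) pp.
  by have /forall_inP/(_ _ pj) := H (i, j).
have up := brun_hooley_upper cls_prime cls_disj a0 Y0 E0 levelH b_even tail_le NB_ge.
have lo := brun_hooley_lower cls_prime cls_disj a0 Y0 E0 levelH b_even tail_le NB_ge Dl_ge.
rewrite -SE VE dtau in up; rewrite -SE VE dtau card_ord in lo.
by rewrite -[C]/(6 + C0 ^+ d * (d%:R + 1)); apply: sieve_arith rle VB1 VB2 up lo => //; try lra;
  rewrite exprn_ge0//; lra.
Qed.

End Constants.

(** * Tents as limits of positive combinations of cosines *)

Section Fejer.
Variable R : realType.
Implicit Types (L H : nat) (x t th : R).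

Definition fejer L th : R := L%:R + 2 * \sum_(l < L) (L - l.+1)%:R * cos (l.+1%:R * th).

Lemma fejerS L th : fejer L.+1 th = fejer L th + (1 + 2 * \sum_(l < L) cos (l.+1%:R * th)).
Proof.
rewrite /fejer big_ord_recr /= subnn mul0r addr0 -natr1.
suff -> : \sum_(l < L) (L.+1 - l.+1)%:R * cos (l.+1%:R * th) =
  \sum_(l < L) (L - l.+1)%:R * cos (l.+1%:R * th) + \sum_(l < L) cos (l.+1%:R * th) by ring.
rewrite -big_split /=; apply: eq_bigr => l _.
by rewrite subSn ?ltn_ord// -natr1 mulrDl mul1r.
Qed.

Lemma fejer_sq L th :
  fejer L th = (\sum_(i < L) cos (i%:R * th)) ^+ 2 + (\sum_(i < L) sin (i%:R * th)) ^+ 2.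
Proof.
elim: L => [|L IH]; first by rewrite /fejer !big_ord0 mulr0 addr0 expr0n /= addr0.
rewrite fejerS IH !big_ord_recr /=.
have E : \sum_(l < L) cos (l.+1%:R * th) =
   (\sum_(i < L) cos (i%:R * th)) * cos (L%:R * th) + (\sum_(i < L) sin (i%:R * th)) * sin (L%:R * th).
  rewrite (reindex_inj rev_ord_inj) /= !mulr_suml -big_split /=.
  apply: eq_bigr => i _; rewrite subnSK// natrB 1?ltnW// mulrBl cosB; ring.
have := cos2Dsin2 (L%:R * th).
move: (cos (L%:R * th)) (sin (L%:R * th)) E => c s E cs.
rewrite E; move: (\sum_(i < L) cos _) (\sum_(i < L) sin _) => A B.
have -> : (A + c) ^+ 2 + (B + s) ^+ 2 = A ^+ 2 + B ^+ 2 + ((c ^+ 2 + s ^+ 2) + 2 * (A * c + B * s)) by ring.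
by rewrite cs.
Qed.

Lemma fejer_ge0 L th : 0 <= fejer L th.
Proof. by rewrite fejer_sq addr_ge0// sqr_ge0. Qed.

Lemma fejer_cos L th : (1 - cos th) * fejer L th = 1 - cos (L%:R * th).
Proof.
have D n : (1 - cos th) * (1 + 2 * \sum_(l < n) cos (l.+1%:R * th)) =
    cos (n%:R * th) - cos (n.+1%:R * th).
  elim: n => [|n IH]; first by rewrite big_ord0 mulr0 addr0 mul0r cos0 mul1r mulr1.
  rewrite big_ord_recr /=.
  have Er u v : (1 - cos th) * (1 + 2 * (u + v)) = (1 - cos th) * (1 + 2 * u) + (1 - cos th) * 2 * v by ring.
  rewrite Er IH.
  have E : cos (n.+2%:R * th) + cos (n%:R * th) = 2 * (cos th * cos (n.+1%:R * th)).
    have -> : n.+2%:R * th = n.+1%:R * th + th by rewrite -natr1 mulrDl mul1r.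
    have -> : n%:R * th = n.+1%:R * th - th by rewrite -natr1 mulrDl mul1r addrK.
    rewrite cosD cosB; ring.
  move: E; move: (cos (n.+2%:R * th)) (cos (n.+1%:R * th)) (cos (n%:R * th)) (cos th) => a b c e E.
  have -> : a = 2 * (e * b) - c by rewrite -E addrK.
  ring.
elim: L => [|L IH]; first by rewrite /fejer big_ord0 mulr0 addr0 mulr0 mul0r cos0 subrr.
by rewrite fejerS mulrDr IH D addrA subrK.
Qed.

Lemma cosD2pin (x : R) n : cos (x + n%:R * (2 * pi)) = cos x.
Proof.
have := periodicn (@cosD2pi R) n x; congr (cos (_ + _) = _).
by rewrite -[LHS]mulr_natl; congr (_ * _); rewrite mulr_natl.
Qed.

Lemma sinD2pin (x : R) n : sin (x + n%:R * (2 * pi)) = sin x.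
Proof.
have := periodicn (@sinD2pi R) n x; congr (sin (_ + _) = _).
by rewrite -[LHS]mulr_natl; congr (_ * _); rewrite mulr_natl.
Qed.

Lemma cosD2piz (x : R) (k : int) : cos (x + k%:~R * (2 * pi)) = cos x.
Proof.
case: k => n; first exact: cosD2pin.
by rewrite NegzE -[LHS](cosD2pin _ n.+1) mulrNz mulNr subrK.
Qed.

(** Multiplication by twice the sine of the half step makes the sum telescope,
    and a full turn brings it back to its start. *)
Lemma sum_cos_roots L (l : nat) x : (0 < l < L)%N ->
  \sum_(j < L) cos (x - l%:R * (2 * pi * (j%:R / L%:R))) = 0.
Proof.
move=> /andP[l0 lL]; have L0 : 0 < L%:R :> R by rewrite ltr0n; lia.
pose be : R := l%:R * pi / L%:R.
have sb : 0 < sin be.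
  apply: sin_gt0_pi; apply/andP; split.
    by rewrite divr_gt0// mulr_gt0 ?pi_gt0// ltr0n.
  by rewrite ltr_pdivrMr// mulrC ltr_pM2l ?pi_gt0// ltr_nat.
suff H n : sin be * (2 * \sum_(j < n) cos (x - l%:R * (2 * pi * (j%:R / L%:R)))) =
    sin (x + be) - sin (x + be - 2 * n%:R * be).
  have := H L; have -> : 2 * L%:R * be = l%:R * (2 * pi) by rewrite /be; field; rewrite gt_eqF.
  rewrite -[X in sin (x + be) - X](sinD2pin _ l) subrK subrr => /eqP.
  by rewrite !mulf_eq0 (gt_eqF sb) pnatr_eq0 /= => /eqP.
elim: n => [|n IH]; first by rewrite big_ord0 !mulr0 mul0r subr0 subrr.
rewrite big_ord_recr /= mulrDr mulrDr IH.
have -> : l%:R * (2 * pi * (n%:R / L%:R)) = 2 * n%:R * be by rewrite /be; field; rewrite gt_eqF.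
have -> : 2 * n.+1%:R * be = 2 * n%:R * be + be + be by rewrite -natr1; ring.
set y := x - 2 * n%:R * be.
have -> : x + be - 2 * n%:R * be = y + be by rewrite /y; ring.
have -> : x + be - (2 * n%:R * be + be + be) = y - be by rewrite /y; ring.
rewrite (sinD y be) (sinB y be); ring.
Qed.

(** Only the constant harmonic survives averaging over the L-th roots of unity. *)
Lemma fejer_sum L x : (0 < L)%N ->
  \sum_(j < L) fejer L (2 * pi * (x - j%:R / L%:R)) = L%:R ^+ 2.
Proof.
move=> L0; rewrite /fejer big_split /= sumr_const card_ord -mulr_sumr exchange_big /=.
rewrite [X in _ + 2 * X]big1 ?mulr0 ?addr0 ?expr2 ?mulr_natr//.
move=> l _; rewrite -mulr_sumr.
have [lL|] := ltnP l.+1 L; last by rewrite -subn_eq0 => /eqP ->; rewrite mul0r.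
under eq_bigr do rewrite mulrBr mulrBr.
by rewrite sum_cos_roots ?mulr0.
Qed.

(** Distance to the nearest integer. *)
Definition zdist x : R := Num.min (x - (Num.floor x)%:~R) ((Num.floor x)%:~R + 1 - x).

Lemma zdist_le x (k : int) : zdist x <= `|x - k%:~R|.
Proof.
rewrite /zdist; set f := Num.floor x.
have [kf|kf] := leP k f.
  rewrite ge_min; apply/orP; left; apply: le_trans (ler_norm _).
  by rewrite lerD2l lerN2 ler_int.
rewrite ge_min; apply/orP; right; rewrite distrC; apply: le_trans (ler_norm _).
by rewrite lerD2r -(intrD _ f 1) ler_int; lia.
Qed.

Lemma zdist_ex x : exists k : int, zdist x = `|x - k%:~R|.
Proof.
have := floor_itv x; rewrite /zdist; set f := Num.floor x => /andP[f1 f2].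
rewrite minEle; case: ifP => _.
  by exists f; rewrite ger0_norm// subr_ge0.
exists (f + 1); rewrite distrC ger0_norm ?intrD// subr_ge0 ltW//.
by rewrite intrD in f2.
Qed.

Lemma zdist_ge0 x : 0 <= zdist x.
Proof. by have [k ->] := zdist_ex x. Qed.

Lemma zdist_le_half x : zdist x <= 1 / 2.
Proof. by rewrite /zdist ge_min; apply/orP; have [h|h] := leP (x - (Num.floor x)%:~R) (1 / 2); [left|right; lra]. Qed.

Lemma zdist_lip x y : `|zdist x - zdist y| <= zdist (x - y).
Proof.
suff H u v : zdist u - zdist v <= zdist (u - v).
  rewrite ler_norml H andbT lerNl opprB; apply: le_trans (H y x) _.
  have [k ->] := zdist_ex (x - y); rewrite distrC.
  have -> : k%:~R - (x - y) = (y - x) - (- k)%:~R by rewrite rmorphN/=; ring.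
  exact: zdist_le.
have [k ->] := zdist_ex v; have [l ->] := zdist_ex (u - v).
rewrite lerBlDr; apply: le_trans (zdist_le u (k + l)) _.
have -> : u - (k + l)%:~R = (u - v - l%:~R) + (v - k%:~R) by rewrite intrD; ring.
exact: ler_normD.
Qed.

(** On [0, pi / 2] the sine has at least linear growth, by the mean value theorem
    on [0, 1] and monotonicity beyond. *)
Lemma one_minus_cos_ge : exists2 c : R, 0 < c & forall x, c * zdist x ^+ 2 <= 1 - cos (2 * pi * x).
Proof.
pose c : R := cos 1 / 2; have c0 : 0 < c by rewrite divr_gt0// cos1_gt0.
have pi2 : pi <= 4 :> R by have := @pihalf_lt2 R; lra.
have pi1 : 2 <= pi :> R by exact: pi_ge2.
have S y : 0 <= y <= pi / 2 -> c * y <= sin y.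
  move=> /andP[y0 yp]; have [y1|y1] := leP y 1.
    move: y0; rewrite le_eqVlt => /orP[/eqP <-|y0]; first by rewrite sin0 mulr0.
    have [z /[!in_itv]/= /andP[z0 zy]] := @MVT R sin cos 0 y y0 (fun x _ => is_derive_sin x)
      (continuous_subspaceT (@continuous_sin R)).
    rewrite sin0 !subr0 => ->; rewrite ler_pM2r//.
    have : cos 1 <= cos z.
      rewrite leNgt ltr_cos ?in_itv/=; last 2 first.
      - by apply/andP; split; lra.
      - by apply/andP; split; lra.
      by rewrite -leNgt; lra.
    by rewrite /c; have := cos1_gt0 R; lra.
  have s1 : c * 2 <= sin 1.
    have [z /[!in_itv]/= /andP[z0 zy]] := @MVT R sin cos 0 1 ltr01 (fun x _ => is_derive_sin x)
      (continuous_subspaceT (@continuous_sin R)).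
    rewrite sin0 !subr0 mulr1 => ->; rewrite /c divfK//.
    rewrite leNgt ltr_cos ?in_itv/=; last 2 first.
    - by apply/andP; split; lra.
    - by apply/andP; split; lra.
    by rewrite -leNgt; lra.
  have : sin 1 <= sin y.
    rewrite leNgt ltr_sin ?in_itv/=; last 2 first.
    - by apply/andP; split; lra.
    - by apply/andP; split; lra.
    by rewrite -leNgt; lra.
  by apply: le_trans; apply: le_trans s1; rewrite ler_pM2l//; lra.
exists (2 * c ^+ 2); first by rewrite mulr_gt0// exprn_gt0.
move=> x; have [k zk] := zdist_ex x; have zh := zdist_le_half x; have z0 := zdist_ge0 x.
have -> : cos (2 * pi * x) = cos ((pi * zdist x) *+ 2).
  rewrite -(cosD2piz _ (- k)) -cos_norm zk.
  have -> : 2 * pi * x + (- k)%:~R * (2 * pi) = (pi *+ 2) * (x - k%:~R) by rewrite rmorphN/= -mulr_natl; ring.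
  by rewrite normrM normrMn (ger0_norm (pi_ge0 R)) mulrnAl.
rewrite cos_mulr2n cos2sin2.
have := S (pi * zdist x).
have -> : 0 <= pi * zdist x <= pi / 2 by rewrite mulr_ge0 ?pi_ge0//= ler_pM2l ?pi_gt0// -div1r.
move=> /(_ isT) sz; set s := sin _ in sz *.
have s0 : 0 <= c * zdist x by rewrite mulr_ge0// ltW.
have cz : c * zdist x <= s.
  by apply: le_trans sz; rewrite ler_pM2l// ler_peMl//; lra.
have : (c * zdist x) ^+ 2 <= s ^+ 2 by apply: lerXn2r; rewrite ?nnegrE// (le_trans s0).
rewrite exprMn mulr2n; move: (c ^+ 2) (zdist x ^+ 2) (s ^+ 2) => a b e; lra.
Qed.

(** The periodic tent of half-width [1 / rho]. *)
Definition tent (rho : nat) x : R := Num.max 0 (1 - rho%:R * zdist x).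

Lemma tent01 rho x : 0 <= tent rho x <= 1.
Proof.
rewrite /tent le_max lexx /= ge_max ler01 /= gerBl.
by rewrite mulr_ge0// zdist_ge0.
Qed.

Lemma tent_lip rho x y : `|tent rho x - tent rho y| <= rho%:R * zdist (x - y).
Proof.
have r0 : 0 <= rho%:R :> R by [].
have := zdist_lip x y; move/(ler_wpM2l r0); apply: le_trans.
rewrite -[X in X * `|_|](ger0_norm r0) -normrM mulrBr.
suff M (p q : R) : Num.max 0 (1 - p) - Num.max 0 (1 - q) <= `|p - q|.
  by rewrite ler_norml M andbT lerNl opprB [leRHS]distrC M.
rewrite lerBlDr ge_max addr_ge0 ?le_max ?lexx//=.
have h1 : q - p <= `|p - q| by rewrite distrC ler_norm.
have h2 : 1 - q <= Num.max 0 (1 - q) by rewrite le_max lexx orbT.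
lra.
Qed.

Section Grid.
Variables (rho H : nat).
Hypotheses (rho2 : (2 <= rho)%N) (H0 : (0 < H)%N).
Let L := (H * rho)%N.
Let HL : (H + H <= L)%N. Proof. by rewrite addnn -muln2 leq_mul2l rho2 orbT. Qed.
Let L0 : (0 < L)%N. Proof. by apply: leq_trans HL; rewrite addn_gt0 H0. Qed.
Let H0' : 0 < H%:R :> R. Proof. by rewrite ltr0n. Qed.
Let L0' : 0 < L%:R :> R. Proof. by rewrite ltr0n. Qed.

(** The tent of half-width 1 / rho sampled at the points j / L of the circle: the grid
    is fine enough for H steps to cover half the support. *)
Let phi (j : nat) : R := ((H - j) + (H - (L - j)))%N%:R / H%:R.

Let tent_grid j : (j < L)%N -> tent rho (j%:R / L%:R) = phi j.
Proof.
move=> jL; have jL' : j%:R < L%:R :> R by rewrite ltr_nat.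
have f0 : Num.floor (j%:R / L%:R : R) = 0.
  apply: floor_def; rewrite /= add0r divr_ge0//= ltr_pdivrMr// mul1r//.
have LE : L%:R = H%:R * rho%:R :> R by rewrite -natrM.
have r0 : 0 < rho%:R :> R by rewrite ltr0n; lia.
rewrite /tent /zdist f0 subr0 add0r.
have E1 : rho%:R * (j%:R / L%:R) = j%:R / H%:R :> R.
  by rewrite LE; field; rewrite !gt_eqF.
have E2 : rho%:R * (1 - j%:R / L%:R) = (L - j)%N%:R / H%:R :> R.
  by rewrite natrB 1?ltnW// LE; field; rewrite !gt_eqF.
have hE (k : nat) : Num.max 0 (1 - k%:R / H%:R) = (H - k)%N%:R / H%:R :> R.
  have [kH|kH] := leqP k H.
    have -> : 1 - k%:R / H%:R = (H - k)%N%:R / H%:R :> R.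
      by rewrite natrB// mulrBl divff// gt_eqF.
    by apply/max_idPr; rewrite divr_ge0.
  have /eqP -> : (H - k == 0)%N by rewrite subn_eq0 ltnW.
  rewrite mul0r; apply/max_idPl; rewrite subr_le0 ler_pdivlMr// mul1r ler_nat ltnW//.
have cmp : (j%:R / L%:R <= 1 - j%:R / L%:R :> R) = (j <= L - j)%N.
  rewrite -(ler_pM2l r0) E1 E2 ler_pM2r ?invr_gt0// ler_nat//.
rewrite /phi minEle cmp; case: ifP => jj.
  rewrite E1 hE; have -> : (H - (L - j) = 0)%N by move: HL jj; lia.
  by rewrite addn0.
rewrite E2 hE; have -> : (H - j = 0)%N by move: HL jj; lia.
by rewrite add0n.
Qed.

Let sum_trunc (g : nat -> R) :
  \sum_(l < L) (H - l.+1)%:R * g l = \sum_(l < H) (H - l.+1)%:R * g l.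
Proof.
rewrite -(big_mkord predT (fun l => (H - l.+1)%:R * g l)).
rewrite -(big_mkord predT (fun l => (H - l.+1)%:R * g l)).
rewrite (big_cat_nat _ (n := H))//=; last by move: HL; lia.
rewrite [X in _ + X]big_nat_cond [X in _ + X]big1 ?addr0// => l /andP[/andP[Hl _] _].
have -> : (H - l.+1 = 0)%N by lia.
by rewrite mul0r.
Qed.

Let sum_phi (g : nat -> R) : \sum_(j < L) phi j * g j =
  g 0%N + \sum_(l < H) (H - l.+1)%:R / H%:R * (g l.+1 + g (L - l.+1)%N).
Proof.
have E j : phi j * g j = ((H - j)%:R * g j + (H - (L - j))%:R * g j) / H%:R.
  by rewrite /phi natrD; ring.
under eq_bigr do rewrite E.
rewrite -mulr_suml big_split /=.
have -> : \sum_(j < L) (H - (L - j))%:R * g j = \sum_(l < H) (H - l.+1)%:R * g (L - l.+1)%N.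
  rewrite -(sum_trunc (fun l => g (L - l.+1)%N)) (reindex_inj rev_ord_inj) /=.
  apply: eq_bigr => l _; congr ((H - _)%:R * _).
  by have := ltn_ord l; lia.
have -> : \sum_(j < L) (H - j)%:R * g j = H%:R * g 0%N + \sum_(l < H) (H - l.+1)%:R * g l.+1.
  rewrite -(sum_trunc (fun l => g l.+1)).
  rewrite -(big_mkord predT (fun j => (H - j)%:R * g j)) big_ltn// subn0; congr (_ + _).
  rewrite big_add1 -(big_mkord predT (fun l => (H - l.+1)%:R * g l.+1)).
  have EL : L = L.-1.+1 by rewrite prednK.
  rewrite [in RHS]EL [RHS]big_nat_recr//= -EL.
  have -> : (H - L = 0)%N by move: HL; lia.
  by rewrite mul0r addr0.
rewrite -addrA mulrDl mulrAC divff ?gt_eqF// mul1r; congr (_ + _).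
rewrite -big_split mulr_suml /=; apply: eq_bigr => l _; ring.
Qed.

Let be (m : nat) : R := m%:R * (2 * pi / L%:R).

Let beL m j : (j <= L)%N -> m%:R * (2 * pi * ((L - j)%N%:R / L%:R)) =
   - (j%:R * be m) + m%:R * (2 * pi) :> R.
Proof. by move=> jL; rewrite natrB// /be; field; rewrite gt_eqF. Qed.

Let bej m j : m%:R * (2 * pi * (j%:R / L%:R)) = j%:R * be m :> R.
Proof. by rewrite /be; field; rewrite gt_eqF. Qed.

(** The sampled tent is a self-convolution of an interval, so its discrete
    transform is a Fejer kernel, in particular nonnegative. *)
Let phi_cos m : \sum_(j < L) phi j * cos (m%:R * (2 * pi * (j%:R / L%:R))) = fejer H (be m) / H%:R.
Proof.
rewrite (sum_phi (fun j => cos (m%:R * (2 * pi * (j%:R / L%:R))))) !mul0r !mulr0 cos0.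
rewrite /fejer [RHS]mulrDl divff ?gt_eqF//; congr (_ + _).
rewrite mulr_sumr mulr_suml; apply: eq_bigr => l _.
have lL : (l.+1 <= L)%N by have := ltn_ord l; move: HL; lia.
by rewrite beL// bej cosD2pin cosN; ring.
Qed.

Let phi_sin m : \sum_(j < L) phi j * sin (m%:R * (2 * pi * (j%:R / L%:R))) = 0.
Proof.
rewrite (sum_phi (fun j => sin (m%:R * (2 * pi * (j%:R / L%:R))))) !mul0r !mulr0 sin0 add0r.
apply: big1 => l _; have lL : (l.+1 <= L)%N by have := ltn_ord l; move: HL; lia.
by rewrite beL// bej sinD2pin sinN subrr mulr0.
Qed.

(** The weights of the approximating cosines: products of the nonnegative
    transforms of the kernel [ker] and of the sampled tent. *)
Let wgt (l : nat) : R := if l is m.+1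
  then 2 * (L - l)%N%:R * (fejer H (be l) / H%:R) / L%:R ^+ 2
  else (\sum_(j < L) phi j) / L%:R.

Let ker (x : R) : R := fejer L (2 * pi * x) / L%:R ^+ 2.

Let phi_ge0 j : 0 <= phi j. Proof. by rewrite divr_ge0. Qed.

Let wgt_ge0 l : 0 <= wgt l.
Proof.
case: l => [|l]; first by rewrite divr_ge0// sumr_ge0.
by rewrite !(mulr_ge0, divr_ge0, fejer_ge0, exprn_ge0, invr_ge0).
Qed.

Let approxE t : \sum_(j < L) phi j * ker (t - j%:R / L%:R) =
  \sum_(l < L.+1) wgt l * cos (2 * pi * l%:R * t).
Proof.
rewrite big_ord_recl mulr0 mul0r cos0 mulr1.
have E (j : 'I_L) : phi j * ker (t - j%:R / L%:R) = phi j / L%:R + \sum_(l < L)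
   2 / L%:R ^+ 2 * (L - l.+1)%:R * (phi j * cos (l.+1%:R * (2 * pi * (t - j%:R / L%:R)))).
  rewrite /ker /fejer mulrDl mulrDr; congr (_ + _).
    by congr (_ * _); field; rewrite gt_eqF.
  rewrite mulr_sumr mulr_suml mulr_sumr; apply: eq_bigr => l _; ring.
under eq_bigr do rewrite E.
rewrite big_split /= -mulr_suml; congr (_ + _).
rewrite exchange_big /=; apply: eq_bigr => l _.
rewrite -mulr_sumr.
have C : \sum_(j < L) phi j * cos (l.+1%:R * (2 * pi * (t - j%:R / L%:R))) =
   cos (2 * pi * l.+1%:R * t) * (fejer H (be l.+1) / H%:R).
  transitivity (cos (2 * pi * l.+1%:R * t) * (\sum_(j < L) phi j * cos (l.+1%:R * (2 * pi * (j%:R / L%:R)))) +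
     sin (2 * pi * l.+1%:R * t) * (\sum_(j < L) phi j * sin (l.+1%:R * (2 * pi * (j%:R / L%:R))))); last first.
    by rewrite phi_cos phi_sin mulr0 addr0.
  rewrite !mulr_sumr -big_split /=; apply: eq_bigr => j _.
  rewrite mulrBr mulrBr cosB (_ : l.+1%:R * (2 * pi * t) = 2 * pi * l.+1%:R * t); ring.
rewrite C /bump /= add1n; ring.
Qed.

Let ker_ge0 x : 0 <= ker x.
Proof. by rewrite divr_ge0 ?fejer_ge0// exprn_ge0. Qed.

Let ker_sum x : \sum_(j < L) ker (x - j%:R / L%:R) = 1.
Proof. by rewrite -mulr_suml fejer_sum// divff// expf_neq0// gt_eqF. Qed.

Let ker_cos x : ker x * (1 - cos (2 * pi * x)) <= 2 / L%:R ^+ 2.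
Proof.
rewrite /ker mulrAC ler_pM2r ?invr_gt0 ?exprn_gt0// mulrC fejer_cos.
by have := cos_geN1 (L%:R * (2 * pi * x)); lra.
Qed.

(** At t = 0 the approximant is an average of the values of the tent. *)
Let wgt_sum : \sum_(l < L.+1) wgt l <= 1.
Proof.
have -> : \sum_(l < L.+1) wgt l = \sum_(j < L) phi j * ker (0 - j%:R / L%:R).
  by rewrite approxE; apply: eq_bigr => l _; rewrite mulr0 cos0 mulr1.
apply: (@le_trans _ _ (\sum_(j < L) ker (0 - j%:R / L%:R))); last by rewrite ker_sum.
apply: ler_sum => j _; rewrite ler_piMl//.
by rewrite -tent_grid//; have /andP[] := tent01 rho (j%:R / L%:R).
Qed.

(** The kernel averages values of a Lipschitz function. The distance z to the
    grid point is at most (kap + z^2 / kap) / 2, and the kernel integrates z^2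
    to O(1 / L) by [fejer_cos]; this avoids any splitting of the sum. *)
Let approx_error (c kap t : R) : 0 < c -> 0 < kap ->
  (forall x, c * zdist x ^+ 2 <= 1 - cos (2 * pi * x)) ->
  `|\sum_(l < L.+1) wgt l * cos (2 * pi * l%:R * t) - tent rho t| <=
  rho%:R / 2 * (kap + 2 / (c * kap * L%:R)).
Proof.
move=> c0 kap0 cH; rewrite -approxE.
have -> : tent rho t = \sum_(j < L) tent rho t * ker (t - j%:R / L%:R).
  by rewrite -mulr_sumr ker_sum mulr1.
rewrite -sumrB.
apply: le_trans (ler_norm_sum _ _ _) _.
apply: (@le_trans _ _ (\sum_(j < L) (rho%:R / 2 * kap * ker (t - j%:R / L%:R) +
   rho%:R / 2 * (2 / (c * kap * L%:R ^+ 2))))).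
  apply: ler_sum => j _; rewrite -mulrBl normrM (ger0_norm (ker_ge0 _)) -tent_grid//.
  set x := t - _; have H1 : `|tent rho (j%:R / L%:R) - tent rho t| <= rho%:R * zdist x.
    by rewrite distrC; exact: tent_lip.
  apply: le_trans (ler_wpM2r (ker_ge0 _) H1) _.
  have H2 : zdist x <= (kap + zdist x ^+ 2 / kap) / 2.
    have : 0 <= (kap - zdist x) ^+ 2 / kap by rewrite divr_ge0 ?sqr_ge0// ltW.
    have -> : (kap - zdist x) ^+ 2 / kap = kap - 2 * zdist x + zdist x ^+ 2 / kap.
      by field; rewrite gt_eqF.
    lra.
  have H3 : ker x * (zdist x ^+ 2 / kap) <= 2 / (c * kap * L%:R ^+ 2).
    have -> : 2 / (c * kap * L%:R ^+ 2) = 2 / L%:R ^+ 2 / (c * kap).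
      by field; rewrite !gt_eqF.
    rewrite ler_pdivlMr ?mulr_gt0//; apply: le_trans (ker_cos x).
    have -> : ker x * (zdist x ^+ 2 / kap) * (c * kap) = ker x * (c * zdist x ^+ 2).
      by field; rewrite gt_eqF.
    by rewrite ler_wpM2l.
  have r0 : 0 <= rho%:R / 2 :> R by rewrite divr_ge0.
  have H4 : zdist x * ker x <= (kap * ker x + ker x * (zdist x ^+ 2 / kap)) / 2.
    have := ler_wpM2r (ker_ge0 x) H2.
    by move: (ker x) (zdist x) (zdist x ^+ 2 / kap) => u v w; lra.
  have r1 : 0 <= rho%:R :> R by [].
  have := ler_wpM2l r1 H4; have := ler_wpM2l r0 H3; rewrite mulrA.
  move: (ker x * (zdist x ^+ 2 / kap)) (2 / (c * kap * L%:R ^+ 2)) (ker x) => A1 A2 A3; lra.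
rewrite big_split /= -mulr_sumr ker_sum sumr_const card_ord mulr1.
rewrite -mulr_natr mulrDr lerD2l le_eqVlt; apply/orP; left; apply/eqP.
by field; rewrite !gt_eqF.
Qed.

Lemma tent_approx_grid (c kap : R) : 0 < c -> 0 < kap ->
  (forall x, c * zdist x ^+ 2 <= 1 - cos (2 * pi * x)) ->
  exists n (w : nat -> R), [/\ forall l, 0 <= w l, \sum_(l < n) w l <= 1 &
   forall t, `|\sum_(l < n) w l * cos (2 * pi * l%:R * t) - tent rho t| <=
    rho%:R / 2 * (kap + 2 / (c * kap * H%:R))].
Proof.
move=> c0 k0 cH; exists L.+1, wgt; split; [exact: wgt_ge0|exact: wgt_sum|move=> t].
apply: le_trans (approx_error t c0 k0 cH) _.
rewrite ler_wpM2l ?divr_ge0// lerD2l ler_wpM2l// lef_pV2 ?posrE ?mulr_gt0//.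
by rewrite ler_pM2l ?mulr_gt0// ler_nat /L leq_pmulr//; lia.
Qed.

End Grid.

(** Averaging a tent against the Fejer kernel of a fine grid gives a
    trigonometric polynomial. Its coefficients are nonnegative because those of
    the tent and of the kernel are, and their sum is the value at 0. *)
Theorem tent_approx rho (eps : R) : (2 <= rho)%N -> 0 < eps ->
  exists n (w : nat -> R), [/\ forall l, 0 <= w l, \sum_(l < n) w l <= 1 &
   forall t, `|\sum_(l < n) w l * cos (2 * pi * l%:R * t) - tent rho t| <= eps].
Proof.
move=> rho2 eps0; have [c c0 cH] := one_minus_cos_ge.
have r0 : 0 < rho%:R :> R by rewrite ltr0n; lia.
pose kap : R := eps / rho%:R; have k0 : 0 < kap by rewrite divr_gt0.
pose H := (Num.truncn (2 / (c * kap * kap))).+1.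
have HH : 2 / (c * kap * kap) < H%:R by rewrite truncnS_gt.
have H0 : 0 < H%:R :> R by rewrite ltr0n.
have [n [w [w0 w1 wa]]] := tent_approx_grid rho2 (isT : (0 < H)%N) c0 k0 cH.
exists n, w; split => // t; apply: le_trans (wa t) _.
have le : 2 / (c * kap * H%:R) <= kap.
  have ck : 0 < c * kap by exact: mulr_gt0.
  rewrite ler_pdivrMr ?(mulr_gt0 ck)//; move: HH; rewrite ltr_pdivrMr ?(mulr_gt0 ck)// => /ltW.
  by move=> h; apply: le_trans h _; rewrite le_eqVlt; apply/orP; left; apply/eqP; ring.
apply: (@le_trans _ _ (rho%:R / 2 * (kap + kap))).
  by rewrite ler_wpM2l ?divr_ge0// lerD2l.
by rewrite /kap le_eqVlt; apply/orP; left; apply/eqP; field; rewrite gt_eqF.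
Qed.

End Fejer.

(** * Integration over cubes *)

Section ProductIntegral.
Variable R : realType.
Local Notation leb1 := (@lebesgue_measure R).

Lemma measurable_prod_tnth d (h : 'I_d -> R -> R) :
  (forall i, measurable_fun setT (h i)) ->
  measurable_fun [set: d.-tuple (measurableTypeR R)]
    (fun t : d.-tuple (measurableTypeR R) => \prod_i h i (tnth t i)).
Proof.
move=> mh; apply: measurable_prod => i _.
apply: (measurableT_comp (mh i)); exact: measurable_tnth.
Qed.

(** Tonelli, one coordinate at a time along the recursive definition of the
    measure. *)
Lemma integral_prod_leb d (h : 'I_d -> R -> R) (c : 'I_d -> R) :
  (forall i, measurable_fun setT (h i)) -> (forall i x, 0 <= h i x) ->
  (forall i, (\int[leb1]_x (h i x)%:E = (c i)%:E)%E) ->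
  (\int[leb R d]_t (\prod_i h i (tnth t i))%:E = (\prod_i c i)%:E)%E.
Proof.
elim: d h c => [|d IH] h c mh h0 hc.
  rewrite integral_dirac//; last by apply/measurable_EFinP; exact: measurable_prod_tnth.
  by rewrite diracT mul1e !big_ord0.
have mprod := measurable_prod_tnth mh.
rewrite [LHS](ge0_integral_pushforward (@measurable_tcons R d)) //; last 2 first.
- by apply/measurable_EFinP.
- by move=> t _; rewrite lee_fin prodr_ge0.
rewrite preimage_setT.
pose g (p : measurableTypeR R * d.-tuple (measurableTypeR R)) : \bar R :=
  (h ord0 p.1 * \prod_i h (lift ord0 i) (tnth p.2 i))%:E.
transitivity (\int[leb1 \x leb R d]_p g p)%E.
  apply: eq_integral => p _ /=; congr (_%:E); rewrite big_ord_recl; congr (_ * _).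
  by apply: eq_bigr => i _; rewrite /tcons tnthS.
have mg : measurable_fun setT g.
  apply/measurable_EFinP; apply: measurable_funM.
    by apply: (measurableT_comp (mh ord0)); exact: measurable_fst.
  apply: (measurableT_comp (measurable_prod_tnth (fun i => mh (lift ord0 i)))).
  exact: measurable_snd.
rewrite fubini_tonelli1//; last first.
  by move=> p; rewrite lee_fin mulr_ge0// prodr_ge0.
rewrite /fubini_F /g /=.
have E (x : R) : (\int[leb R d]_y (h ord0 x * \prod_i h (lift ord0 i) (tnth y i))%:E =
   (h ord0 x * \prod_i c (lift ord0 i))%:E)%E.
  under eq_integral do rewrite EFinM.
  rewrite ge0_integralZl_EFin//.
  - by rewrite (@IH (fun i => h (lift ord0 i)) (fun i => c (lift ord0 i)))// EFinM.
  - by move=> y _; rewrite lee_fin prodr_ge0.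
  - by apply/measurable_EFinP; exact: (measurable_prod_tnth (fun i => mh (lift ord0 i))).
under eq_integral do rewrite E EFinM.
have P0 : 0 <= \prod_i c (lift ord0 i).
  apply: prodr_ge0 => i _; rewrite -lee_fin -hc; apply: integral_ge0 => x _.
  by rewrite lee_fin.
rewrite ge0_integralZr//.
- by rewrite hc -EFinM big_ord_recl.
- by apply/measurable_EFinP; exact: mh.
- by move=> x _; rewrite lee_fin.
Qed.

Lemma box_prodE d (T : R) (t : d.-tuple R) :
  \1_(box T) t = \prod_i \1_(`[0, T]%classic) (tnth t i) :> R.
Proof.
rewrite indicE; case: (boolP (t \in box T)) => [/set_mem tb|tb].
  by rewrite big1// => i _; rewrite indicE mem_set//= in_itv/=; exact: tb.
have [i ni] : exists i, ~ (0 <= tnth t i <= T).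
  by apply/existsNP => H; move/negP: tb; apply; rewrite inE.
by rewrite (bigD1 i)//= indicE memNset ?mul0r//= in_itv/=.
Qed.

Lemma measurable_box d (T : R) : measurable (box T : set (d.-tuple (measurableTypeR R))).
Proof.
have -> : (box T : set (d.-tuple (measurableTypeR R))) =
   \bigcap_(i in [set: 'I_d]) ((fun t : d.-tuple (measurableTypeR R) => tnth t i) @^-1` `[0, T]%classic).
  apply/seteqP; split => t /= H.
    by move=> i _ /=; rewrite in_itv/=; exact: H.
  by move=> i; have := H i I; rewrite /= in_itv.
apply: fin_bigcap_measurable; first exact: finite_finset.
move=> i _; rewrite -[X in measurable X]setTI; apply: measurable_tnth => //.
Qed.

Lemma integral_prod_box d (T : R) (g : 'I_d -> R -> R) (c : 'I_d -> R) :
  (forall i, measurable_fun setT (g i)) -> (forall i x, 0 <= g i x) ->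
  (forall i, (\int[leb1]_(x in `[0%R, T]) (g i x)%:E = (c i)%:E)%E) ->
  (\int[leb R d]_(t in box T) (\prod_i g i (tnth t i))%:E = (\prod_i c i)%:E)%E.
Proof.
move=> mg g0 gc.
rewrite integral_mkcond -(@integral_prod_leb d (fun i x => g i x * \1_(`[0, T]%classic) x) c).
- apply: eq_integral => t _; rewrite big_split /= -box_prodE indicE patchE.
  by case: (t \in box T); rewrite ?mulr1 ?mulr0.
- move=> i; apply: measurable_funM => //.
- by move=> i x; rewrite mulr_ge0.
move=> i; rewrite -gc [RHS]integral_mkcond; apply: eq_integral => x _.
rewrite patchE indicE.
by case: (x \in `[0, T]%classic); rewrite ?mulr1 ?mulr0.
Qed.

Lemma leb_box d (T : R) : 0 <= T -> leb R d (box T) = (T ^+ d)%:E.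
Proof.
move=> T0; transitivity (\int[leb R d]_(t in box T) (\prod_(i < d) 1)%:E)%E.
  rewrite -[LHS]mul1e -integral_cst; last exact: measurable_box.
  by apply: eq_integral => t _; rewrite big1.
rewrite (@integral_prod_box d T (fun _ _ => 1) (fun=> T)) ?prodr_const ?card_ord//.
move=> _; have L : leb1 (`[0, T]%classic) = T%:E; last by rewrite -[RHS]mul1e -L -integral_cst.
rewrite lebesgue_measure_itv/= lte_fin.
by case: ltP => [_|T0']; [rewrite oppr0 adde0|congr (_%:E); apply/eqP; rewrite eq_le T0 T0'].
Qed.

End ProductIntegral.

Section Bump.
Variable R : realType.
Local Notation leb1 := (@lebesgue_measure R).

Definition bump (N : nat) (s : R) : R := Num.max 0 (1 - N%:R * `|s|).

Lemma bump01 N s : 0 <= bump N s <= 1.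
Proof. by rewrite /bump le_max lexx /= ge_max ler01 /= gerBl mulr_ge0. Qed.

Lemma measurable_bump N k : measurable_fun setT (fun x : R => bump N (x - k)).
Proof.
apply: measurable_maxr; first exact: measurable_cst.
apply: measurable_funB; first exact: measurable_cst.
apply: measurable_funM; first exact: measurable_cst.
apply: measurableT_comp => //.
exact: measurable_funB.
Qed.

Lemma affine_integral (al be a b : R) : a < b ->
  (\int[leb1]_(x in `[a, b]) (al + be * x)%:E = ((al * (b - a) + be * (b ^+ 2 - a ^+ 2) / 2))%:E)%E.
Proof.
move=> ab; pose F (x : R) : R := al * x + be / 2 * x ^+ 2.
have dF (x : R) : is_derive x 1 F (al + be * x).
  rewrite /F; apply: is_derive_eq.
  rewrite /GRing.scale /=; by field.
have cF : continuous F.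
  by move=> x; apply: differentiable_continuous; apply/derivable1_diffP; apply: ex_derive.
rewrite (@continuous_FTC2 R (fun x => al + be * x) F)//.
- by rewrite -EFinB /F; congr (_%:E); field.
- apply: continuous_subspaceT => x; apply: cvgD; first exact: cvg_cst.
  by apply: cvgM; [exact: cvg_cst|exact: cvg_id].
- split.
  + by move=> x _; apply: ex_derive.
  + by apply: cvg_at_right_filter; exact: cF.
  + by apply: cvg_at_left_filter; exact: cF.
by move=> x _; rewrite derive1E; exact: derive_val.
Qed.

Lemma integral_eq_restrict (f g : R -> \bar R) (A B : set R) :
  (forall x, (f \_ A) x = (g \_ B) x) ->
  (\int[leb1]_(x in A) f x = \int[leb1]_(x in B) g x)%E.
Proof.
by move=> fg; rewrite integral_mkcond [RHS]integral_mkcond; apply: eq_integral => x _; rewrite fg.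
Qed.

(** The box starts at 0, which halves the bump centred there. *)
Definition bump_mass (N k : nat) : R := if k == 0%N then (2 * N%:R)^-1 else N%:R^-1.

Lemma bump_integral (N M k : nat) : (2 <= N)%N -> (k <= M)%N ->
  (\int[leb1]_(x in `[0%R, (M%:R + 1 / 2)%R]) (bump N (x - k%:R))%:E = (bump_mass N k)%:E)%E.
Proof.
move=> N2 kM; have N0 : 0 < N%:R :> R by rewrite ltr0n; lia.
have kM' : k%:R <= M%:R :> R by rewrite ler_nat.
have n1 : 0 < N%:R^-1 :> R by rewrite invr_gt0.
have nh : N%:R^-1 <= 1 / 2 :> R.
  have N2' : 2 <= N%:R :> R by rewrite ler_nat.
  by rewrite div1r lef_pV2 ?posrE.
have NN : N%:R * N%:R^-1 = 1 :> R by rewrite divff ?gt_eqF.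
pose K : R := k%:R; pose e : R := N%:R^-1; pose n : R := N%:R.
have ne : n * e = 1 by [].
have right_le x : K <= x <= K + e -> bump N (x - K) = (1 + n * K) + (- n) * x.
  move=> /andP[x1 x2]; rewrite /bump ger0_norm ?subr_ge0//.
  have -> : 1 - N%:R * (x - K) = 1 + n * K + - n * x by rewrite /n; ring.
  apply/max_idPr; have : n * (x - K) <= n * e by rewrite ler_pM2l//; lra.
  by rewrite ne; lra.
have left_le x : K - e <= x <= K -> bump N (x - K) = (1 - n * K) + n * x.
  move=> /andP[x1 x2]; rewrite /bump ler0_norm ?subr_le0//.
  have -> : 1 - N%:R * - (x - K) = 1 - n * K + n * x by rewrite /n; ring.
  apply/max_idPr; have : n * (K - x) <= n * e by rewrite ler_pM2l//; lra.
  by rewrite ne; lra.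
have out x : (x < K - e) || (K + e < x) -> bump N (x - K) = 0.
  move=> H; rewrite /bump; apply/max_idPl.
  have : e <= `|x - K|.
    case/orP: H => h; first by rewrite distrC; apply: le_trans (ler_norm _); lra.
    by apply: le_trans (ler_norm _); lra.
  by rewrite -(ler_pM2l N0) -/n ne; lra.
have IR : (\int[leb1]_(x in `[K, (K + e)%R]) (bump N (x - K))%:E = (e / 2)%:E)%E.
  rewrite (@integral_eq_restrict _ (fun x => ((1 + n * K) + (- n) * x)%:E) _ (`[K, K + e]%classic)).
    rewrite affine_integral; last by rewrite ltrDl.
    congr (_%:E); have -> : (1 + n * K) * (K + e - K) + - n * ((K + e) ^+ 2 - K ^+ 2) / 2 =
      e - (n * e) * e / 2 by field.
    by rewrite ne; field.
  move=> x; rewrite !patchE; case: ifP => // xi; congr (_%:E); apply: right_le.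
  by move: xi; rewrite inE/= in_itv.
have IL : (\int[leb1]_(x in `[(K - e)%R, K]) (bump N (x - K))%:E = (e / 2)%:E)%E.
  rewrite (@integral_eq_restrict _ (fun x => ((1 - n * K) + n * x)%:E) _ (`[K - e, K]%classic)).
    rewrite affine_integral; last by rewrite ltrBlDr ltrDl.
    congr (_%:E); have -> : (1 - n * K) * (K - (K - e)) + n * (K ^+ 2 - (K - e) ^+ 2) / 2 =
      e - (n * e) * e / 2 by field.
    by rewrite ne; field.
  move=> x; rewrite !patchE; case: ifP => // xi; congr (_%:E); apply: left_le.
  by move: xi; rewrite inE/= in_itv.
have [k0|k0] := eqVneq k 0%N.
  have K0 : K = 0 by rewrite /K k0.
  have -> : bump_mass N k = e / 2 by rewrite /bump_mass k0 eqxx invfM mulrC.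
  rewrite -IR; apply: integral_eq_restrict => x; rewrite !patchE -/K K0 add0r.
  have [xe|xe] := leP x e.
    rewrite (_ : (x \in `[0, M%:R + 1 / 2]%classic) = (x \in `[0, e]%classic))//.
    by apply/idP/idP; rewrite !inE/= !in_itv/= => /andP[-> _] /=; [done|move: nh; rewrite -/e; lra].
  have o : bump N (x - 0) = 0 by have := out x; rewrite K0 !add0r xe orbT; apply.
  by rewrite o; do 2 case: ifP.
have -> : bump_mass N k = e / 2 + e / 2.
  by rewrite /bump_mass (negbTE k0) /e; field; rewrite gt_eqF.
have K1 : 1 <= K by rewrite ler1n lt0n.
rewrite EFinD -{1}IL -IR.
have mb A : measurable A -> measurable_fun A (fun x : R => (bump N (x - K))%:E).
  move=> mA; apply: measurable_funTS; apply/measurable_EFinP; exact: measurable_bump.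
rewrite -[X in (_ = _ + X)%E]integral_itv_obnd_cbnd; last exact: mb.
rewrite -ge0_integral_setU//; last 3 first.
- by apply: mb; exact: measurableU.
- by move=> x _; rewrite lee_fin; have /andP[] := bump01 N (x - K).
- apply/disj_setPS => y [/=]; rewrite !in_itv/= => /andP[_ yx] /andP[].
  by rewrite ltNge yx.
apply: integral_eq_restrict => x; rewrite !patchE.
have [xe|xe] := boolP (K - e <= x <= K + e); last first.
  have o : bump N (x - K) = 0.
    by apply: out; move: xe; rewrite negb_and -!ltNge.
  by rewrite -/K o; do 2 case: ifP.
rewrite [in LHS]mem_set; last by rewrite /= in_itv/=; move: nh; rewrite -/e /K; lra.
rewrite mem_set//=; rewrite !in_itv/=; have [xK|xK] := leP x K; [left|right]; lra.
Qed.

End Bump.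

(** * Smoothed samples at integer points *)

Section LipschitzMeasurable.
Variables (R : realType) (d : nat).
Local Notation tup := (d.-tuple (measurableTypeR R)).

Lemma cvg_of_rate (u : nat -> R) (l C : R) :
  (forall n, `|u n - l| <= C / n.+1%:R) -> u @ \oo --> l.
Proof.
move=> H; apply/cvgrPdist_le => e e0.
exists (Num.truncn (C / e)) => // n /= Cn.
rewrite distrC; apply: le_trans (H n) _.
rewrite ler_pdivrMr ?ltr0n// mulrC -ler_pdivrMr//.
apply: ltW; apply: lt_le_trans (truncnS_gt _) _.
by rewrite ler_nat ltnS.
Qed.

(** Functions constant on the cells of a grid take countably many values on
    measurable sets, and they converge to a Lipschitz function pointwise. *)
Lemma measurable_lipschitz (F : tup -> R) (Lp : R) : 0 <= Lp ->
  (forall s t, `|F s - F t| <= Lp * \sum_i `|tnth s i - tnth t i|) ->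
  measurable_fun setT F.
Proof.
move=> Lp0 HF.
pose grid n (k : d.-tuple int) : tup := [tuple (tnth k i)%:~R / n.+1%:R | i < d].
pose fl n (t : tup) : d.-tuple int := [tuple Num.floor (n.+1%:R * tnth t i) | i < d].
have mfl n k : measurable [set t | fl n t = k].
  have -> : [set t | fl n t = k] = \bigcap_(i in [set: 'I_d])
     ((fun t : tup => tnth t i) @^-1` `[(tnth k i)%:~R / n.+1%:R, ((tnth k i) + 1)%:~R / n.+1%:R[%classic).
    apply/seteqP; split => t /=.
      move=> <- i _ /=; rewrite in_itv/= tnth_mktuple ler_pdivrMr ?ltr0n// ltr_pdivlMr ?ltr0n//.
      by rewrite ![tnth t i * _]mulrC; exact: floor_itv.
    move=> H; apply: eq_from_tnth => i; rewrite tnth_mktuple.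
    have := H i I; rewrite /= in_itv/= ler_pdivrMr ?ltr0n// ltr_pdivlMr ?ltr0n// => h.
    by apply: floor_def; rewrite [n.+1%:R * _]mulrC.
  apply: fin_bigcap_measurable; first exact: finite_finset.
  move=> i _; rewrite -[X in measurable X]setTI; apply: measurable_tnth => //.
have mF n : measurable_fun setT (fun t => F (grid n (fl n t))).
  move=> _ Y _; rewrite setTI.
  have -> : (fun t => F (grid n (fl n t))) @^-1` Y =
    \bigcup_m (if unpickle m is Some k then
       (if `[< Y (F (grid n k)) >] then [set t | fl n t = k] else set0) else set0).
    apply/seteqP; split => t /=.
      move=> Yt; exists (pickle (fl n t)) => //; rewrite pickleK.
      by case: asboolP.
    move=> [m _]; case: (unpickle m) => // k; by case: asboolP => // Yk /= ->.
  apply: bigcupT_measurable => m; case: (unpickle m) => [k|]; last exact: measurable0.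
  by case: asboolP => _; [exact: mfl|exact: measurable0].
apply: (measurable_fun_cvg mF) => t _.
apply: (@cvg_of_rate _ _ (Lp * d%:R)) => n.
apply: le_trans (HF _ _) _; rewrite -mulrA ler_wpM2l//.
have -> : d%:R / n.+1%:R = \sum_(i < d) n.+1%:R^-1 :> R by rewrite sumr_const card_ord mulr_natl.
apply: ler_sum => i _.
rewrite !tnth_mktuple; have /andP[h1 h2] := floor_itv (n.+1%:R * tnth t i).
have n0 : 0 < n.+1%:R :> R by rewrite ltr0n.
rewrite distrC ger0_norm; last by rewrite subr_ge0 ler_pdivrMr// [_ * n.+1%:R]mulrC.
rewrite -(ler_pM2l n0) mulrBr mulfV ?gt_eqF// mulrCA mulfV ?gt_eqF// mulr1.
by rewrite intrD in h2; lra.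
Qed.

End LipschitzMeasurable.

Section Trig.
Variables (R : realType) (d : nat).
Local Notation tup := (d.-tuple R).

Definition pairing (a t : tup) : R := \sum_k tnth a k * tnth t k.

(** Trigonometric polynomials, with a bound for the sum of the absolute values
    of their coefficients; keeping the bound in the judgement makes products
    and linear estimates one induction each. *)
Inductive trig : R -> (tup -> R) -> Prop :=
| trig_cos a : trig 1 (fun t => cos (pairing a t))
| trig_add u v f g : trig u f -> trig v g -> trig (u + v) (fun t => f t + g t)
| trig_scale c u f : 0 <= c -> trig u f -> trig (c * u) (fun t => c * f t).

Lemma trig_eq u v f g : trig u f -> u = v -> f =1 g -> trig v g.
Proof. by move=> tf <- /funext <-. Qed.

(** The product of two cosines is the mean of the cosines of the sum and of the
    difference of their frequencies. *)
Lemma trig_mul u v f g : trig u f -> trig v g -> trig (u * v) (fun t => f t * g t).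
Proof.
move=> tf; elim: tf v g => {u f} [a|u1 u2 f1 f2 _ IH1 _ IH2|c u f c0 _ IH] v g tg.
- rewrite mul1r; elim: tg => {v g} [b|v1 v2 g1 g2 _ IH1 _ IH2|c v g c0 _ IH].
  + pose p := [tuple tnth a k + tnth b k | k < d].
    pose m := [tuple tnth a k - tnth b k | k < d].
    apply: (trig_eq (trig_scale (c := 1 / 2) _ (trig_add (trig_cos p) (trig_cos m)))).
    * by lra.
    * by lra.
    move=> t; have -> : pairing p t = pairing a t + pairing b t.
      by rewrite /pairing -big_split /=; apply: eq_bigr => k _; rewrite tnth_mktuple mulrDl.
    have -> : pairing m t = pairing a t - pairing b t.
      by rewrite /pairing -sumrB; apply: eq_bigr => k _; rewrite tnth_mktuple mulrBl.
    rewrite cosD cosB; lra.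
  + by apply: (trig_eq (trig_add IH1 IH2)) => // t; rewrite mulrDr.
  + by apply: (trig_eq (trig_scale c0 IH)) => // t; rewrite mulrCA.
- by apply: (trig_eq (trig_add (IH1 _ _ tg) (IH2 _ _ tg))) => [|t]; rewrite mulrDl.
- by apply: (trig_eq (trig_scale c0 (IH _ _ tg))) => [|t]; rewrite mulrA.
Qed.

Lemma trig_sum n (u : nat -> R) (f : nat -> tup -> R) :
  (forall l, trig (u l) (f l)) -> trig (\sum_(l < n) u l) (fun t => \sum_(l < n) f l t).
Proof.
move=> tf; elim: n => [|n IH].
  apply: (trig_eq (trig_scale (c := 0) (lexx _) (tf 0%N))) => [|t]; by rewrite big_ord0 mul0r.
by apply: (trig_eq (trig_add IH (tf n))) => [|t]; rewrite big_ord_recr.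
Qed.

Lemma trig_prod (s : seq 'I_d) (u : 'I_d -> R) (f : 'I_d -> tup -> R) :
  (forall i, trig (u i) (f i)) -> trig (\prod_(i <- s) u i) (fun t => \prod_(i <- s) f i t).
Proof.
move=> tf; elim: s => [|i s IH].
  apply: (trig_eq (trig_cos [tuple 0 | k < d])) => [|t]; rewrite big_nil//.
  by rewrite /pairing big1 ?cos0// => k _; rewrite tnth_mktuple mul0r.
by apply: (trig_eq (trig_mul (tf i) IH)) => [|t]; rewrite big_cons.
Qed.

Lemma trig_coord (i : 'I_d) (x : R) : trig 1 (fun t => cos (x * tnth t i)).
Proof.
apply: (trig_eq (trig_cos [tuple (if k == i then x else 0) | k < d])) => // t.
congr cos; rewrite /pairing (bigD1 i)//= tnth_mktuple eqxx big1 ?addr0// => k /negbTE ki.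
by rewrite tnth_mktuple ki mul0r.
Qed.

Lemma trig_bounded u f : trig u f -> forall t, `|f t| <= u.
Proof.
elim=> [a t|u1 u2 f1 f2 _ IH1 _ IH2 t|c u1 f1 c0 _ IH t]; first exact: cos_max.
  by apply: le_trans (ler_normD _ _) _; exact: lerD.
by rewrite normrM ger0_norm// ler_wpM2l.
Qed.

Lemma trig_measurable u f : trig u f ->
  measurable_fun setT (f : d.-tuple (measurableTypeR R) -> R).
Proof.
elim=> [a|u1 u2 f1 f2 _ IH1 _ IH2|c u1 f1 c0 _ IH].
- apply: measurableT_comp; first exact: (continuous_measurable_fun (@continuous_cos R)).
  apply: measurable_sum => k; apply: measurable_funM => //; exact: measurable_tnth.
- exact: measurable_funD.
- exact: measurable_funM.
Qed.

End Trig.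

(** A half-integer side T leaves room for every bump centred at an integer point
    1, ..., M, and meets none centred at M + 1. *)
Section Smoothing.
Variables (R : realType) (d M N : nat).
Local Notation tup := (d.-tuple (measurableTypeR R)).
Hypothesis N2 : (2 <= N)%N.
Let T : R := M%:R + 1 / 2.
Let N0 : 0 < N%:R :> R. Proof. by rewrite ltr0n; lia. Qed.
Let T0 : 0 <= T. Proof. by rewrite /T addr_ge0. Qed.
Let muL := leb R d.

Lemma bounded_integrable (f : tup -> R) (B : R) : measurable_fun setT f ->
  (forall t, box T t -> `|f t| <= B) -> muL.-integrable (box T : set tup) (EFin \o f).
Proof.
move=> mf fB; apply: measurable_bounded_integrable => //.
- exact: measurable_box.
- by have := ltry (T ^+ d); rewrite -(leb_box d T0).
- exact: measurable_funTS.
exists B; split; first exact: num_real.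
by move=> x Bx t tb /=; apply: le_trans (fB t tb) _; exact: ltW.
Qed.

Lemma Rint_sum (I : finType) (P : pred I) (f : I -> tup -> R) (B : I -> R) :
  (forall i, measurable_fun setT (f i)) -> (forall i t, box T t -> `|f i t| <= B i) ->
  \int[muL]_(t in box T) (\sum_(i | P i) f i t) = \sum_(i | P i) \int[muL]_(t in box T) f i t.
Proof.
move=> mf fB.
suff H (s : seq I) : \int[muL]_(t in box T) (\sum_(i <- s | P i) f i t) =
    \sum_(i <- s | P i) \int[muL]_(t in box T) f i t by exact: H.
elim: s => [|i s IH].
  rewrite big_nil (@eq_Rintegral _ _ _ _ _ (fun=> 0)); last by move=> t _; rewrite big_nil.
  by rewrite Rintegral_cst ?mul0r//; exact: measurable_box.
rewrite big_cons -IH; case: ifP => Pi; last first.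
  by apply: eq_Rintegral => t _; rewrite big_cons Pi.
rewrite -RintegralD//.
- by apply: eq_Rintegral => t _; rewrite big_cons Pi.
- exact: measurable_box.
- exact: bounded_integrable (fB i).
apply: (bounded_integrable (B := \sum_(i <- s | P i) B i)).
  under eq_fun do rewrite big_mkcond.
  by apply: measurable_sum => k; case: (P k).
by move=> t tb; apply: le_trans (ler_norm_sum _ _ _) _; apply: ler_sum => k _; exact: fB.
Qed.

Lemma box0 : box T ([tuple 0 | i < d] : d.-tuple R).
Proof. by move=> i; rewrite tnth_mktuple lexx T0. Qed.

Lemma Rint_abs_le (f : tup -> R) (B : R) : measurable_fun setT f ->
  (forall t, box T t -> `|f t| <= B) -> `|\int[muL]_(t in box T) f t| <= B * T ^+ d.
Proof.
move=> mf fB; have B0 : 0 <= B by apply: le_trans (fB _ box0).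
have if1 := bounded_integrable mf fB.
have mfn : measurable_fun setT (fun t => `|f t|) by exact: measurableT_comp.
apply: le_trans (le_normr_Rintegral _ if1) _; first exact: measurable_box.
have -> : B * T ^+ d = \int[muL]_(t in box T) B.
  rewrite Rintegral_cst; last exact: measurable_box.
  by congr (_ * _); rewrite -[T ^+ d]/(fine (T ^+ d)%:E) -(leb_box d T0).
apply: le_Rintegral => //; first exact: measurable_box.
- by apply: (bounded_integrable (B := B)) => // t tb; rewrite normr_id; exact: fB.
- by apply: (bounded_integrable (B := B)) => // t; rewrite ger0_norm.
Qed.

Variables (F : tup -> R) (mu Fm Lp E0 : R).
Hypotheses (Lp0 : 0 <= Lp) (mu0 : 0 <= mu) (FB : forall t, 0 <= F t <= Fm).
Hypothesis FL : forall s t, `|F s - F t| <= Lp * \sum_i `|tnth s i - tnth t i|.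
Hypothesis Fchar : forall a : d.-tuple R,
  `|\int[muL]_(t in box T) (cos (pairing a t) * (F t - mu))| <= E0.

Let mF : measurable_fun setT F := measurable_lipschitz Lp0 FL.

Let h (t : tup) : R := F t - mu.
Let mh : measurable_fun setT h. Proof. exact: measurable_funB. Qed.
Let hB t : `|h t| <= Fm + mu.
Proof.
have /andP[f0 f1] := FB t; apply: le_trans (ler_normB _ _) _.
by rewrite !ger0_norm// lerD2r.
Qed.

Let trig_int u f : trig u f -> `|\int[muL]_(t in box T) (f t * h t)| <= u * E0.
Proof.
elim=> [a|u1 u2 f1 f2 t1 IH1 t2 IH2|c u1 f1 c0 t1 IH].
- by rewrite mul1r; exact: Fchar.
- have b1 := trig_bounded t1; have b2 := trig_bounded t2.
  have m1 := trig_measurable t1; have m2 := trig_measurable t2.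
  have -> : \int[muL]_(t in box T) ((f1 t + f2 t) * h t) =
            \int[muL]_(t in box T) (f1 t * h t + f2 t * h t).
    by apply: eq_Rintegral => t _; rewrite mulrDl.
  rewrite RintegralD//.
  + by rewrite mulrDl; apply: le_trans (ler_normD _ _) _; exact: lerD.
  + exact: measurable_box.
  + apply: (bounded_integrable (B := u1 * (Fm + mu))); first exact: measurable_funM.
    by move=> t _; rewrite normrM; apply: ler_pM.
  + apply: (bounded_integrable (B := u2 * (Fm + mu))); first exact: measurable_funM.
    by move=> t _; rewrite normrM; apply: ler_pM.
have b1 := trig_bounded t1; have m1 := trig_measurable t1.
have -> : \int[muL]_(t in box T) (c * f1 t * h t) = \int[muL]_(t in box T) (c * (f1 t * h t)).
  by apply: eq_Rintegral => t _; rewrite mulrA.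
rewrite RintegralZl//.
- by rewrite normrM ger0_norm// -mulrA ler_wpM2l.
- exact: measurable_box.
apply: (bounded_integrable (B := u1 * (Fm + mu))); first exact: measurable_funM.
by move=> t _; rewrite normrM; apply: ler_pM.
Qed.

(** Replace the factors one at a time. *)
Let prod_diff (n : nat) (a b : 'I_n -> R) (B : R) : 0 <= B ->
  (forall i, `|a i| <= B) -> (forall i, `|b i| <= B) ->
  `|\prod_i a i - \prod_i b i| <= B ^+ n.-1 * \sum_i `|a i - b i|.
Proof.
move=> B0; elim: n a b => [|n IH] a b aB bB; first by rewrite !big_ord0 subrr normr0 mulr0.
rewrite !big_ord_recl /=.
have -> : a ord0 * \prod_i a (lift ord0 i) - b ord0 * \prod_i b (lift ord0 i) =
   (a ord0 - b ord0) * \prod_i a (lift ord0 i) + b ord0 * (\prod_i a (lift ord0 i) - \prod_i b (lift ord0 i)) by ring.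
apply: le_trans (ler_normD _ _) _; rewrite !normrM mulrDr; apply: lerD.
  rewrite mulrC ler_wpM2r// normr_prod -[n in B ^+ n]card_ord -prodr_const.
  by apply: ler_prod => i _; rewrite normr_ge0 /=.
have {}IH := IH (fun i => a (lift ord0 i)) (fun i => b (lift ord0 i)) (fun i => aB _) (fun i => bB _).
case: n a b aB bB IH => [|n] a b aB bB IH.
  by rewrite !big_ord0 subrr normr0 !mulr0.
rewrite exprS -mulrA; apply: ler_pM => //; exact: bB.
Qed.

Let bump_out s : 1 <= N%:R * `|s| -> bump N s = 0 :> R.
Proof. by move=> H; apply/max_idPl; rewrite subr_le0. Qed.

Definition comb (q : nat) (x : R) : R := \sum_(k < M.+1 | (q %| k)%N) bump N (x - k%:R).

(** On [0, T] only one tent of the comb is active at a time, so the periodic tent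
    with period q is the sum of the bumps at the multiples of q up to M. *)
Lemma tent_comb q x : (0 < q)%N -> 0 <= x <= T -> tent (q * N) (x / q%:R) = comb q x.
Proof.
move=> q0 /andP[x0 xT]; have q0' : 0 < q%:R :> R by rewrite ltr0n.
have N2' : 2 <= N%:R :> R by rewrite ler_nat.
have [k zk] := zdist_ex (x / q%:R).
have Q (l : int) : `|x - q%:R * l%:~R| = q%:R * `|x / q%:R - l%:~R|.
  by rewrite -{2}(ger0_norm (ltW q0')) -normrM mulrBr mulrCA mulfV ?gt_eqF// mulr1.
have E : (q * N)%:R * zdist (x / q%:R) = N%:R * `|x - q%:R * k%:~R|.
  by rewrite zk Q natrM mulrAC mulrC.
have low (l : nat) : (q %| l)%N -> N%:R * `|x - q%:R * k%:~R| <= N%:R * `|x - l%:R|.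
  move=> /dvdnP[r ->]; rewrite ler_pM2l//.
  have h1 := zdist_le (x / q%:R) r%:Z; rewrite zk -(ler_pM2l q0') -!Q in h1.
  by rewrite natrM [r%:R * _]mulrC.
rewrite /tent E -/(bump N (x - q%:R * k%:~R)).
have [far|near] := leP 1 (N%:R * `|x - q%:R * k%:~R|).
  rewrite bump_out// /comb big1// => l ql; rewrite bump_out//.
  exact: le_trans far (low _ ql).
have near' : `|x - q%:R * k%:~R| < 1 / 2.
  rewrite -(ltr_pM2l N0); apply: lt_le_trans near _; lra.
have qk : q%:R * k%:~R = (q%:Z * k)%:~R :> R by rewrite intrM.
have [k' kE] : exists k' : nat, q%:Z * k = k'%:Z.
  suff : 0 <= q%:Z * k by case: (q%:Z * k) => // n _; exists n.
  rewrite leNgt; apply/negP => neg.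
  have neg1 : q%:Z * k <= -1 by lia.
  have : (q%:Z * k)%:~R <= (-1)%:~R :> R by rewrite ler_int.
  rewrite rmorphN/= => neg2.
  by move: near'; rewrite qk ltr_norml => /andP[h1 h2]; lra.
have qk' : (q %| k')%N.
  apply/dvdnP; exists `|k|%N.
  by have := congr1 absz kE; rewrite abszM /= mulnC => <-.
rewrite qk kE -pmulrn in near near' *.
have kM : (k' < M.+1)%N.
  rewrite -(ltr_nat R) -natr1; move: near' xT; rewrite ltr_norml /T => /andP[h1 h2]; lra.
rewrite /comb (bigD1 (Ordinal kM))//= big1 ?addr0// => l /andP[ql lk].
rewrite bump_out//; have lk' : (l : nat) != k' by apply: contra lk => /eqP e; apply/eqP/val_inj.
have : 1 <= `|l%:R - k'%:R| :> R.
  have [lt|lt|e] := ltngtP l k'; last by rewrite e eqxx in lk'.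
    by rewrite distrC -natrB ?(ltnW lt)// normr_nat ler1n subn_gt0.
  by rewrite -natrB ?(ltnW lt)// normr_nat ler1n subn_gt0.
have := ler_normD (l%:R - x) (x - k'%:R); rewrite subrKA [`|l%:R - x|]distrC => h1 h2.
have : 1 / 2 <= `|x - l%:R| by lra.
rewrite -(ler_pM2l N0); lra.
Qed.

Let W (q : 'I_d -> nat) (t : tup) : R := \prod_i comb (q i) (tnth t i).

Let comb01 q x : (0 < q)%N -> 0 <= x <= T -> `|comb q x| <= 1.
Proof.
move=> q0 xT; rewrite -tent_comb//.
by have /andP[h1 h2] := tent01 (q * N) (x / q%:R); rewrite ger0_norm.
Qed.

Let mcomb q : measurable_fun setT (comb q).
Proof.
rewrite /comb; under eq_fun do rewrite big_mkcond.
by apply: measurable_sum => k; case: (q %| k)%N => //; exact: measurable_bump.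
Qed.

Let mW q : measurable_fun setT (W q).
Proof. exact: (measurable_prod_tnth (fun i => mcomb (q i))). Qed.

Let W01 q t : (forall i, 0 < q i)%N -> box T t -> `|W q t| <= 1.
Proof.
move=> q0 tb; rewrite /W normr_prod; apply: (@le_trans _ _ (\prod_(i < d) 1)); last by rewrite big1.
by apply: ler_prod => i _; rewrite normr_ge0 comb01.
Qed.

(** The hypothesis is uniform in the characters and the comb is a uniform limit
    of combinations of characters with total weight at most 1, so the comb
    inherits the bound [E0] with no loss depending on the moduli. *)
Let W_int q : (forall i, 0 < q i)%N -> `|\int[muL]_(t in box T) (W q t * h t)| <= E0.
Proof.
move=> q0; apply/ler_addgt0Pr => e e0.
pose K : R := d%:R * (Fm + mu) * T ^+ d + 1.
have K0 : 0 < K.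
  by have /andP[f0 f1] := FB [tuple 0 | i < d]; rewrite /K ltr_wpDl// !mulr_ge0// ?exprn_ge0// addr_ge0// (le_trans f0).
pose ep : R := Num.min 1 (e / K).
have ep0 : 0 < ep by rewrite /ep lt_min ltr01 divr_gt0.
have rho2 i : (2 <= q i * N)%N by rewrite (leq_trans N2)// leq_pmull.
have app i : exists nw : nat * (nat -> R), [/\ forall l, 0 <= nw.2 l, \sum_(l < nw.1) nw.2 l <= 1 &
   forall t, `|\sum_(l < nw.1) nw.2 l * cos (2 * pi * l%:R * t) - tent (q i * N) t| <= ep].
  by have [n [w H]] := tent_approx (rho2 i) ep0; exists (n, w).
have [nw Hnw] := choice app.
pose A i (x : R) : R := \sum_(l < (nw i).1) (nw i).2 l * cos (2 * pi * l%:R / (q i)%:R * x).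
pose G (t : tup) : R := \prod_i A i (tnth t i).
pose u : R := \prod_i \sum_(l < (nw i).1) (nw i).2 l.
have tG : trig u G.
  apply: (@trig_prod _ _ _ (fun i => \sum_(l < (nw i).1) (nw i).2 l) (fun i t => A i (tnth t i))) => i.
  apply: (@trig_sum _ _ _ (nw i).2 (fun l t => (nw i).2 l * cos (2 * pi * l%:R / (q i)%:R * tnth t i))) => l.
  have [w0 _ _] := Hnw i.
  by apply: (trig_eq (trig_scale (w0 l) (trig_coord i (2 * pi * l%:R / (q i)%:R)))); rewrite ?mulr1.
have u1 : u <= 1.
  apply: (@le_trans _ _ (\prod_(i < d) 1)); last by rewrite big1.
  apply: ler_prod => i _; have [w0 w1 _] := Hnw i; rewrite w1 andbT.
  by apply: sumr_ge0.
have E00 : 0 <= E0 by apply: le_trans (Fchar [tuple 0 | i < d]).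
have Adiff i x : 0 <= x <= T -> `|A i x - comb (q i) x| <= ep.
  move=> xT; rewrite -tent_comb//; have [_ _ wa] := Hnw i; apply: le_trans (wa (x / (q i)%:R)).
  rewrite le_eqVlt; apply/orP; left; apply/eqP; congr (`|_ - _|).
  by apply: eq_bigr => l _; congr (_ * cos _); ring.
have A1 i x : `|A i x| <= 1.
  have [w0 w1 _] := Hnw i; apply: le_trans w1; apply: le_trans (ler_norm_sum _ _ _) _.
  by apply: ler_sum => l _; rewrite normrM ger0_norm// ler_piMr// cos_max.
have GW t : box T t -> `|G t - W q t| <= d%:R * ep.
  move=> tb; apply: le_trans (prod_diff ler01 (fun i => A1 i (tnth t i)) (fun i => comb01 (q0 i) (tb i))) _.
  rewrite expr1n mul1r; apply: (@le_trans _ _ (\sum_(i < d) ep)); last by rewrite sumr_const card_ord mulr_natl.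
  by apply: ler_sum => i _; exact: Adiff.
have mG := trig_measurable tG.
have bG := trig_bounded tG.
have -> : \int[muL]_(t in box T) (W q t * h t) =
    \int[muL]_(t in box T) (G t * h t) - \int[muL]_(t in box T) ((G t - W q t) * h t).
  rewrite -RintegralB//.
  - by apply: eq_Rintegral => t _; ring.
  - exact: measurable_box.
  - apply: (bounded_integrable (B := u * (Fm + mu))); first exact: measurable_funM.
    by move=> t _; rewrite normrM; apply: ler_pM.
  - apply: (bounded_integrable (B := d%:R * ep * (Fm + mu))).
      by apply: measurable_funM => //; exact: measurable_funB.
    by move=> t tb; rewrite normrM; apply: ler_pM => //; exact: GW.
apply: le_trans (ler_normB _ _) _; apply: lerD.
  apply: le_trans (trig_int tG) _; rewrite ler_piMl//.
apply: le_trans (Rint_abs_le (B := d%:R * ep * (Fm + mu)) _ _) _.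
- by apply: measurable_funM => //; exact: measurable_funB.
- by move=> t tb; rewrite normrM; apply: ler_pM => //; exact: GW.
have : ep * K <= e by rewrite -ler_pdivlMr// ge_min lexx orbT.
move=> epK; apply: le_trans epK.
have -> : ep * K = d%:R * ep * (Fm + mu) * T ^+ d + ep by rewrite /K; ring.
by rewrite lerDl ltW.
Qed.

Let cell (f : {ffun 'I_d -> 'I_M.+1}) (t : tup) : R := \prod_i bump N (tnth t i - (f i)%:R).

(** The smoothed value of F at the integer point f. *)
Definition sample (f : {ffun 'I_d -> 'I_M.+1}) : R := \int[muL]_(t in box T) (cell f t * F t).

Let mcell f : measurable_fun setT (cell f).
Proof. apply: (measurable_prod_tnth (h := fun i x => bump N (x - (f i)%:R))) => i; exact: measurable_bump. Qed.

Let cell01 f t : 0 <= cell f t <= 1.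
Proof.
apply/andP; split; first by apply: prodr_ge0 => i _; have /andP[] := bump01 N (tnth t i - (f i)%:R).
apply: (@le_trans _ _ (\prod_(i < d) 1)); last by rewrite big1.
by apply: ler_prod => i _; exact: bump01.
Qed.

Let FmB t : `|F t| <= Fm.
Proof. by have /andP[f0 f1] := FB t; rewrite ger0_norm. Qed.

Lemma sample_ge0 f : 0 <= sample f.
Proof.
apply: Rintegral_ge0 => t _; have /andP[c0 _] := cell01 f t; have /andP[f0 _] := FB t.
exact: mulr_ge0.
Qed.

(** Distributing the product of combs over its cells, each at an integer point. *)
Let W_expand q t : W q t = \sum_(f : {ffun 'I_d -> 'I_M.+1} | [forall i, q i %| (f i : 'I_M.+1)]%N) cell f t.
Proof.
rewrite /W /comb (bigA_distr_big_dep (fun i (k : 'I_M.+1) => q i %| k)%N (fun i (k : 'I_M.+1) => bump N (tnth t i - k%:R))).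
by apply: eq_bigl => f; apply/familyP/forallP => H i; have := H i; rewrite unfold_in.
Qed.

Let comb_int q : (\int[@lebesgue_measure R]_(x in `[0%R, T]) (comb q x)%:E =
   (\sum_(k < M.+1 | (q %| k)%N) bump_mass R N k)%:E)%E.
Proof.
rewrite /comb; under eq_integral do rewrite -sumEFin -big_filter.
rewrite ge0_integral_sum//.
- by rewrite big_filter -sumEFin; apply: eq_bigr => k _; rewrite bump_integral// -ltnS.
- move=> k; apply: measurable_funTS; apply/measurable_EFinP; exact: measurable_bump.
- by move=> k x _; rewrite lee_fin; have /andP[] := bump01 N (x - k%:R).
Qed.

Let mass_bd q : (0 < q)%N ->
  `|N%:R * \sum_(k < M.+1 | (q %| k)%N) bump_mass R N k - M%:R / q%:R| <= 1 / 2.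
Proof.
move=> q0; have q0' : 0 < q%:R :> R by rewrite ltr0n.
have -> : N%:R * \sum_(k < M.+1 | (q %| k)%N) bump_mass R N k = 1 / 2 + (M %/ q)%:R.
  rewrite mulr_sumr -(big_mkord (fun k => q %| k)%N (fun k => N%:R * bump_mass R N k)).
  rewrite big_ltn_cond// dvdn0 /bump_mass eqxx; congr (_ + _).
    by field; rewrite gt_eqF.
  rewrite divn_count_dvd natr_sum big_mkcond big_nat_cond [RHS]big_nat_cond.
  apply: eq_bigr => k /andP[/andP[k0 _] _].
  by rewrite gtn_eqF//; case: (q %| k)%N => //; rewrite divff ?gt_eqF.
have h1 : (M %/ q)%:R <= M%:R / q%:R :> R.
  by rewrite ler_pdivlMr// -natrM ler_nat leq_trunc_div.
have h2 : M%:R / q%:R <= (M %/ q)%:R + 1 :> R.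
  rewrite ler_pdivrMr// natr1 -natrM ler_nat; apply: ltnW; exact: ltn_ceil.
by rewrite ler_norml; lra.
Qed.

Let mass_le q : 0 <= N%:R * \sum_(k < M.+1 | (q %| k)%N) bump_mass R N k <= M%:R + 1.
Proof.
have b01 k : 0 <= N%:R * bump_mass R N k <= 1.
  rewrite /bump_mass; case: ifP => _; last by rewrite divff ?gt_eqF// ler01 lexx.
  have -> : N%:R / (2 * N%:R) = 1 / 2 :> R by field; rewrite gt_eqF.
  by lra.
rewrite mulr_sumr; apply/andP; split.
  by apply: sumr_ge0 => k _; have /andP[] := b01 k.
have -> : M%:R + 1 = \sum_(k < M.+1) 1 :> R by rewrite sumr_const card_ord natr1.
rewrite big_mkcond; apply: ler_sum => k _; case: ifP => _ //.
by have /andP[] := b01 k.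
Qed.

Let W_mass q : (forall i, 0 < q i)%N ->
  `|\int[muL]_(t in box T) W q t - M%:R ^+ d / N%:R ^+ d / (\prod_i q i)%:R|
   <= N%:R ^- d * ((M%:R + 1) ^+ d.-1 * d%:R).
Proof.
move=> q0; pose c i : R := \sum_(k < M.+1 | (q i %| k)%N) bump_mass R N k.
have -> : \int[muL]_(t in box T) W q t = \prod_i c i.
  rewrite /Rintegral (@integral_prod_box R d T (fun i => comb (q i)) c)//.
  by move=> i x; apply: sumr_ge0 => k _; have /andP[] := bump01 N (x - k%:R).
have Nd : N%:R ^+ d != 0 :> R by rewrite expf_neq0// gt_eqF.
have -> : \prod_i c i = N%:R ^- d * \prod_i (N%:R * c i).
  by rewrite big_split /= prodr_const card_ord mulrA mulVf// mul1r.
have -> : M%:R ^+ d / N%:R ^+ d / (\prod_i q i)%:R = N%:R ^- d * \prod_i (M%:R / (q i)%:R) :> R.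
  rewrite big_split /= prodr_const card_ord prodfV natr_prod mulrA.
  by rewrite [M%:R ^+ d / _]mulrC.
rewrite -mulrBr normrM ger0_norm ?invr_ge0 ?exprn_ge0//.
apply: ler_wpM2l; first by rewrite invr_ge0 exprn_ge0.
apply: le_trans (prod_diff (B := M%:R + 1) _ _ _) _.
- by rewrite addr_ge0.
- by move=> i; have /andP[h1 h2] := mass_le (q i); rewrite ger0_norm.
- move=> i; rewrite ger0_norm; last by rewrite divr_ge0.
  rewrite ler_pdivrMr ?ltr0n//.
  have : 1 <= (q i)%:R :> R by rewrite ler1n.
  by have : 0 <= M%:R :> R by []; nra.
apply: ler_wpM2l; first by rewrite exprn_ge0// addr_ge0.
rewrite -[X in _ <= X%:R](card_ord d) -sumr_const; apply: ler_sum => i _.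
by apply: le_trans (mass_bd (q0 i)) _; lra.
Qed.

(** The samples at multiples of q add up to the integral of F against a comb.
    Its mean value part is a product of lengths, its oscillating part is [W_int]. *)
Theorem sample_level q : (forall i, 0 < q i)%N ->
  `|\sum_(f : {ffun 'I_d -> 'I_M.+1} | [forall i, q i %| (f i : 'I_M.+1)]%N) sample f
     - mu * (M%:R ^+ d / N%:R ^+ d) / (\prod_i q i)%:R|
  <= E0 + mu * (N%:R ^- d * ((M%:R + 1) ^+ d.-1 * d%:R)).
Proof.
move=> q0.
have -> : \sum_(f : {ffun 'I_d -> 'I_M.+1} | [forall i, q i %| (f i : 'I_M.+1)]%N) sample f =
    \int[muL]_(t in box T) (W q t * h t) + mu * \int[muL]_(t in box T) W q t.
  rewrite -(@Rint_sum _ _ _ (fun=> Fm)).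
  - rewrite -RintegralZl//.
    + rewrite -RintegralD//.
      * by apply: eq_Rintegral => t _; rewrite -mulr_suml -W_expand /h; ring.
      * exact: measurable_box.
      * apply: (bounded_integrable (B := 1 * (Fm + mu))); first exact: measurable_funM.
        by move=> t tb; rewrite normrM; apply: ler_pM => //; exact: W01.
      * apply: (bounded_integrable (B := mu * 1)); first exact: measurable_funM.
        by move=> t tb; rewrite normrM ger0_norm// ler_wpM2l//; exact: W01.
    + exact: measurable_box.
    + by apply: (bounded_integrable (B := 1)) => // t tb; exact: W01.
  - by move=> f; apply: measurable_funM.
  - move=> f t _; rewrite normrM -[Fm]mul1r; apply: ler_pM => //.
    by have /andP[c0 c1] := cell01 f t; rewrite ger0_norm.
rewrite -mulrA -addrA -mulrBr; apply: le_trans (ler_normD _ _) _.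
apply: lerD; first exact: W_int.
by rewrite normrM ger0_norm//; apply: ler_wpM2l => //; exact: W_mass.
Qed.

(** The cell around f has mass N^-d once no coordinate sits at the end 0 of the
    box, and F varies by at most Lp d / N on it. *)
Theorem sample_value (f : {ffun 'I_d -> 'I_M.+1}) : (forall i, f i != ord0) ->
  `|sample f - N%:R ^- d * F [tuple (f i : nat)%:R | i < d]| <=
   N%:R ^- d * (Lp * (d%:R / N%:R)).
Proof.
move=> f0; pose k : tup := [tuple (f i : nat)%:R | i < d].
have cint : \int[muL]_(t in box T) cell f t = N%:R ^- d.
  rewrite /Rintegral (@integral_prod_box R d T (fun i x => bump N (x - (f i)%:R)) (fun=> N%:R^-1)).
  - by rewrite /= prodr_const card_ord exprVn.
  - by move=> i; exact: measurable_bump.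
  - by move=> i x; have /andP[] := bump01 N (x - (f i)%:R).
  move=> i; have fM : (f i <= M)%N by rewrite -ltnS.
  rewrite (bump_integral R N2 fM) /bump_mass.
  by have := f0 i; rewrite -val_eqE /= => /negbTE ->.
have ic : muL.-integrable (box T : set tup) (EFin \o cell f).
  apply: (bounded_integrable (B := 1)) => // t _.
  by have /andP[c0 c1] := cell01 f t; rewrite ger0_norm.
have icF : muL.-integrable (box T : set tup) (EFin \o (fun t => cell f t * F t)).
  apply: (bounded_integrable (B := 1 * Fm)); first exact: measurable_funM.
  move=> t _; rewrite normrM; apply: ler_pM => //.
  by have /andP[c0 c1] := cell01 f t; rewrite ger0_norm.
have ick : muL.-integrable (box T : set tup) (EFin \o (fun t => F k * cell f t)).
  apply: (bounded_integrable (B := Fm * 1)); first exact: measurable_funM.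
  move=> t _; rewrite normrM; apply: ler_pM => //.
  by have /andP[c0 c1] := cell01 f t; rewrite ger0_norm.
have -> : sample f - N%:R ^- d * F k = \int[muL]_(t in box T) (cell f t * F t - F k * cell f t).
  rewrite RintegralB//; last exact: measurable_box.
  rewrite RintegralZl//; last exact: measurable_box.
  by rewrite cint mulrC.
have mg : measurable_fun setT (fun t => cell f t * F t - F k * cell f t).
  by apply: measurable_funB; apply: measurable_funM.
have pw t : `|cell f t * F t - F k * cell f t| <= Lp * (d%:R / N%:R) * cell f t.
  have /andP[c0 c1] := cell01 f t.
  have [/eqP z|nz] := boolP (cell f t == 0); first by rewrite z mul0r !mulr0 subrr normr0.
  rewrite [F k * _]mulrC -mulrBr normrM (ger0_norm c0) mulrC ler_wpM2r//.
  apply: le_trans (FL t k) _; apply: ler_wpM2l => //.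
  have -> : d%:R / N%:R = \sum_(i < d) N%:R^-1 :> R by rewrite sumr_const card_ord mulr_natl.
  apply: ler_sum => i _; rewrite tnth_mktuple -(ler_pM2l N0) mulfV ?gt_eqF//.
  rewrite leNgt; apply/negP => lt; move: nz; rewrite /cell (bigD1 i)//= bump_out ?mul0r ?eqxx//.
  exact: ltW.
have L0 : 0 <= Lp * (d%:R / N%:R) by rewrite mulr_ge0// divr_ge0.
have ig : muL.-integrable (box T : set tup) (EFin \o (fun t => cell f t * F t - F k * cell f t)).
  apply: (bounded_integrable (B := Lp * (d%:R / N%:R) * 1)) => // t _.
  by apply: le_trans (pw t) _; apply: ler_wpM2l => //; have /andP[] := cell01 f t.
apply: le_trans (le_normr_Rintegral _ ig) _; first exact: measurable_box.
apply: (@le_trans _ _ (\int[muL]_(t in box T) (Lp * (d%:R / N%:R) * cell f t))).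
  apply: le_Rintegral => //; first exact: measurable_box.
    by apply: integrable_norm.
  apply: (bounded_integrable (B := Lp * (d%:R / N%:R) * 1)); first exact: measurable_funM.
  move=> t _; have /andP[c0 c1] := cell01 f t.
  by rewrite normrM !ger0_norm// ler_wpM2l.
by rewrite RintegralZl//; [rewrite cint mulrC|exact: measurable_box].
Qed.

End Smoothing.

(** * The action on the space of lattices *)

HB.instance Definition _ (R : realType) m n := Complete.on 'M[R]_(m, n).

Section Action.
Variables (R : realType) (n : nat).
Local Notation SL := (SL R n).
Local Notation X := (lattices R n).

Lemma detSL (g : SL) : \det (val g) = 1.
Proof. by apply/eqP; exact: (valP g). Qed.

Lemma toX_eq (g h : SL) : sameSLZ (g : SLtop R n) h -> toX g = toX h.
Proof.
move=> gh. rewrite /toX. exact/eqquotP.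
Qed.

Lemma toX_same (g h : SL) : toX g = toX h -> sameSLZ (g : SLtop R n) h.
Proof.
move=> gh.
have := @eqquotP _ _ {eq_quot (@sameSLZ_equiv R n)}%qT (g : SLtop R n) (h : SLtop R n).
by move=> H; exact: (introT H gh).
Qed.

Lemma toX_surj (x : X) : exists g : SL, x = toX g.
Proof. exists (repr x); rewrite /toX; by rewrite reprK. Qed.

Definition mulSL (g : SL) (h : 'M[R]_n) : SL := insubd (SL1 R n) (val g *m h).

Lemma val_mulSL g h : \det h = 1 -> val (mulSL g h) = val g *m h.
Proof. by move=> h1; rewrite val_insubd det_mulmx detSL h1 mulr1 eqxx. Qed.

Lemma act_toX (g : SL) h : \det h = 1 -> act (toX g) h = toX (mulSL g h).
Proof.
move=> h1; set r : SL := repr (toX g).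
have /toX_same/asboolP[c c1 cE] : toX r = toX g by rewrite /toX /r reprK.
apply: toX_eq; apply/asboolP; exists c => //.
rewrite -/(mulSL r h) (val_mulSL r h1) (val_mulSL g h1).
by rewrite mulmxA cE.
Qed.

Lemma act_degenerate (x : X) h : \det h != 1 -> act x h = toX (SL1 R n).
Proof.
move=> h1; congr toX; apply/val_inj; rewrite val_insubd det_mulmx.
by rewrite detSL mul1r (negbTE h1).
Qed.

Lemma act1 (x : X) : act x 1%:M = x.
Proof.
have [g ->] := toX_surj x; rewrite act_toX ?det1//; congr toX.
by apply/val_inj; rewrite val_mulSL ?det1// mulmx1.
Qed.

Lemma actM (x : X) h k : \det h = 1 -> \det k = 1 -> act (act x h) k = act x (h *m k).
Proof.
move=> h1 k1; have [g ->] := toX_surj x.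
rewrite !act_toX ?det_mulmx ?h1 ?k1 ?mulr1//; congr toX.
by apply/val_inj; rewrite !val_mulSL ?det_mulmx ?h1 ?k1 ?mulr1// mulmxA.
Qed.

Lemma toX_continuous : continuous (@toX R n : SLtop R n -> X).
Proof. exact: pi_continuous. Qed.

Lemma cvg_SLtop (T : Type) (F : set_system T) (FF : Filter F) (q : T -> SLtop R n) (g : SLtop R n) :
  ((fun t => val (q t) : 'M[R]_n) @ F --> (val g : 'M[R]_n)) -> q @ F --> g.
Proof.
move=> cF U [?/= [[W oW <-]]] /= Wg /filterS; apply; apply: cF.
exact: open_nbhs_nbhs.
Qed.

Lemma mx_norm_le (A : 'M[R]_n) e : 0 <= e -> (`|A| <= e) = [forall i, forall j, `|A i j| <= e].
Proof.
move=> e0; apply/idP/idP => [Ae|/forallP Ae].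
  apply/forallP => i; apply/forallP => j; apply: le_trans Ae.
  rewrite -[leRHS]/(mx_norm A) mx_normrE.
  exact: (le_bigmax (0:R) (fun i : 'I_n * 'I_n => `|A i.1 i.2|) (i, j)).
rewrite -[leLHS]/(mx_norm A) mx_normrE; apply: bigmax_le => // -[i j] _.
by move/forallP : (Ae i) => /(_ j).
Qed.

Lemma mx_entry_le (A : 'M[R]_n) i j : `|A i j| <= `|A|.
Proof. by have := lexx `|A|; rewrite {1}mx_norm_le// => /forallP/(_ i)/forallP/(_ j). Qed.

Lemma mx_norm_mul (A B : 'M[R]_n) : `|A *m B| <= n%:R * `|A| * `|B|.
Proof.
rewrite mx_norm_le ?mulr_ge0//; apply/forallP => i; apply/forallP => j.
rewrite mxE; apply: le_trans (ler_norm_sum _ _ _) _.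
apply: (@le_trans _ _ (\sum_(k < n) (`|A| * `|B|))).
  by apply: ler_sum => k _; rewrite normrM ler_pM// mx_entry_le.
by rewrite sumr_const card_ord -mulrA mulr_natl.
Qed.

Lemma mulmx_continuous (A : 'M[R]_n) : continuous (fun B : 'M[R]_n => A *m B).
Proof.
move=> B; apply/(@cvgrPdist_lt _ _ _ (nbhs B)) => e e0.
have c0 : 0 < n%:R * `|A| + 1 by rewrite ltr_wpDl// mulr_ge0.
near=> C; rewrite -mulmxBr; apply: le_lt_trans (mx_norm_mul _ _) _.
apply: (@le_lt_trans _ _ ((n%:R * `|A| + 1) * `|B - C|)).
  by rewrite ler_wpM2r// lerDl.
rewrite mulrC -ltr_pdivlMr//; near: C.
by apply: (@cvgr_dist_lt _ _ _ (nbhs B)) => //; rewrite divr_gt0.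
Unshelve. all: by end_near. Qed.

Lemma mulmxr_continuous (A : 'M[R]_n) : continuous (fun B : 'M[R]_n => B *m A).
Proof.
move=> B; apply/(@cvgrPdist_lt _ _ _ (nbhs B)) => e e0.
have c0 : 0 < n%:R * `|A| + 1 by rewrite ltr_wpDl// mulr_ge0.
near=> C; rewrite -mulmxBl; apply: le_lt_trans (mx_norm_mul _ _) _.
apply: (@le_lt_trans _ _ ((n%:R * `|A| + 1) * `|B - C|)).
  by rewrite mulrAC ler_wpM2r// lerDl.
rewrite mulrC -ltr_pdivlMr//; near: C.
by apply: (@cvgr_dist_lt _ _ _ (nbhs B)) => //; rewrite divr_gt0.
Unshelve. all: by end_near. Qed.

(** Lifting to a representative reduces continuity to that of matrix
    multiplication. *)
Lemma cvg_act (T : Type) (F : set_system T) (FF : Filter F) (p : T -> 'M[R]_n) (h : 'M[R]_n) (x : X) :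
  \det h = 1 -> (\forall t \near F, \det (p t) = 1) -> p @ F --> h ->
  act x (p t) @[t --> F] --> act x h.
Proof.
move=> h1 p1 ph; have [g ->] := toX_surj x; rewrite act_toX//.
apply: (@cvg_trans _ ((fun t => toX (mulSL g (p t))) @ F)).
  by apply: near_eq_cvg; near do rewrite act_toX//.
apply: (@cvg_comp _ _ _ (fun t => mulSL g (p t) : SLtop R n) (@toX R n)); last exact: toX_continuous.
apply: cvg_SLtop; rewrite (val_mulSL g h1).
apply: (@cvg_trans _ ((fun t => val g *m p t) @ F)).
  by apply: near_eq_cvg; near do rewrite /= val_mulSL//.
apply: (cvg_comp _ _ ph); exact: mulmx_continuous.
Unshelve. all: by end_near. Qed.

(** Right multiplication commutes with the quotient map, so it is continuous on
    the quotient although [act] is defined through representatives. *)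
Lemma act_continuous h : \det h = 1 -> continuous (fun x : X => act x h).
Proof.
move=> h1; apply/quotient_continuous => g.
have -> : (fun x : X => act x h) \o \pi_(lattices R n)%qT = @toX R n \o (fun g => mulSL g h).
  by apply/funext => k /=; rewrite -[RHS]act_toX.
apply: (@cvg_comp _ _ _ (fun g : SLtop R n => mulSL g h : SLtop R n) (@toX R n)); last exact: toX_continuous.
apply: cvg_SLtop; first exact: (nbhs_filter (g : SLtop R n)).
rewrite (val_mulSL g h1).
have -> : (fun k : SLtop R n => val (mulSL k h)) = (fun k : SLtop R n => val k *m h).
  by apply/funext => k /=; rewrite val_mulSL.
have H := @mulmxr_continuous h (val g).
exact: (cvg_comp _ _ (@initial_continuous _ _ (val : Defs.SL R n -> 'M[R]_n) g) H).
Qed.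

Lemma mx_normX (Z : 'M[R]_n) k : `|Z ^+ k| <= (n%:R * `|Z|) ^+ k.
Proof.
elim: k => [|k IH].
  rewrite !expr0 mx_norm_le//; apply/forallP => i; apply/forallP => j.
  by rewrite mxE; case: (i == j); rewrite ?normr1 ?normr0.
rewrite !exprS; apply: le_trans (mx_norm_mul _ _) _.
by rewrite ler_wpM2l// mulr_ge0.
Qed.

(** The k-th term is bounded by r^k with r <= 1/2; the partial sums beyond the
    constant term are then at most 2 r. *)
Lemma expmx_close (Z : 'M[R]_n) : n%:R * `|Z| <= 2^-1 ->
  `|expmx Z - 1| <= 2 * (n%:R * `|Z|).
Proof.
set r := n%:R * _ => r2; have r0 : 0 <= r by rewrite mulr_ge0.
pose u k : 'M[R]_n := (k`!%:R)^-1 *: Z ^+ k.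
have uk k : `|u k| <= r ^+ k.
  rewrite normrZ; apply: le_trans (_ : 1 * `|Z ^+ k| <= _); last by rewrite mul1r mx_normX.
  rewrite ler_wpM2r// ger0_norm ?invr_ge0// invf_le1 ?ler1n ?ltr0n ?fact_gt0//.
have cu : cvgn (series u).
  apply: (@normed_cvg R 'M[R]_n); apply: (@series_le_cvg _ _ (geometric 1 r)) => //.
  - by move=> k /=.
  - by move=> k /=; rewrite mul1r exprn_ge0.
  - by move=> k /=; rewrite mul1r.
  - apply: is_cvg_geometric_series; rewrite ger0_norm//; apply: le_lt_trans r2 _.
    by rewrite invf_lt1// ltr1n.
have part K : `|series u K.+1 - 1| <= 2 * r - 2 * r * 2^-1 ^+ K.
  elim: K => [|K IH].
    rewrite /series /= big_nat1 /u fact0 invr1 scale1r expr0 subrr normr0 expr0 mulr1 subrr//.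
  rewrite seriesSr addrAC; apply: le_trans (ler_normD _ _) _.
  have ukr : `|u K.+1| <= r * 2^-1 ^+ K.
    apply: le_trans (uk _) _; rewrite exprS ler_wpM2l// lerXn2r// nnegrE//.
  apply: le_trans (lerD IH ukr) _; rewrite exprS.
  by set q := 2^-1 ^+ K; lra.
have cn : `|series u k - 1| @[k --> \oo] --> `|expmx Z - 1|.
  by apply: cvg_norm; apply: cvgB; [exact: cu|exact: cvg_cst].
rewrite -(cvg_lim _ cn)//; apply: limr_le; first by apply/cvg_ex; exists (`|expmx Z - 1|).
near=> k; have k0 : (0 < k)%N by near: k; exact: nbhs_infty_gt.
rewrite -(prednK k0); apply: le_trans (part _) _.
by rewrite gerBl mulr_ge0// ?exprn_ge0// mulr_ge0.
Unshelve. all: by end_near. Qed.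

Lemma expmx_cvg1 (Y : 'M[R]_n) : expmx (t *: Y) @[t --> (0:R)] --> (1%:M : 'M[R]_n).
Proof.
apply/(@cvgrPdist_le _ _ _ (nbhs (0:R))) => e e0.
have c0 : 0 < 2 * (n%:R * `|Y|) + 1 by rewrite ltr_wpDl// mulr_ge0// mulr_ge0.
have small (e' : R) : 0 < e' -> \forall t \near (0:R), `|t| * (n%:R * `|Y|) <= e'.
  move=> e'0; near=> t.
  apply: (@le_trans _ _ (`|t| * (2 * (n%:R * `|Y|) + 1))).
    have : 0 <= n%:R * `|Y| by rewrite mulr_ge0.
    by move=> H; rewrite ler_wpM2l//; lra.
  rewrite -ler_pdivlMr//; near: t.
  have := @cvgr_dist_le _ _ _ (nbhs (0:R)) _ id 0 (@cvg_id _ _) (e' / (2 * (n%:R * `|Y|) + 1)).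
  rewrite divr_gt0// => /(_ _ isT); apply: filterS => t /=; by rewrite sub0r normrN.
near=> t.
have E : n%:R * `|t *: Y| = `|t| * (n%:R * `|Y|) by rewrite normrZ mulrCA.
rewrite distrC; apply: le_trans (expmx_close _) _; rewrite E.
  by near: t; apply: small; rewrite invr_gt0.
have : `|t| * (n%:R * `|Y|) <= e / 2 by near: t; apply: small; rewrite divr_gt0.
by lra.
Unshelve. all: by end_near. Qed.

Lemma expmx_nil (Y : 'M[R]_n) : Y *m Y = 0 -> expmx Y = 1%:M + Y.
Proof.
move=> YY; apply: cvg_lim => //.
apply: (@cvg_near_cst _ _ _ _ _ eventually_filter).
near=> k; have k2 : (2 <= k)%N by near: k; exact: nbhs_infty_ge.
rewrite -(subnK k2) addnC /series /= big_mkord big_ord_recl big_ord_recl big1 ?addr0.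
  by rewrite /= !fact0 /bump /= factS fact0 !invr1 !scale1r expr0 expr1.
move=> i _; rewrite !lift0 2!exprS mulrA.
by rewrite [Y * Y]YY mul0r scaler0.
Unshelve. all: by end_near. Qed.
End Action.

Section SmoothSupport.
Variables (R : realType) (n : nat).
Local Notation X := (lattices R n).
Implicit Types (f : X -> R) (s : seq 'M[R]_n).

(** A function with values in {0, c} that is continuous and vanishes at a point
    is locally constant there. *)
Lemma derive1_two_valued (p : R -> R) (c : R) : derivable p 0 1 -> p 0 = 0 ->
  (\forall t \near (0:R), p t = 0 \/ p t = c) -> derive1 p 0 = 0.
Proof.
move=> dp p0 pc.
have cp : {for 0, continuous p} by apply: differentiable_continuous; apply/derivable1_diffP.
have p0' : \forall t \near (0:R), p t = cst 0 t.
  have [c0|c0] := eqVneq c 0.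
    by apply: filterS pc => t [|] ->//; rewrite c0.
  have := @cvgr_dist_lt _ _ _ (nbhs (0:R)) _ p (p 0) cp `|c|.
  rewrite normr_gt0 => /(_ _ c0) near_p.
  near=> t; have [//|tc] : p t = 0 \/ p t = c by near: t.
  have : `|p 0 - p t| < `|c| by near: t.
  by rewrite p0 sub0r normrN tc ltxx.
rewrite derive1E (near_eq_derive (g := cst 0)) ?oner_neq0//.
by rewrite derive_cst.
Unshelve. all: by end_near. Qed.

(** Outside the support all iterated derivatives vanish since they are local.
    Where the determinant of the exponential is not known to be 1, the action
    falls back to a fixed point of the space; then the function of t takes only
    two values near 0, and its derivative vanishes all the same. *)
Lemma lies_vanish f s x : smooth f -> {in s, forall Y, Y \in slv R n} ->
  ~ closure [set x | f x != 0] x -> lies s f x = 0.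
Proof.
move=> sf; elim: s x => [|Y s IH] x sin xZ /=.
  apply/eqP; apply: contrapT => /negP fx; apply: xZ.
  by apply: subset_closure.
have sin' : {in s, forall Y, Y \in slv R n} by move=> Z Zs; apply: sin; rewrite in_cons Zs orbT.
have Ys : Y \in slv R n by apply: sin; rewrite mem_head.
have [_ /(_ Y x Ys) dY] := sf s sin'.
set h := lies s f in IH dY *; rewrite /lie.
pose A := [set t : R | \det (expmx (t *: Y)) = 1].
have e0 : expmx (0 *: Y) = 1%:M.
  by rewrite scale0r expmx_nil ?mulmx0// addr0.
apply: (@derive1_two_valued _ (h (toX (SL1 R n)))) => //.
  by rewrite e0 act1 IH.
have W : nbhs x (~` closure [set x | f x != 0]).
  by apply: open_nbhs_nbhs; split => //; apply: closed_openC; exact: closed_closure.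
(* a path of determinant 1 that agrees with the exponential whenever the
   latter acts *)
pose E (t : R) := if \det (expmx (t *: Y)) == 1 then expmx (t *: Y) else 1%:M.
have E1 t : \det (E t) = 1 by rewrite /E; case: ifP => [/eqP//|_]; rewrite det1.
have cE : E t @[t --> (0:R)] --> (1%:M : 'M[R]_n).
  apply/(@cvgrPdist_le _ _ _ (nbhs (0:R))) => e e_gt0.
  have := @cvgr_dist_le _ _ _ (nbhs (0:R)) _ _ _ (@expmx_cvg1 R n Y) e e_gt0.
  by move=> /(_ _); apply: filterS => t; rewrite /E; case: ifP => // _ _; rewrite subrr normr0 ltW.
have cA : act x (E t) @[t --> (0:R)] --> act x 1%:M.
  by apply: cvg_act => //; [exact: det1|near do exact: E1].
rewrite act1 in cA.
near=> t.
have [dt|dt] := eqVneq (\det (expmx (t *: Y))) 1; last by right; rewrite act_degenerate.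
left; apply: IH => //.
have : (~` closure [set x | f x != 0]) (act x (E t)) by near: t; exact: cA.
by rewrite /E dt eqxx.
Unshelve. all: by end_near. Qed.

(** An iterated derivative is continuous and vanishes outside a compact set. *)
Lemma lies_bounded f s : Cc_smooth f -> {in s, forall Y, Y \in slv R n} ->
  exists2 C : R, 0 <= C & forall x, `|lies s f x| <= C.
Proof.
move=> [sf cpt] sin; set Z := closure _ in cpt.
have [cs _] := sf s sin.
have cptI : compact (lies s f @` Z).
  by apply: continuous_compact => //; exact: continuous_subspaceT.
have [M [Mr MB]] := compact_bounded cptI.
exists (`|M| + 1); first by rewrite addr_ge0.
move=> x; have [xZ|xZ] := pselect (Z x); last first.
  by rewrite lies_vanish// normr0 addr_ge0.
by apply: (MB (`|M| + 1)); [rewrite ltr_pwDr// ler_norm|exists x].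
Qed.
End SmoothSupport.

Section OneParameter.
Variables (R : realType) (n : nat).
Local Notation X := (lattices R n).
Implicit Types f : X -> R.

(** As Y squares to 0, the exponential is 1 + s Y and a one-parameter group; the
    derivative at time s is the Lie derivative at the translated point, so the
    mean value theorem applies. *)
Lemma one_param_lipschitz f (Y : 'M[R]_n) C : 0 <= C -> smooth f ->
  Y \in slv R n -> Y *m Y = 0 -> (forall s : R, \det (1%:M + s *: Y) = 1) ->
  (forall x, `|lie Y f x| <= C) ->
  forall x s, `|f (act x (1%:M + s *: Y)) - f x| <= C * `|s|.
Proof.
move=> C0 sf Ys YY dY CY x.
have eY s : expmx (s *: Y) = 1%:M + s *: Y.
  by rewrite expmx_nil// -scalemxAl -scalemxAr YY !scaler0.
pose p s := f (act x (1%:M + s *: Y)).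
have shiftE s u : p (u + s) = f (act (act x (1%:M + s *: Y)) (expmx (u *: Y))).
  rewrite /p eY actM//; congr (f (act x _)).
  rewrite mulmxDl mul1mx mulmxDr mulmx1 -scalemxAl -scalemxAr YY !scaler0 addr0.
  by rewrite scalerDl addrA.
have dp (s : R) : is_derive s (1 : R) p (lie Y f (act x (1%:M + s *: Y))).
  pose q (u : R) := f (act (act x (1%:M + s *: Y)) (expmx (u *: Y))).
  have dq : derivable q 0 1 by have [_ /(_ Y (act x (1%:M + s *: Y)) Ys)] := sf [::] (fun=> ltac:(by [])).
  have qE u : q u = p (u + s) by rewrite shiftE.
  have E : (fun h : R => h^-1 *: ((q \o shift 0) (h *: 1) - q 0)) =
           (fun h : R => h^-1 *: ((p \o shift s) (h *: 1) - p s)).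
    by apply/funext => h /=; rewrite !qE addr0 add0r.
  rewrite -[lie Y f _]/(derive1 q 0) derive1E /derive.
  move: dq; rewrite /derivable E => cq.
  by apply: DeriveDef; [exact: cq|rewrite /derive].
have mvt a c : a <= c -> `|p c - p a| <= C * (c - a).
  move=> ac; have pc : {within `[a, c], continuous p}.
    apply: continuous_subspaceT => z.
    by apply: differentiable_continuous; apply/derivable1_diffP; case: (dp z).
  have [z _ ->] := MVT_segment ac (fun z _ => dp z) pc.
  by rewrite normrM ler_pM// ger0_norm// subr_ge0.
have p0 : p 0 = f x by rewrite /p scale0r addr0 act1.
move=> s; rewrite -/(p s) -p0; have [s0|s0] := leP 0 s.
  by have := mvt _ _ s0; rewrite subr0 (ger0_norm s0).
by rewrite distrC; have := mvt _ _ (ltW s0); rewrite sub0r (ltr0_norm s0).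
Qed.
End OneParameter.

Section Horospherical.
Variables (R : realType) (n m d : nat) (phi : 'I_d -> 'I_n * 'I_n).
Hypothesis hphi : block_coords phi m.
Local Notation X := (lattices R n).
Local Notation E k := (delta_mx (phi k).1 (phi k).2 : 'M[R]_n).

Lemma block_coord_lt k : ((phi k).1 < m <= (phi k).2)%N.
Proof. by apply/(hphi.2); exists k; case: (phi k). Qed.

Lemma delta_blockM k l (a c : R) : (a *: E k) *m (c *: E l) = 0.
Proof.
rewrite -scalemxAl -scalemxAr mul_delta_mx_0 ?scaler0//.
apply/eqP => e; have := block_coord_lt k; have := block_coord_lt l.
by rewrite e => /andP[lm _] /andP[_ ml]; have := leq_trans lm ml; rewrite ltnn.
Qed.

Lemma det_horo (t : d.-tuple R) : \det (horo phi t) = 1.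
Proof.
have hE (i j : 'I_n) : (j <= i)%N -> horo phi t i j = (i == j)%:R.
  move=> ji; rewrite !mxE summxE big1 ?addr0// => k _; rewrite !mxE.
  case: eqVneq => [ik|]; last by rewrite mulr0.
  case: eqVneq => [jk|]; last by rewrite mulr0.
  have /andP[] := block_coord_lt k; rewrite -ik -jk => a c.
  by have := leq_trans a c; rewrite ltnNge ji.
rewrite -det_tr det_trig.
  by rewrite big1// => i _; rewrite mxE hE// eqxx.
by apply/is_trig_mxP => i j ij; rewrite mxE hE ?(ltnW ij)// -val_eqE /= gtn_eqF.
Qed.

Definition addt (s t : d.-tuple R) : d.-tuple R := [tuple tnth s i + tnth t i | i < d].

(** The block above the diagonal squares to 0. *)
Lemma horoD s t : horo phi s *m horo phi t = horo phi (addt s t).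
Proof.
rewrite /horo mulmxDl mul1mx mulmxDr mulmx1 mulmx_suml [X in _ + (_ + X)]big1 => [|k _].
  rewrite addr0 -addrA -big_split /=; congr (_ + _); apply: eq_bigr => k _.
  by rewrite -scalerDl tnth_mktuple addrC.
by rewrite mulmx_sumr big1// => l _; exact: delta_blockM.
Qed.

Lemma act_horoD (x : X) s t : act (act x (horo phi s)) (horo phi t) = act x (horo phi (addt s t)).
Proof. by rewrite actM ?det_horo// horoD. Qed.

Definition unit_tuple k (c : R) : d.-tuple R := [tuple if i == k then c else 0 | i < d].

Lemma horo_unit k c : horo phi (unit_tuple k c) = 1%:M + c *: E k.
Proof.
rewrite /horo; congr (_ + _); rewrite (bigD1 k)//= big1 ?addr0 => [|i ik].
  by rewrite tnth_mktuple eqxx.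
by rewrite tnth_mktuple (negbTE ik) scale0r.
Qed.

Lemma delta_slv k : E k \in slv R n.
Proof.
rewrite memv_ker lfunE /= /mxtrace big1// => i _; rewrite mxE.
case: eqVneq => // e1; case: eqVneq => // e2.
by have /andP[a c] := block_coord_lt k; have := leq_trans a c; rewrite -e1 -e2 ltnn.
Qed.

(** Pass from s to t by changing one coordinate at a time, each along a
    unipotent one-parameter group. *)
Lemma horo_lipschitz (f : X -> R) : Cc_smooth f ->
  exists2 L : R, 0 <= L & forall x s t,
    `|f (act x (horo phi s)) - f (act x (horo phi t))| <= L * \sum_i `|tnth s i - tnth t i|.
Proof.
move=> cf.
have /choice[C Cb] : forall k, exists C : R, 0 <= C /\ forall x, `|lie (E k) f x| <= C.
  move=> k; have [|C C0 CB] := @lies_bounded _ _ f [:: E k] cf.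
    by move=> Y; rewrite inE => /eqP ->; exact: delta_slv.
  by exists C; split.
have C0 k : 0 <= C k by case: (Cb k).
exists (\sum_k C k); first exact: sumr_ge0.
move=> x s t.
pose mix j : d.-tuple R := [tuple if (i < j)%N then tnth s i else tnth t i | i < d].
pose F u := f (act x (horo phi u)).
have -> : f (act x (horo phi s)) - f (act x (horo phi t)) = \sum_(0 <= j < d) (F (mix j.+1) - F (mix j)).
  rewrite telescope_sumr//; congr (F _ - F _); apply: eq_from_tnth => i; rewrite tnth_mktuple.
    by rewrite ltn_ord.
  by rewrite ltn0.
rewrite big_mkord; apply: le_trans (ler_norm_sum _ _ _) _.
rewrite mulr_sumr; apply: ler_sum => k _.
have -> : mix k.+1 = addt (mix k) (unit_tuple k (tnth s k - tnth t k)).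
  apply: eq_from_tnth => i; rewrite !tnth_mktuple ltnS leq_eqVlt.
  have [->|ik] := eqVneq i k; first by rewrite eqxx ltnn /= addrC subrK.
  by rewrite (negbTE (ik : (i : nat) != k)) addr0.
rewrite /F -act_horoD horo_unit; apply: le_trans (one_param_lipschitz _ _ _ _ _ _ _ _) _.
- exact: (C0 k).
- by case: cf.
- exact: delta_slv.
- by have := delta_blockM k k 1 1; rewrite !scale1r.
- by move=> c; rewrite -horo_unit det_horo.
- by move=> y; case: (Cb k).
by rewrite ler_wpM2r// (bigD1 k)//= lerDl sumr_ge0.
Qed.
End Horospherical.

(** * The invariant measure *)

Section BorelX.
Variables (R : realType) (n : nat) (mX : probability (borelX R n) R).
Local Notation X := (lattices R n).
Implicit Types f : X -> R.

Lemma open_measurableX (U : set X) : open U -> measurable (U : set (borelX R n)).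
Proof. by move=> oU; exact: sub_sigma_algebra. Qed.

Lemma continuous_measurableX f : continuous f ->
  measurable_fun [set: borelX R n] (f : borelX R n -> R).
Proof.
move=> cf; apply: (measurability _ (RGenOInfty.measurableE R)).
move=> _ [_ [a ->] <-]; rewrite setTI; apply: open_measurableX.
by move/continuousP : cf; apply; exact: interval_open.
Qed.

Lemma Lnorm_bounded f C : 0 <= C -> (forall x, `|f x| <= C) ->
  (Lnorm mX +oo (fun x : borelX R n => (f x)%:E) <= C%:E)%E.
Proof.
move=> C0 fC; rewrite unlock; case: ifP => _ //.
by apply/ess_supP; apply: nearW => x /=; rewrite lee_fin.
Qed.

(** The norm is a finite sum of essential suprema of bounded functions. *)
Lemma sobolev_bounded (B : seq 'M[R]_n) l f : basis_of (slv R n) B -> Cc_smooth f ->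
  exists2 C : R, 0 <= C & (sobolev mX B l f <= C%:E)%E.
Proof.
move=> hB cf.
have bdd (k : nat) (w : k.-tuple 'I_(size B)) : exists C : R, 0 <= C /\ forall x,
   `|lies [seq B`_i | i : 'I_(size B) <- w] f x| <= C.
  have [|C C0 CB] := lies_bounded (s := [seq B`_i | i : 'I_(size B) <- w]) cf.
    by move=> Y /mapP[i _ ->]; apply: (basis_mem hB); exact: mem_nth.
  by exists C.
pose c (k : nat) (w : k.-tuple 'I_(size B)) := xget 0 [set C : R | 0 <= C /\ forall x,
   `|lies [seq B`_i | i : 'I_(size B) <- w] f x| <= C] : R.
have cP k (w : k.-tuple 'I_(size B)) : 0 <= c k w /\ forall x,
   `|lies [seq B`_i | i : 'I_(size B) <- w] f x| <= c k w := xgetPex 0 (bdd k w).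
exists (\sum_(k < l.+1) \sum_(w : k.-tuple 'I_(size B)) c k w).
  by apply: sumr_ge0 => k _; apply: sumr_ge0 => w _; case: (cP k w).
rewrite /sobolev -sumEFin; apply: lee_sum => k _; rewrite -sumEFin; apply: lee_sum => w _.
by have [c0 cb] := cP k w; exact: Lnorm_bounded.
Qed.

Lemma smooth_continuous f : Cc_smooth f -> continuous f.
Proof. by case=> sf _; have [] := sf [::] (fun=> ltac:(by [])). Qed.

Lemma smooth_bounded f : Cc_smooth f -> exists2 C : R, 0 <= C & forall x, `|f x| <= C.
Proof. by move=> cf; have [|C C0 CB] := lies_bounded (s := [::]) cf; [|exists C]. Qed.

Hypothesis hmX : SL_invariant mX.

Definition cell_index (k : nat) (h : SL R n) : 'M[int]_n :=
  \matrix_(i, j) Num.floor (val h i j * k.+1%:R).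

(** A countable dense family: one group element in each nonempty cell of each
    grid of mesh 1 / (k + 1). *)
Definition cell_point (p : nat * 'M[int]_n) : SL R n :=
  xget (SL1 R n) [set h : SL R n | cell_index p.1 h = p.2].

Lemma cell_point_dense (O : set (SLtop R n)) (h : SLtop R n) : nbhs h O ->
  exists p, O (cell_point p).
Proof.
move=> [_ [[U oU <-] Uh] /= UO].
have [e /= e0 eU] : exists2 e : R, 0 < e & ball (val h : 'M[R]_n) e `<=` U.
  by have := open_nbhs_nbhs (conj oU Uh : open_nbhs _ _) => /nbhs_ballP[e e0 eU]; exists e.
have [k ke] : exists k : nat, k.+1%:R^-1 < e.
  exists (Num.truncn e^-1); rewrite invf_plt ?posrE// ; exact: truncnS_gt.
exists (k, cell_index k h); apply: UO => /=; apply: eU.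
have : cell_index k (cell_point (k, cell_index k h)) = cell_index k h.
  by apply: (@xgetPex _ (SL1 R n) [set h' | cell_index k h' = cell_index k h]); exists h.
set h' := cell_point _ => E.
rewrite -ball_normE /=.
apply: le_lt_trans ke; rewrite mx_norm_le ?invr_ge0//.
apply/forallP => i; apply/forallP => j.
have := congr1 (fun A : 'M[int]_n => A i j) E; rewrite !mxE => Eij.
have k0 : 0 < k.+1%:R :> R by rewrite ltr0n.
rewrite -(ler_pM2r k0) mulVf ?gt_eqF// -[X in _ * X](ger0_norm (ltW k0)) -normrM mulrBl.
have := floor_itv (val h i j * k.+1%:R); have := floor_itv (val h' i j * k.+1%:R).
rewrite Eij; move=> /andP[a b] /andP[c e1].
by rewrite ler_norml; move: a b c e1; rewrite intrD; lra.
Qed.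

(** Countably many translates of a nonempty open set cover the space, and
    invariance gives all of them the same measure. *)
Lemma open_null_empty (U : set X) : open U -> mX U = 0%E -> U = set0.
Proof.
move=> oU U0; apply/eqP; apply: contrapT => /negP/set0P[x0 Ux0].
have [g0 x0E] := toX_surj x0.
pose A p := [set x : X | U (act x (val (cell_point p)))].
have oA p : open (A p).
  have := act_continuous (detSL (cell_point p)) => /continuousP; exact.
have A0 p : mX (A p) = 0%E.
  by rewrite -U0 -(hmX (cell_point p) (open_measurableX oU)).
pose F k := if unpickle k is Some p then A p else set0.
have cover : \bigcup_k F k = [set: X].
  apply/seteqP; split=> // x _; have [g ->] := toX_surj x.
  pose h : SL R n := mulSL (insubd (SL1 R n) (invmx (val g))) (val g0).
  have vh : val h = invmx (val g) *m val g0.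
    rewrite val_mulSL ?detSL// val_insubd det_inv detSL invr1 eqxx//.
  have gh : act (toX g) (val h) = x0.
    rewrite act_toX ?detSL// x0E; congr toX; apply/val_inj.
    by rewrite val_mulSL ?detSL// vh mulmxA mulmxV ?mul1mx// unitmxE detSL unitr1.
  have [|p Up] := @cell_point_dense [set k : SLtop R n | U (act (toX g) (val k))] h.
    have : act (toX g) (val k) @[k --> (h : SLtop R n)] --> act (toX g) (val h).
      apply: cvg_act; [exact: (nbhs_filter (h : SLtop R n))|exact: detSL| |exact: (@initial_continuous _ _ (val : SL R n -> 'M[R]_n) h)].
      by apply: (@filterE _ _ (nbhs_filter (h : SLtop R n))) => k; exact: detSL.
    by apply; rewrite gh; exact: open_nbhs_nbhs.
  by exists (pickle p) => //; rewrite /F pickleK.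
have := @probability_setT _ _ _ mX; rewrite -cover => m1.
have : mX (\bigcup_k F k) = 0%E.
  apply: measure_negligible; first by rewrite cover; exact: measurableT.
  apply: negligible_bigcup => k; rewrite /F; case: unpickle => [p|]; last exact: negligible_set0.
  by apply/negligibleP; [exact: open_measurableX|exact: A0].
by rewrite m1 => /eqP; rewrite onee_eq0.
Qed.

Lemma integral_eq0_eq0 f : Cc_smooth f -> (forall x, 0 <= f x) ->
  \int[mX]_x f x = 0 -> forall x, f x = 0.
Proof.
move=> cf f0 If0; have ctf := smooth_continuous cf.
have [C C0 fC] := smooth_bounded cf.
have mf := continuous_measurableX ctf.
have oU : open [set x | f x != 0].
  have -> : [set x | f x != 0] = f @^-1` [set~ 0] by apply/seteqP; split=> x /= /eqP.
  move/continuousP : ctf; apply; rewrite openC; exact: closed_eq.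
suff E : [set x | f x != 0] = set0.
  move=> x; apply/eqP; apply: contrapT => /negP fx.
  by have : [set x | f x != 0] x by []; rewrite E.
apply: open_null_empty => //.
apply: measure_negligible; first exact: open_measurableX.
have : (\int[mX]_(x in setT) `|(f x)%:E|)%E = 0%E.
  have fin : (\int[mX]_x (f x)%:E)%E \is a fin_num.
    apply: (@integrable_fin_num _ _ _ mX) => //.
    apply: measurable_bounded_integrable => //; first by apply: (le_lt_trans (probability_le1 mX _)) => //; exact: ltry.
    exists C; split; first exact: num_real.
    by move=> y Cy x _ /=; apply: le_trans (fC x) (ltW Cy).
  under eq_integral do rewrite gee0_abs ?lee_fin//.
  by rewrite -(fineK fin) -/(Rintegral mX setT f) If0.
move/ae_eq_integral_abs => /(_ measurableT _) H.
have [|N [mN N0 NS]] := H; first exact/measurable_EFinP.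
exists N; split => // x /= fx; apply: NS => /= /(_ I) /eqP; rewrite eqe.
by rewrite (negbTE fx).
Qed.
End BorelX.

(** * Dirichlet's bound for the Diophantine exponent *)

Section Dirichlet.
Variables (R : realType) (n : nat).

Definition multivector_of (w : 'I_n -> int) : {ffun {set 'I_n} -> int} :=
  [ffun I : {set 'I_n} => \sum_(k | I == finset.set1 k) w k].

Lemma sum_set1 (V : zmodType) (w : 'I_n -> V) j :
  \sum_(k | finset.set1 j == finset.set1 k) w k = w j.
Proof.
rewrite (big_pred1 j) // => k /=.
by apply/eqP/eqP => [/finset.set1_inj|->].
Qed.

Lemma multivector_ofP (w : 'I_n -> int) : (1 < n)%N -> (exists k, w k != 0) ->
  int_multivectors (multivector_of w).
Proof.
move=> n1 [k wk]; split.
  apply/eqP => /ffunP /(_ (finset.set1 k)); rewrite !ffunE sum_set1 => /eqP.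
  by rewrite (negbTE wk).
exists 1%N; split; first by rewrite n1.
move=> I I1; rewrite ffunE big1// => i /eqP Ii.
by rewrite Ii finset.cards1 in I1.
Qed.

Lemma wedge1 (v : ext R n) : wedge v (ext1 R n) = v.
Proof.
apply/ffunP => K; rewrite ffunE (bigD1 K)//= [X in _ + X]big1 ?addr0.
  rewrite ffunE finset.setDv eqxx mulr1 eq_card0 ?expr0 ?mul1r// => p.
  by rewrite inE finset.in_set0 andbF.
move=> I /andP[IK nIK]; rewrite ffunE; case: eqP => [E|_]; last by rewrite mulr0.
case/eqP: nIK; apply/eqP; rewrite finset.eqEsubset IK /=.
by rewrite -finset.setD_eq0 E.
Qed.

Lemma ext_basis_act1 k (h : 'M[R]_n) : ext_basis_act (finset.set1 k) h = ext_vec (row k h).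
Proof. by rewrite /ext_basis_act finset.enum_set1 big_cons big_nil wedge1. Qed.

Lemma ext_act_multivector (w : 'I_n -> int) (h : 'M[R]_n) J :
  ext_act (ext_of_int R (multivector_of w)) h J =
  \sum_(i | J == finset.set1 i) \sum_k (w k)%:~R * h k i.
Proof.
rewrite ffunE.
transitivity (\sum_k (w k)%:~R * (ext_vec (row k h)) J).
  transitivity (\sum_I \sum_(k | I == finset.set1 k) (w k)%:~R * ext_basis_act (finset.set1 k) h J).
    apply: eq_bigr => I _; rewrite ffunE ffunE rmorph_sum mulr_suml.
    by apply: eq_bigr => k /eqP ->.
  rewrite (exchange_big_dep xpredT)//=; apply: eq_bigr => k _.
  by rewrite big_pred1_eq ext_basis_act1.
under eq_bigr do rewrite ffunE mulr_sumr.
rewrite exchange_big; apply: eq_bigr => i _; apply: eq_bigr => k _.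
by rewrite mxE.
Qed.

Lemma ext_norm_multivector (w : 'I_n -> int) (h : 'M[R]_n) (C : R) : 0 <= C ->
  (forall i, `|\sum_k (w k)%:~R * h k i| <= C) ->
  ext_norm (ext_act (ext_of_int R (multivector_of w)) h) <= C.
Proof.
move=> C0 wh; apply: bigmax_le => // J _; rewrite ext_act_multivector.
have [/existsP[j /eqP ->]|] := boolP [exists j, J == finset.set1 j].
  by rewrite sum_set1.
by move=> nJ; rewrite big1 ?normr0// => i Ji; case/negP: nJ; apply/existsP; exists i.
Qed.

(** The pigeonhole principle. The (K + 1)^n combinations with coefficients in
    [0, K] have their first m coordinates in Q^m cells of size 2 A / Q; two in
    the same cell differ by a nonzero combination w as wanted. *)
Lemma small_combination m (mn : (m <= n)%N) (g : 'M[R]_n) (K Q : nat) (A : R) :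
  (Q ^ m < K.+1 ^ n)%N -> (0 < Q)%N -> 0 < A ->
  (forall i, \sum_k K%:R * `|g k i| < A) ->
  exists w : 'I_n -> int, [/\ (exists k, w k != 0), (forall k, `|(w k)%:~R : R| <= K%:R) &
    forall i : 'I_n, (i < m)%N -> `|\sum_k (w k)%:~R * g k i| <= 2 * A / Q%:R].
Proof.
move=> QK Q0 A0 gA.
have QR : 0 < Q%:R :> R by rewrite ltr0n.
pose y (v : {ffun 'I_n -> 'I_K.+1}) i := \sum_k (v k : nat)%:R * g k i.
have yA v i : `|y v i| < A.
  apply: le_lt_trans (gA i); apply: le_trans (ler_norm_sum _ _ _) _.
  apply: ler_sum => k _; rewrite normrM ger0_norm// ler_wpM2r// ler_nat.
  by rewrite -ltnS.
pose z v i := (y v i + A) / (2 * A) * Q%:R.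
have z_itv v i : 0 <= z v i < Q%:R.
  have := yA v i; rewrite ltr_norml => /andP[a c]; apply/andP; split.
    by rewrite mulr_ge0// ?divr_ge0//; lra.
  by rewrite gtr_pMl// ltr_pdivrMr; lra.
have zQ v i : (Num.truncn (z v i) < Q)%N.
  have /andP[a c] := z_itv v i; rewrite -(ltr_nat R); apply: le_lt_trans c.
  by have /andP[] := truncn_itv a.
pose F (v : {ffun 'I_n -> 'I_K.+1}) : {ffun 'I_m -> 'I_Q} :=
  [ffun i => Ordinal (zQ v (widen_ord mn i))].
have [v [v' [vv' Fvv']]] : exists v v', v != v' /\ F v = F v'.
  apply: contrapT => H; have /leq_card : injective F.
    move=> v v' E; apply/eqP; apply: contrapT => /negP vv'; apply: H.
    by exists v, v'.
  by rewrite !card_ffun !card_ord leqNgt QK.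
exists (fun k => (v k : nat)%:Z - (v' k : nat)%:Z); split.
- apply: contrapT => H; case/eqP: vv'; apply/ffunP => k; apply/val_inj/eqP.
  rewrite -(eqr_nat int) -subr_eq0 !natz; apply: contrapT => /negP Hk; apply: H.
  by exists k.
- move=> k; rewrite intrB -!pmulrn.
  have : (v k : nat)%:R <= K%:R :> R by rewrite ler_nat -ltnS.
  have : (v' k : nat)%:R <= K%:R :> R by rewrite ler_nat -ltnS.
  have : 0 <= (v k : nat)%:R :> R by []. have : 0 <= (v' k : nat)%:R :> R by [].
  by rewrite ler_norml; lra.
move=> i im.
have -> : \sum_k ((v k : nat)%:Z - (v' k : nat)%:Z)%:~R * g k i = y v i - y v' i.
  by rewrite -sumrB; apply: eq_bigr => k _; rewrite intrB -!pmulrn mulrBl.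
have := congr1 (fun f : {ffun 'I_m -> 'I_Q} => f (Ordinal im) : nat) Fvv'.
rewrite !ffunE /=; have -> : widen_ord mn (Ordinal im) = i by apply/val_inj.
move=> E.
have zz : `|z v i - z v' i| <= 1.
  have /andP[a _] := z_itv v i; have /andP[a' _] := z_itv v' i.
  have := truncn_itv a; have := truncn_itv a'; rewrite E => /andP[b c] /andP[b' c'].
  by move: b c b' c'; rewrite -addn1 natrD ler_norml; lra.
rewrite ler_pdivlMr// -[leRHS]mulr1.
apply: le_trans (_ : 2 * A * `|z v i - z v' i| <= _); last by rewrite ler_pM2l// mulr_gt0.
have A2 : 0 < 2 * A by rewrite mulr_gt0.
have E2 : (y v i - y v' i) * Q%:R = 2 * A * (z v i - z v' i).
  by rewrite /z; field; rewrite gt_eqF.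
have := congr1 (fun u : R => `|u|) E2; rewrite !normrM (ger0_norm (ltW QR)) => ->.
by rewrite -[X in X * _ <= _]normrM (ger0_norm (ltW A2)).
Qed.
End Dirichlet.

Section Exponent.
Variables (R : realType) (n m d : nat) (phi : 'I_d -> 'I_n * 'I_n).
Hypotheses (n2 : (1 < n)%N) (mn : (m < n)%N) (hphi : block_coords phi m).

Lemma horo_row (g : 'M[R]_n) (w : 'I_n -> int) (t : d.-tuple R) j :
  \sum_k (w k)%:~R * (g *m horo phi t) k j =
  \sum_k (w k)%:~R * g k j +
  \sum_(l | (phi l).2 == j) tnth t l * \sum_k (w k)%:~R * g k (phi l).1.
Proof.
have E k : (g *m horo phi t) k j = g k j + \sum_(l | (phi l).2 == j) tnth t l * g k (phi l).1.
  rewrite mulmxDr mulmx1 mxE; congr (_ + _).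
  rewrite mulmx_sumr summxE [LHS](bigID (fun l => (phi l).2 == j))/= [X in _ + X]big1 ?addr0.
    apply: eq_bigr => l /eqP lj; rewrite -scalemxAr mxE; congr (_ * _).
    rewrite mxE (bigD1 (phi l).1)//= mxE lj !eqxx mulr1 big1 ?addr0// => i il.
    by rewrite mxE (negbTE il) mulr0.
  move=> l lj; rewrite -scalemxAr mxE mxE big1 ?mulr0// => i _.
  by rewrite mxE [j == _]eq_sym (negbTE lj) andbF mulr0.
under eq_bigr do rewrite E mulrDr.
rewrite big_split /=; congr (_ + _).
under [RHS]eq_bigr do rewrite mulr_sumr.
rewrite exchange_big; apply: eq_bigr => k _; rewrite mulr_sumr.
by apply: eq_bigr => l _; rewrite mulrCA.
Qed.

(** Degree 1 is enough. With Q close to T and K close to T^(m/n), a nonzero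
    integer vector has image of size K whose first m coordinates are at most
    K / T; the flow up to time T then keeps it of size K. *)
Lemma small_integer_vector (g : SL R n) : exists2 C : R, 0 < C & forall T : R, 1 <= T ->
  exists2 w, @int_multivectors n w &
    forall t, box T t -> wgu phi w g t <= C * T `^ (m%:R / n%:R).
Proof.
set G : R := n%:R * `|val g|; set r : R := m%:R / n%:R.
have n0 : 0 < n%:R :> R by rewrite ltr0n ltnW.
have G0 : 0 <= G by rewrite mulr_ge0.
have r0 : 0 <= r by rewrite divr_ge0.
pose p : R := 2 `^ r.
have p0 : 0 <= p by rewrite powR_ge0.
exists (p * G + 2 * d%:R * (p * G + 1) + 1).
  by rewrite ltr_wpDl// addr_ge0// !mulr_ge0// addr_ge0// mulr_ge0.
move=> T T1; have T0 : 0 < T by apply: lt_le_trans T1.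
set Q := (Num.truncn T).+1.
have TQ : T < Q%:R by exact: truncnS_gt.
have QT : Q%:R <= 2 * T.
  by rewrite /Q -addn1 natrD; have /andP[+ _] := truncn_itv (ltW T0); lra.
have Q0 : 0 < Q%:R :> R by rewrite ltr0n.
set K := Num.truncn (Q%:R `^ r : R).
have /andP[KQ QK] := truncn_itv (powR_ge0 (Q%:R : R) r).
have KT : K%:R <= p * T `^ r.
  apply: le_trans KQ _; rewrite -powRM// ?(ltW T0)//.
  by rewrite ge0_ler_powR// nnegrE// mulr_ge0// ltW.
have QKn : (Q ^ m < K.+1 ^ n)%N.
  rewrite -(ltr_nat R) !natrX.
  have -> : Q%:R ^+ m = (Q%:R `^ r) ^+ n :> R.
    by rewrite -[RHS]powR_mulrn ?powR_ge0// -powRrM /r divfK ?gt_eqF// powR_mulrn// ltW.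
  by rewrite ltrXn2r// ?powR_ge0// -lt0n ltnW.
have [||w [w0 wK wsmall]] := small_combination (ltnW mn) QKn (ltn0Sn _ : (0 < Q)%N) (_ : 0 < K%:R * G + 1) (g := val g).
- by rewrite ltr_wpDl// mulr_ge0.
- move=> i; rewrite -mulr_sumr; apply: le_lt_trans (_ : K%:R * G < _); last by rewrite ltrDl.
  rewrite ler_wpM2l// /G -[X in X%:R]card_ord mulr_natl -sumr_const.
  by apply: ler_sum => k _; exact: mx_entry_le.
exists (multivector_of w); first exact: multivector_ofP.
move=> t bt; have Tr1 : 1 <= T `^ r by rewrite -[leLHS](powRr0 T) ler_powR.
have KG : K%:R * G <= p * G * T `^ r by rewrite mulrAC ler_wpM2r.
have KG0 : 0 <= K%:R * G by rewrite mulr_ge0.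
apply: (@le_trans _ _ (K%:R * G + 2 * d%:R * (K%:R * G + 1))); last first.
  have d0 : 0 <= d%:R :> R by [].
  have pG0 : 0 <= p * G by rewrite mulr_ge0.
  apply: (@le_trans _ _ (p * G * T `^ r + 2 * d%:R * (p * G * T `^ r + T `^ r))).
    by rewrite lerD// ler_wpM2l ?mulr_ge0// lerD.
  rewrite [leRHS](_ : _ = p * G * T `^ r + 2 * d%:R * (p * G * T `^ r + T `^ r) + T `^ r); last by ring.
  by rewrite lerDl powR_ge0.
apply: ext_norm_multivector; first by rewrite addr_ge0// !mulr_ge0// addr_ge0.
move=> j; rewrite horo_row; apply: le_trans (ler_normD _ _) _; apply: lerD.
  apply: le_trans (ler_norm_sum _ _ _) _.
  apply: (@le_trans _ _ (\sum_(k < n) K%:R * `|val g|)).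
    by apply: ler_sum => k _; rewrite normrM ler_pM// mx_entry_le.
  by rewrite sumr_const card_ord /G mulrCA [X in _ <= X]mulr_natl.
apply: le_trans (ler_norm_sum _ _ _) _.
apply: (@le_trans _ _ (\sum_(l < d) T * (2 * (K%:R * G + 1) / Q%:R))).
  rewrite big_mkcond; apply: ler_sum => l _; case: ifP => _.
    rewrite normrM ler_pM//; first by have /andP[t0 tT] := bt l; rewrite ger0_norm.
    by apply: wsmall; have /andP[] := block_coord_lt hphi l.
  by rewrite mulr_ge0 ?divr_ge0// ?mulr_ge0// ?addr_ge0// ltW.
rewrite sumr_const card_ord -[X in X <= _]mulr_natr [leRHS](_ : _ = 2 * (K%:R * G + 1) * d%:R); last by ring.
rewrite ler_wpM2r// mulrCA ger_pMr ?mulr_gt0 ?ltr_wpDl//.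
by rewrite ler_pdivrMr// mul1r ltW.
Qed.

Lemma dio_exponent_le (delta : R) (x : lattices R n) : strongly_poly_dio phi delta x ->
  delta <= m%:R / n%:R.
Proof.
move=> [g _ [T Toy Tdio]]; have [C C0 CP] := small_integer_vector g.
rewrite leNgt; apply/negP => rd; set r := m%:R / n%:R in CP rd.
have e0 : 0 < delta - r by rewrite subr_gt0.
have big : \forall i \near \oo, Num.max 1 (C `^ (delta - r)^-1) < T i.
  by move/cvgryPgt : Toy; apply.
have [i Ti] := filter_ex big.
move: Ti; rewrite gt_max => /andP[T1 TC].
have [w wI wC] := CP _ (ltW T1).
have T0 : 0 < T i by apply: lt_trans T1.
have : ((T i `^ delta)%:E < (C * T i `^ r)%:E)%E.
  apply: lt_le_trans (Tdio i) _.
  apply: (@le_trans _ _ (ereal_sup [set (wgu phi w g t)%:E | t in box (T i)])).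
    by apply: ereal_inf_lbound; exists w.
  by apply: ge_ereal_sup => _ [t bt <-]; rewrite lee_fin wC.
rewrite lte_fin -[delta in X in X < _](subrK r) powRD; last first.
  by apply/implyP => _; rewrite gt_eqF.
rewrite ltr_pM2r ?powR_gt0// ltNge => /negP; apply.
apply: le_trans (_ : (C `^ (delta - r)^-1) `^ (delta - r) <= _).
  by rewrite -powRrM mulVf ?gt_eqF// powRr1// ltW.
by rewrite ge0_ler_powR ?nnegrE ?powR_ge0// ltW.
Qed.
End Exponent.

(** * The sifted sum *)

Section SievedBox.
Variables (R : realType) (d : nat).

Lemma coprime_primorial (k : nat) (y : R) : coprime k (primorial y) <->
  forall p, prime p -> p%:R < y -> ~~ (p %| k)%N.
Proof.
have P0 : (0 < primorial y)%N.
  by rewrite /primorial prodn_cond_gt0// => p /andP[/prime_gt0].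
split=> [ck p pp py|H].
  apply/negP => pk; have pP : (p %| primorial y)%N.
    rewrite /primorial Euclid_dvd_prod// big_has_cond; apply/hasP; exists p.
      rewrite mem_index_iota /= ltnS truncn_ge_nat ?(ltW py)//.
      by apply: le_trans (ltW py).
    by rewrite /= pp py dvdnn.
  have : (p %| gcdn k (primorial y))%N by rewrite dvdn_gcd pk.
  by rewrite (eqP ck) dvdn1 => /eqP p1; rewrite p1 in pp.
rewrite /coprime eqn_leq gcdn_gt0 P0 orbT andbT leqNgt; apply/negP => g1.
have pp := pdiv_prime g1; set p := pdiv _ in pp.
have := pdiv_dvd (gcdn k (primorial y)); rewrite -/p dvdn_gcd => /andP[pk].
rewrite /primorial Euclid_dvd_prod// big_has_cond => /hasP[q _ /= /andP[/andP[qp qy]]].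
rewrite dvdn_prime2// => /eqP pq; rewrite pq in pk.
by have := H q qp qy; rewrite pk.
Qed.

Lemma coprime_prod_primorial (k : 'I_d -> nat) (y : R) :
  coprime (\prod_i k i) (primorial y) <->
  forall p i, prime p -> p%:R < y -> ~~ (p %| k i)%N.
Proof.
split=> [/coprime_primorial H p i pp py|H].
  apply: contra (H p pp py) => pk; apply: dvdn_trans pk _.
  by rewrite (bigD1 i)//= dvdn_mulr.
apply/coprime_primorial => p pp py; rewrite Euclid_dvd_prod//.
by rewrite big_has_cond; apply/hasPn => i _ /=; exact: H.
Qed.

Lemma sieved_box_sum M (y : R) (G : d.-tuple R -> R) :
  \sum_(k \in @sieved_box R d (M%:R + 1 / 2) y) G (map_tuple (fun z : int => z%:~R) k) =
  \sum_(f : {ffun 'I_d -> 'I_M.+1} | coprime (\prod_i (f i : 'I_M.+1)) (primorial y))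
     G [tuple (f i : nat)%:R | i < d].
Proof.
pose h (f : {ffun 'I_d -> 'I_M.+1}) : d.-tuple int := [tuple (f i : nat)%:Z | i < d].
have hG f : map_tuple (fun z : int => z%:~R) (h f) = [tuple (f i : nat)%:R : R | i < d].
  by apply: eq_from_tnth => i; rewrite tnth_map !tnth_mktuple -pmulrn.
have hp f : coprimez (\prod_i tnth (h f) i) (primorial y) =
    coprime (\prod_i (f i : 'I_M.+1)) (primorial y).
  rewrite coprimezE /= (_ : \prod_i tnth (h f) i = (\prod_i (f i : nat))%N%:Z) ?absz_nat//.
  by rewrite (big_morph Posz PoszM (erefl _)); apply: eq_bigr => i _; rewrite tnth_mktuple.
rewrite (@reindex_fsbig _ _ _ _ _ h
  [set` [pred f : {ffun 'I_d -> 'I_M.+1} | coprime (\prod_i (f i : 'I_M.+1)) (primorial y)]]); last first.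
  split.
  - move=> f /= cf; split; last by rewrite hp.
    move=> i; rewrite hG tnth_mktuple ler0n /=.
    have : (f i : nat)%:R <= M%:R :> R by rewrite ler_nat -ltnS.
    by lra.
  - move=> f f' _ _ E; apply/ffunP => i; apply/val_inj.
    by have := congr1 (fun t => tnth t i) E; rewrite !tnth_mktuple => -[].
  move=> k [bk ck].
  have kM i : (absz (tnth k i) < M.+1)%N /\ 0 <= tnth k i.
    have := bk i; rewrite tnth_map => /andP[k0 kM]; rewrite ler0z in k0; split=> //.
    rewrite -(ltr_nat R) -[X in X < _]/((absz (tnth k i))%:Z%:~R) gez0_abs//.
    by rewrite -addn1 natrD; lra.
  pose f := [ffun i => Ordinal (kM i).1].
  have fk : h f = k.
    by apply: eq_from_tnth => i; rewrite tnth_mktuple ffunE /= gez0_abs//; case: (kM i).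
  have ck' : coprimez (\prod_i tnth (h f) i) (primorial y) by rewrite fk.
  by rewrite hp in ck'; exists f.
rewrite -(@bigfs _ _ _ _ (index_enum {ffun 'I_d -> 'I_M.+1})) ?index_enum_uniq//; last by move=> f _; rewrite mem_index_enum.
by apply: eq_bigr => f _; rewrite hG.
Qed.
End SievedBox.

Section Growth.
Variable R : realType.

Lemma powR_infty (A s : R) : 0 < s -> exists T0 : R, forall T, T0 <= T -> A <= T `^ s.
Proof.
move=> s0; exists (Num.max 0 (Num.max 0 A `^ s^-1)) => T; rewrite ge_max => /andP[T0 AT].
have [A0|A0] := leP A 0; first by apply: le_trans A0 (powR_ge0 _ _).
move: AT; rewrite (max_idPr (ltW A0)) => AT.
rewrite -[leLHS]powRr1 ?(ltW A0)// -(mulVf (lt0r_neq0 s0)) powRrM.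
by rewrite ge0_ler_powR ?nnegrE ?powR_ge0// ltW.
Qed.

(** A power of the logarithm is at most any positive power, and half of the
    exponent s is kept to beat the constants. *)
Lemma ln_pow_dominated (A eps s : R) k : 0 < eps -> 0 < s ->
  exists T0 : R, forall T, T0 <= T -> A * ln T ^+ k <= eps * T `^ s.
Proof.
move=> e0 s0; pose r := s / (2 * k.+1%:R).
have k0 : 0 < 2 * k.+1%:R :> R by rewrite mulr_gt0// ltr0n.
have r0 : 0 < r by rewrite divr_gt0.
have [T0 TP] := powR_infty (`|A| * r ^- k / eps) (divr_gt0 s0 (ltr0n R 2)).
exists (Num.max 1 T0) => T; rewrite ge_max => /andP[T1 /TP HT].
have Tp : 0 < T by apply: lt_le_trans T1.
have l0 : 0 <= ln T by rewrite ln_ge0.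
have lT : ln T <= r^-1 * T `^ r.
  rewrite -(ler_pM2l r0) mulVKf ?gt_eqF// -ln_powR ltW// ln_sublinear// powR_gt0//.
have lk : ln T ^+ k <= r ^- k * T `^ (s / 2).
  apply: (@le_trans _ _ ((r^-1 * T `^ r) ^+ k)); first by rewrite lerXn2r// nnegrE mulr_ge0 ?powR_ge0// invr_ge0 ltW.
  rewrite exprMn exprVn ler_wpM2l ?invr_ge0 ?exprn_ge0 ?(ltW r0)//.
  rewrite -powR_mulrn ?powR_ge0// -powRrM ler_powR// /r.
  rewrite mulrAC ler_pdivrMr// -mulrA ler_pM2l// mulrA mulVf// mul1r ler_nat.
  exact: leqnSn.
apply: (@le_trans _ _ (`|A| * (r ^- k * T `^ (s / 2)))).
  apply: le_trans (_ : `|A| * ln T ^+ k <= _); last by rewrite ler_wpM2l.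
  by rewrite ler_wpM2r ?exprn_ge0// ler_norm.
have -> : T `^ s = T `^ (s / 2) * T `^ (s / 2).
  by rewrite -powRD -?splitr//; apply/implyP => _; rewrite gt_eqF.
rewrite (mulrA `|A|) (mulrA eps) ler_wpM2r ?powR_ge0//.
by rewrite -ler_pdivrMl// mulrC.
Qed.
End Growth.

Section SievedSum.
Variable R : realType.

Definition sieved_sum d (M : nat) (y : R) (F : d.-tuple R -> R) : R :=
  \sum_(f : {ffun 'I_d -> 'I_M.+1} | coprime (\prod_i (f i : 'I_M.+1)) (primorial y))
    F [tuple (f i : nat)%:R | i < d].

(** The first term is the error of the sieve, the second that of smoothing. *)
Definition sieved_error d (C y : R) (M N : nat) (mu Lp E0 : R) : R :=
  C * y ^+ (4 * d * d + 4 * d + 1) * ln y * (N%:R ^+ d * E0 + mu * ((M%:R + 1) ^+ d.-1 * d%:R))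
  + (M%:R + 1) ^+ d * (Lp * (d%:R / N%:R)).

(** The sieve is applied to the samples, whose sums along q_i | k_i are known, and
    the samples are then replaced by the values of F. Only points without zero
    coordinate survive the sieve since 2 is among the primes. *)
Lemma sieved_sum_bounds d : (0 < d)%N -> exists y0 c C : R, [/\ 3 <= y0, 0 < c, 0 < C &
  forall y (M N : nat) (F : d.-tuple R -> R) (mu Fm Lp E0 : R),
  y0 <= y -> (2 <= N)%N -> 0 <= Lp -> 0 <= mu -> 0 <= E0 ->
  (forall t, 0 <= F t <= Fm) ->
  (forall s t, `|F s - F t| <= Lp * \sum_i `|tnth s i - tnth t i|) ->
  (forall a : d.-tuple R, `|\int[leb R d]_(t in box (M%:R + 1 / 2)) (cos (pairing a t) * (F t - mu))| <= E0) ->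
  c * (mu * M%:R ^+ d / ln y ^+ d) - sieved_error d C y M N mu Lp E0 <= sieved_sum M y F
   <= C * (mu * M%:R ^+ d / ln y ^+ d) + sieved_error d C y M N mu Lp E0].
Proof.
move=> d0; have [y0 [c [C [y3 c0 C0 sieve]]]] := sieve_bounds R d0.
exists y0, c, C; split => // y M N F mu Fm Lp E0 yy N2 Lp0 mu0 E00 FB FL Fchar.
have N0 : 0 < N%:R ^+ d :> R by rewrite exprn_gt0// ltr0n ltnW.
have y2 : 2 < y by apply: lt_le_trans yy; apply: lt_le_trans y3; rewrite ltr_nat.
pose a := sample N F : {ffun 'I_d -> 'I_M.+1} -> R.
pose E := E0 + mu * (N%:R ^- d * ((M%:R + 1) ^+ d.-1 * d%:R)).
pose P (f : {ffun 'I_d -> 'I_M.+1}) := coprime (\prod_i (f i : 'I_M.+1)) (primorial y).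
have M1 : 0 <= M%:R + 1 :> R by rewrite addr_ge0.
have E_ge0 : 0 <= E by rewrite addr_ge0// !mulr_ge0// ?invr_ge0 ?ltW// exprn_ge0.
have sieved : c * (mu * (M%:R ^+ d / N%:R ^+ d) / ln y ^+ d) - C * y ^+ (4 * d * d + 4 * d + 1) * ln y * E
   <= \sum_(f | P f) a f <=
   C * (mu * (M%:R ^+ d / N%:R ^+ d) / ln y ^+ d) + C * y ^+ (4 * d * d + 4 * d + 1) * ln y * E.
  apply: (sieve y yy _ (fun (f : {ffun 'I_d -> 'I_M.+1}) i => f i : nat)) => //.
  - exact: (sample_ge0 N FB).
  - by rewrite !mulr_ge0// ?invr_ge0 ?(ltW N0)// exprn_ge0.
  - by move=> q q0; exact: (sample_level N2 Lp0 mu0 FB FL Fchar q0).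
  - by move=> f; exact: coprime_prod_primorial.
have value f : P f -> `|a f - N%:R ^- d * F [tuple (f i : nat)%:R | i < d]| <=
    N%:R ^- d * (Lp * (d%:R / N%:R)).
  move=> /coprime_prod_primorial Pf; apply: (sample_value N2 Lp0 FB FL) => i.
  apply/eqP => f0; have := Pf 2%N i isT y2; rewrite f0 dvdn0 //.
set D := N%:R ^- d * (Lp * (d%:R / N%:R)) in value.
have D0 : 0 <= D by rewrite !mulr_ge0// ?invr_ge0// ltW.
have close : `|\sum_(f | P f) a f - N%:R ^- d * sieved_sum M y F| <= (M%:R + 1) ^+ d * D.
  rewrite /sieved_sum mulr_sumr -sumrB; apply: le_trans (ler_norm_sum _ _ _) _.
  apply: (@le_trans _ _ (\sum_(f : {ffun 'I_d -> 'I_M.+1}) D)).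
    by rewrite big_mkcond; apply: ler_sum => f _; case: ifP => // Pf; exact: value.
  by rewrite sumr_const card_ffun !card_ord -[X in X <= _]mulr_natl natrX -addn1 natrD.
have NK (u : R) : N%:R ^+ d * (N%:R ^- d * u) = u by rewrite mulVKf ?gt_eqF.
move: sieved close; rewrite ler_norml.
set W := \sum_(f | P f) a f; set V := sieved_sum M y F => /andP[lo hi] /andP[lo' hi'].
have eD : N%:R ^+ d * ((M%:R + 1) ^+ d * D) = (M%:R + 1) ^+ d * (Lp * (d%:R / N%:R)).
  by rewrite mulrCA /D NK.
have eE (k : R) : N%:R ^+ d * (k * E) = k * (N%:R ^+ d * E0 + mu * ((M%:R + 1) ^+ d.-1 * d%:R)).
  by rewrite mulrCA /E mulrDr (mulrCA _ mu) NK.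
have eY (k : R) : N%:R ^+ d * (k * (mu * (M%:R ^+ d / N%:R ^+ d) / ln y ^+ d)) =
    k * (mu * M%:R ^+ d / ln y ^+ d).
  by rewrite -[in RHS](NK (M%:R ^+ d)); ring.
move: lo hi lo' hi'.
rewrite -(ler_pM2l N0) mulrBr eY eE => lo.
rewrite -(ler_pM2l N0) mulrDr eY eE => hi.
rewrite -(ler_pM2l N0) mulrN mulrBr NK eD => lo'.
rewrite -(ler_pM2l N0) mulrBr NK eD => hi'.
rewrite /sieved_error; apply/andP; split; lra.
Qed.
End SievedSum.

(** * Choice of the parameters *)

Section Asymptotics.
Variable R : realType.

(** With N of size T^rho, every error is T^(d - rho) up to a constant and a
    logarithm. The condition on [beta] asks that the saving T^-beta of
    equidistribution pay for the number of terms of the sieve and for N^d, with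
    T^(d rho) left over. *)
Lemma error_bound d (alpha beta C mu Lp K rho T : R) (M N : nat) :
  (0 < d)%N -> 0 < alpha -> 0 <= C -> 0 <= mu -> 0 <= Lp -> 0 <= K ->
  alpha * (4 * d * d + 4 * d + 1)%:R + 2 * (d%:R * rho) <= beta -> beta < 1 -> 0 < rho ->
  T = M%:R + 1 / 2 -> 1 <= T -> 1 <= ln T -> T `^ rho <= N%:R <= 2 * T `^ rho ->
  sieved_error d C (T `^ alpha) M N mu Lp (T ^+ d * (K * T `^ (- beta))) <=
  (C * alpha * (2 ^+ d * K + mu * (2 ^+ d.-1 * d%:R)) + 2 ^+ d * (Lp * d%:R)) *
    (ln T * (T ^+ d * T `^ (- rho))).
Proof.
move=> d0 a0 C0 mu0 Lp0 K0 gap b1 r0 TM T1 L1 /andP[N1 N2].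
set La := (_ + 1)%N in gap *.
have T0 : 0 < T by apply: lt_le_trans T1.
have d1 : 1 <= d%:R :> R by rewrite ler1n.
have yL : (T `^ alpha) ^+ La = T `^ (alpha * La%:R).
  by rewrite -powR_mulrn ?powR_ge0// -powRrM.
have yln : ln (T `^ alpha) = alpha * ln T by rewrite ln_powR.
have q0 : 0 < T `^ rho by rewrite powR_gt0.
have N0 : 0 < N%:R :> R by apply: lt_le_trans N1.
have powD (u v : R) : T `^ (u + v) = T `^ u * T `^ v.
  by rewrite powRD//; apply/implyP => _; rewrite gt_eqF.
have M1 : M%:R + 1 <= 2 * T by rewrite TM; have : 0 <= M%:R :> R by []; lra.
have M10 : 0 <= M%:R + 1 :> R by rewrite addr_ge0.
have D0 : 0 < T ^+ d by rewrite exprn_gt0.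
have l0 : 0 <= ln T by apply: le_trans L1.
have drho : rho <= d%:R * rho by rewrite ler_peMl// ltW.
have t1 : T `^ (alpha * La%:R) * (N%:R ^+ d * (T ^+ d * (K * T `^ (- beta)))) <=
    2 ^+ d * K * (T ^+ d * T `^ (- rho)).
  apply: (@le_trans _ _ (T `^ (alpha * La%:R) * ((2 * T `^ rho) ^+ d * (T ^+ d * (K * T `^ (- beta)))))).
    rewrite ler_wpM2l ?powR_ge0// ler_wpM2r ?mulr_ge0 ?powR_ge0 ?(ltW D0)//.
    by rewrite lerXn2r// nnegrE ?mulr_ge0 ?(ltW q0).
  rewrite exprMn -[(T `^ rho) ^+ d]powR_mulrn ?powR_ge0// -powRrM.
  rewrite [leLHS](_ : _ = 2 ^+ d * K * (T ^+ d * (T `^ (alpha * La%:R) * T `^ (rho * d%:R) * T `^ (- beta)))); last by ring.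
  rewrite ler_wpM2l ?mulr_ge0 ?exprn_ge0// ler_wpM2l ?(ltW D0)// -!powD ler_powR//.
  by rewrite [rho * _]mulrC; lra.
have t2 : T `^ (alpha * La%:R) * (mu * ((M%:R + 1) ^+ d.-1 * d%:R)) <=
    mu * (2 ^+ d.-1 * d%:R) * (T ^+ d * T `^ (- rho)).
  apply: (@le_trans _ _ (T `^ (alpha * La%:R) * (mu * ((2 * T) ^+ d.-1 * d%:R)))).
    rewrite ler_wpM2l ?powR_ge0// ler_wpM2l// ler_wpM2r// lerXn2r// nnegrE ?mulr_ge0 ?(ltW T0)//.
  have -> : T ^+ d = T ^+ d.-1 * T by rewrite -exprSr prednK.
  rewrite exprMn [leLHS](_ : _ = mu * (2 ^+ d.-1 * d%:R) * (T ^+ d.-1 * T `^ (alpha * La%:R))); last by ring.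
  apply: ler_wpM2l; first by rewrite !mulr_ge0// exprn_ge0.
  rewrite -mulrA; apply: ler_wpM2l; first by rewrite exprn_ge0// ltW.
  by rewrite -{2}[T]powRr1 ?(ltW T0)// -powD ler_powR//; lra.
have t3 : (M%:R + 1) ^+ d * (Lp * (d%:R / N%:R)) <= 2 ^+ d * (Lp * d%:R) * (T ^+ d * T `^ (- rho)).
  apply: (@le_trans _ _ ((2 * T) ^+ d * (Lp * (d%:R * T `^ (- rho))))).
    apply: ler_pM; rewrite ?exprn_ge0 ?mulr_ge0 ?divr_ge0//.
      by rewrite lerXn2r// nnegrE ?mulr_ge0 ?(ltW T0).
    by rewrite ler_wpM2l// ler_wpM2l// powRN lef_pV2 ?posrE.
  by rewrite exprMn le_eqVlt; apply/orP; left; apply/eqP; ring.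
rewrite /sieved_error -/La yL yln.
set A := T `^ (alpha * La%:R) in t1 t2 *; set W := T ^+ d * T `^ (- rho) in t1 t2 t3 *.
set U := N%:R ^+ d * _ in t1 *; set V := mu * (_ * _) in t2 *.
have W0 : 0 <= W by rewrite mulr_ge0 ?powR_ge0 ?(ltW D0).
rewrite mulrDl lerD//.
  rewrite [leLHS](_ : _ = C * alpha * ln T * (A * U + A * V)); last by ring.
  rewrite [leRHS](_ : _ = C * alpha * ln T * (2 ^+ d * K * W + mu * (2 ^+ d.-1 * d%:R) * W)); last by ring.
  by rewrite ler_wpM2l ?lerD// !mulr_ge0// ltW.
apply: le_trans t3 _; apply: ler_wpM2l; first by rewrite mulr_ge0 ?exprn_ge0 ?mulr_ge0.
by rewrite ler_peMl.
Qed.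

(** The constants depend only on d and alpha: f enters the error terms through
    its bounds, but a power of T is saved, so they are eventually smaller than
    half of the main term, which has size mu (T / ln T)^d. *)
Lemma sieved_sum_asymptotics d (alpha : R) : (0 < d)%N -> 0 < alpha ->
  exists c1 c2 : R, [/\ 0 < c1, 0 < c2 & forall beta : R,
  alpha * (4 * d * d + 4 * d + 1)%:R < beta -> beta < 1 ->
  forall (F : d.-tuple R -> R) (mu Fm Lp K : R), 0 <= Lp -> 0 < mu -> 0 <= K ->
  (forall t, 0 <= F t <= Fm) ->
  (forall s t, `|F s - F t| <= Lp * \sum_i `|tnth s i - tnth t i|) ->
  exists T0 : R, forall (M : nat) (T : R), T = M%:R + 1 / 2 -> T0 <= T ->
  (forall a : d.-tuple R, `|\int[leb R d]_(t in box T) (cos (pairing a t) * (F t - mu))| <=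
     T ^+ d * (K * T `^ (- beta))) ->
  c1 * ((T / ln T) ^+ d * mu) <= sieved_sum M (T `^ alpha) F <= c2 * ((T / ln T) ^+ d * mu)].
Proof.
move=> d0 a0; have [y0 [c [C [y3 c0 C0 sieve]]]] := sieved_sum_bounds R d0.
pose eps : R := c / (2 * alpha) ^+ d / 2.
have eps0 : 0 < eps by rewrite !divr_gt0// exprn_gt0// mulr_gt0.
exists eps, (C / alpha ^+ d + eps); split=> //.
  by rewrite addr_gt0// divr_gt0// exprn_gt0.
move=> beta gap b1 F mu Fm Lp K Lp0 mu0 K0 FB FL.
(* half of the available saving is spent on smoothing *)
pose rho := (beta - alpha * (4 * d * d + 4 * d + 1)%:R) / (2 * d%:R).
have dR : 0 < d%:R :> R by rewrite ltr0n.
have rho0 : 0 < rho by rewrite divr_gt0 ?subr_gt0// mulr_gt0.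
have rhoE : alpha * (4 * d * d + 4 * d + 1)%:R + 2 * (d%:R * rho) <= beta.
  have -> : 2 * (d%:R * rho) = beta - alpha * (4 * d * d + 4 * d + 1)%:R.
    by rewrite mulrA mulrC divfK// gt_eqF// mulr_gt0.
  by rewrite addrC subrK.
pose A := C * alpha * (2 ^+ d * K + mu * (2 ^+ d.-1 * d%:R)) + 2 ^+ d * (Lp * d%:R).
have [T1 T1P] := ln_pow_dominated A d.+1 (mulr_gt0 eps0 mu0) rho0.
have [T2 T2P] := powR_infty y0 a0.
exists (Num.max (expR 1) (Num.max T1 T2)) => M T TM; rewrite !ge_max => /and3P[Te /T1P HA /T2P Hy] Fchar.
have T0 : 0 < T by apply: lt_le_trans Te; exact: expR_gt0.
have Tge1 : 1 <= T by apply: le_trans Te; rewrite -[leLHS]expR0 ler_expR.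
have L1 : 1 <= ln T by rewrite -ler_expR lnK ?posrE.
have L0 : 0 < ln T by apply: lt_le_trans L1.
pose N := (Num.truncn (T `^ rho)).+1.
have q1 : 1 <= T `^ rho by rewrite -[leLHS](powRr0 T) ler_powR// ltW.
have /andP[n1 n2] := truncn_itv (powR_ge0 T rho).
have NT : T `^ rho <= N%:R <= 2 * T `^ rho by rewrite (ltW n2) /N -addn1 natrD; lra.
have N2 : (2 <= N)%N by rewrite ltnS truncn_gt0.
have E00 : 0 <= T ^+ d * (K * T `^ (- beta)) by rewrite !mulr_ge0 ?powR_ge0 ?exprn_ge0 ?(ltW T0).
rewrite TM in Fchar.
have := sieve (T `^ alpha) M N F mu Fm Lp _ Hy N2 Lp0 (ltW mu0) E00 FB FL.
rewrite TM in E00 *; move=> /(_ Fchar); rewrite -TM.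
have err := error_bound d0 a0 (ltW C0) (ltW mu0) Lp0 K0 rhoE b1 rho0 TM Tge1 L1 NT.
rewrite ln_powR; set Err := sieved_error _ _ _ _ _ _ _ _ in err *.
have errB : Err <= eps * ((T / ln T) ^+ d * mu).
  apply: le_trans err _; rewrite -/A.
  rewrite -(ler_pM2r (_ : 0 < ln T ^+ d * T `^ rho)); last by rewrite mulr_gt0 ?exprn_gt0// (lt_le_trans _ q1).
  rewrite [leLHS](_ : _ = A * ln T ^+ d.+1 * T ^+ d * (T `^ rho * T `^ (- rho))); last by rewrite exprS; ring.
  rewrite powRN mulfV ?mulr1; last by rewrite gt_eqF// powR_gt0.
  rewrite [leRHS](_ : _ = eps * mu * T `^ rho * T ^+ d * (ln T ^+ d / ln T ^+ d)); last by rewrite expr_div_n; ring.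
  by rewrite mulfV ?expf_neq0 ?gt_eqF// mulr1 ler_wpM2r// exprn_ge0// ltW.
have M2 : T / 2 <= M%:R <= T.
  by have : 1 <= T by []; rewrite TM; lra.
have Ld0 : 0 < ln T ^+ d by rewrite exprn_gt0.
have ad0 : 0 < alpha ^+ d by rewrite exprn_gt0.
have lo : 2 * eps * ((T / ln T) ^+ d * mu) <= c * (mu * M%:R ^+ d / (alpha * ln T) ^+ d).
  have -> : 2 * eps * ((T / ln T) ^+ d * mu) = c * (mu * (T / 2) ^+ d / (alpha * ln T) ^+ d).
    rewrite /eps !exprMn !exprVn; field.
    by rewrite !expf_neq0 ?gt_eqF.
  rewrite ler_wpM2l ?(ltW c0)// ler_wpM2r ?invr_ge0 ?exprn_ge0 ?mulr_ge0 ?(ltW a0) ?(ltW L0)//.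
  rewrite ler_wpM2l ?(ltW mu0)// lerXn2r ?nnegrE//; last by case/andP: M2.
  by rewrite divr_ge0// ltW.
have hi : C * (mu * M%:R ^+ d / (alpha * ln T) ^+ d) <= C / alpha ^+ d * ((T / ln T) ^+ d * mu).
  have -> : C / alpha ^+ d * ((T / ln T) ^+ d * mu) = C * (mu * T ^+ d / (alpha * ln T) ^+ d).
    rewrite !exprMn !exprVn; field.
    by rewrite !expf_neq0 ?gt_eqF.
  rewrite ler_wpM2l ?(ltW C0)// ler_wpM2r ?invr_ge0 ?exprn_ge0 ?mulr_ge0 ?(ltW a0) ?(ltW L0)//.
  rewrite ler_wpM2l ?(ltW mu0)// lerXn2r ?nnegrE ?(ltW T0)//; by case/andP: M2.
move=> /andP[lb ub]; apply/andP; split.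
  by apply: le_trans lb; move: lo errB; lra.
by apply: le_trans ub _; rewrite mulrDl lerD.
Qed.
End Asymptotics.

(** * From the Diophantine condition to the sifted sum *)

Section Dynamics.
Variables (R : realType) (n d : nat) (phi : 'I_d -> 'I_n * 'I_n).

Lemma normc_ge_real (z : R[i]) : `|complex.Re z| <= Normc.normc z.
Proof. by case: z => u v /=; rewrite -sqrtr_sqr ler_wsqrtr// lerDl sqr_ge0. Qed.

(** The real part of the equidistribution hypothesis; the Sobolev norm is finite
    and gets absorbed into a constant depending on f. *)
Lemma char_estimate (B : seq 'M[R]_n) (mX : probability (borelX R n) R) (b : R) :
  basis_of (slv R n) B -> equidistribution_exponent phi B mX b ->
  exists C : R, forall f : lattices R n -> R, Cc_smooth f -> exists2 K : R, 0 <= K &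
  forall (T S : R) x (a : d.-tuple R), 0 < T -> C < S -> S < T -> Dio phi T S x ->
  `|\int[leb R d]_(t in box T) (cos (pairing a t) *
      (f (act x (horo phi t)) - \int[mX]_y f y))| <= T ^+ d * (K * S `^ (- b)).
Proof.
move=> hB [_ [C [K [C0 K0 H]]]]; exists C => f cf.
have [Sob Sob0 SobP] := sobolev_bounded mX (n * n.-1)./2 hB cf.
exists (K * Sob); first by rewrite mulr_ge0// ltW.
move=> T S x a T0 CS ST dx.
have Td : 0 < T ^+ d by rewrite exprn_gt0.
have /le_trans : ((Normc.normc ((T ^+ d)^-1%:C%C *
        int_box T (fun t => additive_char a t *
          (f (act x (horo phi t)) - \int[mX]_y f y)%:C%C)))%:E
     <= (K * S `^ (- b))%:E * Sob%:E)%E.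
  apply: le_trans (H T S x f a CS ST dx cf) _.
  by rewrite lee_pmul2l// lte_fin mulr_gt0// powR_gt0// (lt_trans C0).
move=> /(_ _ (lexx _)); rewrite -EFinM lee_fin => Hn.
rewrite -ler_pdivrMl//.
have -> : K * Sob * S `^ (- b) = K * S `^ (- b) * Sob by rewrite mulrAC.
apply: le_trans Hn; apply: le_trans (normc_ge_real _).
rewrite /= mul0r subr0 normrM ger0_norm ?invr_ge0 ?(ltW Td)//.
rewrite ler_wpM2l ?invr_ge0 ?(ltW Td)//.
rewrite le_eqVlt; apply/orP; left; apply/eqP; congr `| _ |.
apply: eq_Rintegral => t _; rewrite /additive_char /= mulr0 subr0 //.
Qed.

Lemma dio_monotone (T T' S : R) x : T <= T' -> Dio phi T S x -> Dio phi T' S x.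
Proof.
move=> TT [g -> H]; exists g => // w /H[t bt Ht]; exists t => // k.
by have /andP[t0 tT] := bt k; rewrite t0 (le_trans tT).
Qed.

(** Rounding the good times up to half-integers changes them by a bounded factor,
    which is harmless since theta d / n < delta. *)
Lemma strongly_dio (delta theta : R) x : (0 < n)%N -> (0 < d)%N -> 0 < theta -> 0 < delta ->
  theta * (d%:R / n%:R) < delta -> strongly_poly_dio phi delta x ->
  exists M : nat -> nat, (M i)%:R + 1 / 2 @[i --> \oo] --> (+oo : set_system R) /\
    forall i, let T := (M i)%:R + 1 / 2 in Dio phi T (T `^ theta) x.
Proof.
move=> n0 d0 th0 de0 gap [g -> [T Toy Tdio]].
have e0 : 0 < delta - theta * (d%:R / n%:R) by rewrite subr_gt0.
have [T0 T0P] := powR_infty (2 `^ delta) e0.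
have : \forall i \near \oo, Num.max 2 T0 < T i by move/cvgryPgt : Toy; apply.
case=> i0 _ i0P.
exists (fun i => (Num.truncn (T (i + i0)%N)).+1); split.
  apply/cvgryPge => A.
  have : \forall i \near \oo, A <= T i by move/cvgryPge : Toy; apply.
  case=> i1 _ i1P; exists i1 => // i /= i1i.
  have Ai : A <= T (i + i0)%N by apply: i1P => /=; rewrite (leq_trans i1i)// leq_addr.
  apply: le_trans Ai _; apply: le_trans (ltW (truncnS_gt _)) _.
  by rewrite lerDl.
move=> i; set t := T (i + i0)%N.
have : Num.max 2 T0 < t by apply: i0P => /=; rewrite leq_addl.
rewrite gt_max => /andP[t2 tT0].
have t0 : 0 < t by apply: lt_trans t2.
have /andP[t1 t3] := truncn_itv (ltW t0).
set M := (Num.truncn t).+1 in t3 *.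
have tT : t <= M%:R + 1 / 2 by apply: le_trans (ltW t3) _; rewrite lerDl.
have Tt : M%:R + 1 / 2 <= 2 * t by rewrite /M -addn1 natrD; lra.
apply: (@dio_monotone t) => //; exists g => // w wI.
set T' := M%:R + 1 / 2 in tT Tt *.
have T'0 : 0 < T' by apply: lt_le_trans tT.
have lb : T' `^ (theta * (d%:R / n%:R)) <= t `^ delta.
  have h2 : 0 < 2 `^ delta :> R by rewrite powR_gt0.
  rewrite -(ler_pM2l h2) -powRM//; last exact: ltW.
  apply: (@le_trans _ _ (T' `^ delta)).
    rewrite -[delta in leRHS](subrK (theta * (d%:R / n%:R))) powRD; last by apply/implyP => _; rewrite gt_eqF.
    by rewrite ler_wpM2r ?powR_ge0// T0P// (le_trans (ltW tT0)).
  by rewrite ge0_ler_powR ?nnegrE ?(ltW de0) ?(ltW T'0) ?mulr_ge0 ?(ltW t0).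
have : ((t `^ delta)%:E < ereal_sup [set (wgu phi w g s)%:E | s in box t])%E.
  by apply: lt_le_trans (Tdio _) _; apply: ereal_inf_lbound; exists w.
move=> /ereal_sup_gt[_ [s bs <-]]; rewrite lte_fin => ws.
exists s => //; rewrite -powRrM; apply: le_trans lb (ltW ws).
Qed.
End Dynamics.

Theorem theorem5p2 (R : realType) (n m d : nat)
  (hn : (2 <= n)%N) (hm : (1 <= m < n)%N) (hd : d = (m * (n - m))%N)
  (phi : 'I_d -> 'I_n * 'I_n) (hphi : block_coords phi m)
  (B : seq 'M[R]_n) (hB : basis_of (slv R n) B)
  (mX : probability (borelX R n) R) (hmX : SL_invariant mX)
  (b : R) (hb : equidistribution_exponent phi B mX b)
  (delta alpha : R) (hdelta : 0 < delta)
  (halpha : 0 < alpha < delta * b * n%:R /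
     (9 * d%:R * (d%:R ^+ 2 + b * n%:R * (minn m (n - m))%:R))) :
  exists c1 c2 : R, [/\ 0 < c1, 0 < c2 &
    forall x0 : lattices R n, strongly_poly_dio phi delta x0 ->
    forall f : lattices R n -> R, Cc_smooth f -> (forall x, 0 <= f x) ->
    exists2 T : nat -> R, T i @[i --> \oo] --> +oo &
    forall i,
      let S := \sum_(k \in sieved_box (T i) (T i `^ alpha))
                 f (act x0 (horo phi (map_tuple (fun z : int => z%:~R) k))) in
      let M := (T i / ln (T i)) ^+ d * \int[mX]_x f x in
      c1 * M <= S <= c2 * M].
Proof.
have /andP[m0 mn] := hm.
have d0 : (0 < d)%N by rewrite hd muln_gt0 m0 subn_gt0.
have md : (m <= d)%N by rewrite hd leq_pmulr// subn_gt0.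
have n0 : (0 < n)%N by exact: leq_trans hn.
have dR : 0 < d%:R :> R by rewrite ltr0n.
have nR : 0 < n%:R :> R by rewrite ltr0n.
have /andP[a0 aB] := halpha; have /andP[b0 b1] := hb.1.
set La : nat := (4 * d * d + 4 * d + 1)%N.
have La9 : La%:R <= 9 * d%:R ^+ 2 :> R.
  rewrite -natrX -natrM ler_nat /La; nia.
(* 4 d^2 + 4 d + 1 <= 9 d^2, so the bound on alpha puts the level of the sieve
   below the saving b theta for some theta < delta n / d *)
have gap : alpha * La%:R < b * (delta * n%:R / d%:R).
  set kap : R := (minn m (n - m))%:R in aB.
  have kap0 : 0 <= kap by [].
  have D0 : 0 < 9 * d%:R * (d%:R ^+ 2 + b * n%:R * kap).
    by rewrite !mulr_gt0// ltr_pwDl ?exprn_gt0// !mulr_ge0// ltW.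
  rewrite ltr_pdivlMr// in aB.
  have aB' : alpha * (9 * d%:R ^+ 2) * d%:R < b * (delta * n%:R).
    apply: le_lt_trans (_ : alpha * (9 * d%:R * (d%:R ^+ 2 + b * n%:R * kap)) < _).
      rewrite -mulrA ler_wpM2l ?(ltW a0)// mulrAC -mulrA -mulrA -mulrA.
      apply: ler_wpM2l => //; apply: ler_wpM2l; first exact: ltW.
      by rewrite lerDl !mulr_ge0// ltW.
    by rewrite (_ : b * (delta * n%:R) = delta * b * n%:R) //; ring.
  rewrite mulrA ltr_pdivlMr//; apply: le_lt_trans aB'.
  by rewrite ler_wpM2r ?(ltW dR)// ler_wpM2l// ltW.
pose theta := (alpha * La%:R / b + delta * n%:R / d%:R) / 2.
have gap' : alpha * La%:R / b < delta * n%:R / d%:R by rewrite ltr_pdivrMr// [X in _ < X]mulrC.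
have th1 : alpha * La%:R < b * theta.
  by rewrite -ltr_pdivrMl// mulrC /theta; lra.
have th0 : 0 < theta by rewrite -(pmulr_rgt0 _ b0); apply: lt_trans th1; rewrite mulr_gt0// ltr0n /La addn1.
have th2 : theta * (d%:R / n%:R) < delta.
  rewrite mulrA ltr_pdivrMr// -ltr_pdivlMr// /theta; lra.
have [c1 [c2 [c10 c20 asym]]] := sieved_sum_asymptotics d0 a0.
exists c1, c2; split => // x0 sd f cf f0.
(* since delta <= m / n, the exponent theta is below 1 and T^theta is an
   admissible radius *)
have dn : delta <= d%:R / n%:R.
  apply: le_trans (dio_exponent_le hn mn hphi sd) _.
  by rewrite ler_wpM2r ?invr_ge0 ?(ltW nR)// ler_nat.
have tlt1 : theta < 1.
  rewrite -(ltr_pM2r (divr_gt0 dR nR)) mul1r; exact: lt_le_trans th2 dn.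
set mu := \int[mX]_x f x.
have mu_ge0 : 0 <= mu by exact: Rintegral_ge0.
(* if f has integral 0 it vanishes identically and any sequence will do *)
have [mu0|mu_neq0] := eqVneq mu 0.
  exists (fun i => i%:R); first exact: cvgr_idn.
  move=> i /=; rewrite mu0 !mulr0 fsbig1 ?lexx// => k _.
  exact: (integral_eq0_eq0 hmX cf f0 mu0).
have mu_gt0 : 0 < mu by rewrite lt_neqAle eq_sym mu_neq0.
have [Fm Fm0 FmP] := smooth_bounded cf.
have [Lp Lp0 LpP] := horo_lipschitz hphi cf.
have [C CP] := char_estimate hB hb.
have [K K0 KP] := CP f cf.
pose F (t : d.-tuple R) := f (act x0 (horo phi t)).
have [||T0 T0P] := asym (b * theta) th1 _ F mu Fm Lp K Lp0 mu_gt0 K0 _ (LpP x0).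
- by apply: lt_trans b1; rewrite gtr_pMr.
- by move=> t; rewrite /F f0 (le_trans (ler_norm _) (FmP _)).
have [T1 T1P] := powR_infty (`|C| + 1) th0.
have [M [Moy Mdio]] := strongly_dio n0 d0 th0 hdelta th2 sd.
have : \forall i \near \oo, Num.max 2 (Num.max T0 T1) <= (M i)%:R + 1 / 2 by move/cvgryPge : Moy; apply.
case=> i0 _ i0P.
exists (fun i => (M (i + i0)%N)%:R + 1 / 2).
  by rewrite (cvg_shiftn i0 (fun i => (M i)%:R + 1 / 2 : R)).
move=> i /=; set T := _ + 1 / 2.
have -> := sieved_box_sum (M (i + i0)%N) (T `^ alpha) F.
have : Num.max 2 (Num.max T0 T1) <= T by apply: i0P => /=; rewrite leq_addl.
rewrite !ge_max => /and3P[T2 TT0 TT1].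
apply: (T0P _ _ (erefl _) TT0) => a.
have T_gt0 : 0 < T by apply: lt_le_trans T2.
have -> : T `^ (- (b * theta)) = (T `^ theta) `^ (- b).
  by rewrite -powRrM mulrN (mulrC theta).
apply: KP => //.
- by apply: lt_le_trans (T1P _ TT1); apply: le_lt_trans (ler_norm C) _; rewrite ltrDl.
- rewrite -[X in _ < X](@lnK _ T) ?posrE// /powR gt_eqF// ltr_expR gtr_pMl// ln_gt0//.
  by apply: lt_le_trans T2; rewrite ltr1n.
Qed.
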